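(* Let $N\ge 6$ and consider the spin-$1/2$ chain on $N$ sites with periodic boundary conditions and Hamiltonian $$H=\sum_{i=1}^N \sum_{\alpha,\beta\in\{X,Y,Z\}} J_{\alpha\beta}\,\alpha_i\beta_{i+1}+\sum_{i=1}^N\sum_{\alpha\in\{X,Y,Z\}} h_\alpha\,\alpha_i ,$$ where $J_{\alpha\beta},h_\alpha$ are arbitrary real numbers with $J_{\alpha\beta}=J_{\beta\alpha}$ for all $\alpha,\beta$. Suppose that there is no global spin rotation $R\in SO(3)$ transforming $H$ into one of the following Hamiltonians (with arbitrary real parameters): (1) XXX: $\sum_i \big(J(X_iX_{i+1}+Y_iY_{i+1}+Z_iZ_{i+1})+hZ_i\big)$; (2) XXZ: $\sum_i \big(J_X(X_iX_{i+1}+Y_iY_{i+1})+J_ZZ_iZ_{i+1}+hZ_i\big)$; (3) XYZ: $\sum_i \big(J_XX_iX_{i+1}+J_YY_iY_{i+1}+J_ZZ_iZ_{i+1}\big)$; (4) XY: $\sum_i \big(J_XX_iX_{i+1}+J_YY_iY_{i+1}+h_ZZ_i\big)$; (5) transverse-field Ising: $\sum_i \big(J_ZZ_iZ_{i+1}+h_XX_i\big)$; (6) longitudinal-field Ising: $\sum_i \big(J_ZZ_iZ_{i+1}+h_ZZ_i\big)$; (7) free spins: $\sum_i h_ZZ_i$. Then for every integer $k$ with $3\le k\le N/2$, $H$ has no $k$-support conserved quantity.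
   Context: $X_i,Y_i,Z_i$ denote the Pauli matrices $\sigma^x,\sigma^y,\sigma^z$ acting on site $i$; site $N+1$ is identified with site $1$ (periodic boundary). A global spin rotation by $R\in SO(3)$ replaces $(X_i,Y_i,Z_i)^T$ by $R\,(X_i,Y_i,Z_i)^T$ simultaneously on every site (equivalently, conjugation of $H$ by the corresponding product unitary $U^{\otimes N}$). An operator is a $k$-support operator if it acts nontrivially only on $k$ consecutive sites of the ring (and not on fewer consecutive sites). An operator is a $k$-support quantity if it can be written as a sum of $l$-support operators with $l\le k$ but cannot be written as a sum of $l$-support operators with $l\le k-1$. A $k$-support conserved quantity is a $k$-support quantity commuting with $H$. *)

(* Defs.v *)
(* real numbers R : realType (mathcomp-analysis), complex
   numbers R[i] (mathcomp-real-closed), operators on the N-qubit Hilbert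
   space (C^2)^{\otimes N} as 'M[R[i]]_(2^N).
   Computational basis index a : 'I_(2^N); the state of site j (0-based)
   is bit j of a (false = |0>, true = |1>, Z|0> = |0>). *)
From HB Require Import structures.
From mathcomp Require Import all_boot all_order all_algebra.
From mathcomp Require Import reals complex.
Set Implicit Arguments.
Unset Strict Implicit.
Unset Printing Implicit Defensive.
Import Order.TTheory GRing.Theory Num.Theory.
Local Open Scope ring_scope.
Local Open Scope complex_scope.

Section Spin.
Variable R : realType.
Local Notation C := (R[i]).

Definition op (N : nat) := 'M[C]_(2 ^ N).

(* bit j of basis index a = local state of site j *)
Definition bit (N : nat) (j : 'I_N) (a : 'I_(2 ^ N)) : bool := odd (a %/ 2 ^ j).

(* single-spin Pauli matrices; index 0 = X, 1 = Y, 2 = Z *)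
Definition pauli (al : 'I_3) (r c : bool) : C :=
  match val al with
  | 0 => if r != c then 1 else 0
  | 1 => if r != c then (if r then 'i else - 'i) else 0
  | _ => if r == c then (if r then -1 else 1) else 0
  end.

Definition sig (N : nat) (al : 'I_3) (i : 'I_N) : op N :=
  \matrix_(r, c) (pauli al (bit i r) (bit i c) *
     (([forall j : 'I_N, (j != i) ==> (bit j r == bit j c)]) : nat)%:R).

Definition nxt (N : nat) (i : 'I_N) : 'I_N := ordS i.

Definition hamil (N : nat) (s : 'I_3 -> 'I_N -> op N)
  (J : 'M[R]_3) (h : 'I_3 -> R) : op N :=
  \sum_(i : 'I_N)
    ((\sum_(al : 'I_3) \sum_(be : 'I_3) (J al be)%:C *: (s al i *m s be (nxt i)))
     + \sum_(al : 'I_3) (h al)%:C *: s al i).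

Definition H (N : nat) (J : 'M[R]_3) (h : 'I_3 -> R) : op N := hamil (@sig N) J h.

Definition SO3 (Q : 'M[R]_3) : Prop := Q^T *m Q = 1%:M /\ \det Q = 1.

(* global spin rotation: (X_i,Y_i,Z_i)^T is replaced by Q (X_i,Y_i,Z_i)^T on
   every site, i.e. sigma^al_i |-> sum_be Q al be sigma^be_i *)
Definition rsig (N : nat) (Q : 'M[R]_3) (al : 'I_3) (i : 'I_N) : op N :=
  \sum_(be : 'I_3) (Q al be)%:C *: sig be i.

Definition rotH (N : nat) (Q : 'M[R]_3) (J : 'M[R]_3) (h : 'I_3 -> R) : op N :=
  hamil (rsig Q) J h.

Definition cJ (jx jy jz : R) : 'M[R]_3 :=
  \matrix_(a, b) (if a == b then
                    (if val a == 0%N then jx else if val a == 1%N then jy else jz)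
                  else 0).
Definition cvec (hx hy hz : R) : 'I_3 -> R :=
  fun a => if val a == 0%N then hx else if val a == 1%N then hy else hz.

Definition is_special_model (N : nat) (K : op N) : Prop :=
     (exists J hz : R, K = H N (cJ J J J) (cvec 0 0 hz))
  \/ (exists JX JZ hz : R, K = H N (cJ JX JX JZ) (cvec 0 0 hz))
  \/ (exists JX JY JZ : R, K = H N (cJ JX JY JZ) (cvec 0 0 0))
  \/ (exists JX JY hz : R, K = H N (cJ JX JY 0) (cvec 0 0 hz))
  \/ (exists JZ hx : R, K = H N (cJ 0 0 JZ) (cvec hx 0 0))
  \/ (exists JZ hz : R, K = H N (cJ 0 0 JZ) (cvec 0 0 hz))
  \/ (exists hz : R, K = H N (cJ 0 0 0) (cvec 0 0 hz)).

Definition interval (N : nat) (i : 'I_N) (l : nat) : {set 'I_N} :=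
  [set j | [exists t : 'I_l, j == iter t (@nxt N) i]].

(* A acts (possibly trivially) only on the sites in S, i.e. A = A_S (x) Id *)
Definition acts_on (N : nat) (S : {set 'I_N}) (A : op N) : Prop :=
  (forall a b : 'I_(2 ^ N), (exists2 j, j \notin S & bit j a != bit j b) ->
       A a b = 0)
  /\ (forall a b c d : 'I_(2 ^ N),
        (forall j, j \in S -> bit j a = bit j c /\ bit j b = bit j d) ->
        (forall j, j \notin S -> bit j a = bit j b /\ bit j c = bit j d) ->
        A a b = A c d).

Definition within (N : nat) (l : nat) (A : op N) : Prop :=
  (l = 0%N /\ acts_on set0 A) \/ exists i : 'I_N, acts_on (interval i l) A.

Definition ksupp_op (N : nat) (k : nat) (A : op N) : Prop :=
  within k A /\ forall l, (l < k)%N -> ~ within l A.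

Definition sum_supp_le (N : nat) (k : nat) (Q : op N) : Prop :=
  exists s : seq (op N),
    (forall A, A \in s -> exists2 l, (l <= k)%N & ksupp_op l A) /\
    Q = \sum_(A <- s) A.

Definition ksupp_quantity (N : nat) (k : nat) (Q : op N) : Prop :=
  sum_supp_le k Q /\ ~ sum_supp_le k.-1 Q.

Definition ksupp_conserved (N : nat) (K : op N) (k : nat) (Q : op N) : Prop :=
  ksupp_quantity k Q /\ Q *m K = K *m Q.

End Spin.

(* Main.v *)
(* Rotate so that J = diag(J_X, J_Y, J_Z) and expand a conserved quantity A in
   Pauli strings: [A, H] = 0 becomes one linear relation between the
   coefficients of A for every target string.  For 2k <= N the targets of
   support k+1 only involve the coefficients q of support k, and those of support
   k only involve q and the coefficients p of support k-1.

   J of rank 3.  The targets of support k+1 force q to be a multiple la of the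
   iterated commutator B = [h_1, [h_2, ... h_{k-1}]] of the bond operators.  Among
   the targets of support k without identity factor the interactions inside
   the support drop out; peeling off one bond at a time, these relations descend
   to (k-1) la [h, field] = 0, and [h, field] = 0 means XXX, XXZ or XYZ.

   J of rank 2 (J_Z = 0).  Only the strings a Z...Z b with a, b in {X, Y} survive
   in q.  A transverse field puts a letter X or Y on an inner site; following
   this marked letter along the chain expresses p through q with a coefficient
   growing linearly, and the two ends of the chain give (k-1) q = 0.

   J of rank 1 (J_Z only, field in the XZ plane).  Only Z X...X Y, Y X...X Z
   and Z X...X Z survive in q.  The same walk of a marked letter, first with
   the targets of support k, then also with those of support k-1, gives
   (k-1) q = 0 for the first two and (2k-3) q = 0 for the last one. *)
Require Import Defs.
From HB Require Import structures.
From mathcomp Require Import all_boot all_order all_algebra.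
From mathcomp Require Import reals complex boolp polyrcf.
From mathcomp Require Import ring lra zify.
Set Implicit Arguments.
Unset Strict Implicit.
Unset Printing Implicit Defensive.
Import Order.TTheory GRing.Theory Num.Theory.
Local Open Scope ring_scope.

(** * Pauli letters *)

(** A target of support n is reached from strings of support n - 1, n and n + 1, so the relations do
    not close: coefficients of support k - 1 must be eliminated before support k can be settled. In
    ranks one and two this works because a string of support k - 1 is reached both from a target
    extending it to the left and from one extending it to the right. The two relations differ by a
    field term that accumulates along the chain; this is the origin of the integer factors. The
    algebra is kept apart from the operators by [conserved_coeffs], a list of real linear relations;
    the complex coefficients of an operator enter through their real and imaginary parts. A rotation
    acts on the Pauli matrices, which keep their multiplication table, so that no unitary has to be
    constructed. Every case ends either in one of the excluded models, against the assumption, or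
    with all coefficients of support k equal to zero; the quantity is then a sum of operators of
    support at most k - 1, against the definition of a [k]-support quantity. *)

Inductive letter := LI | LX | LY | LZ.

Definition letter_code (x : letter) : nat :=
  match x with LI => 0 | LX => 1 | LY => 2 | LZ => 3 end.

Definition letter_decode (n : nat) : letter :=
  match n with 0 => LI | 1 => LX | 2 => LY | _ => LZ end.

Lemma letter_codeK : cancel letter_code letter_decode.
Proof. by case. Qed.

HB.instance Definition _ := Countable.copy letter (can_type letter_codeK).

Lemma letter_enumP : Finite.axiom [:: LI; LX; LY; LZ].
Proof. by case. Qed.

HB.instance Definition _ := isFinite.Build letter letter_enumP.

(* Product of Pauli matrices up to phase. *)
Definition lmul (a x : letter) : letter :=
  match a, x with
  | LI, y | y, LI => y
  | LX, LX | LY, LY | LZ, LZ => LI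
  | LX, LY | LY, LX => LZ
  | LY, LZ | LZ, LY => LX
  | LZ, LX | LX, LZ => LY
  end.

Section Letters.
Variable R : comNzRingType.

(* [a, x] = 2i * lsgn a x * (lmul a x) *)
Definition lsgn (a x : letter) : R :=
  match a, x with
  | LX, LY | LY, LZ | LZ, LX => 1
  | LY, LX | LZ, LY | LX, LZ => -1
  | _, _ => 0
  end.

Definition lcom (a x : letter) : bool := (x == LI) || (x == a).

(* [a a, x y] = 2i * bsgn a x y * (lmul a x)(lmul a y) *)
Definition bsgn (a x y : letter) : R :=
  lsgn a x * (lcom a y)%:R + (lcom a x)%:R * lsgn a y.

Definition sum3 (F : letter -> R) : R := F LX + F LY + F LZ.

Lemma eq_sum3 F G : (forall a, a != LI -> F a = G a) -> sum3 F = sum3 G.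
Proof. by move=> FG; rewrite /sum3 !FG. Qed.

Lemma sum3_eq0 F : (forall a, a != LI -> F a = 0) -> sum3 F = 0.
Proof. by move=> F0; rewrite /sum3 !F0 // !addr0. Qed.

Lemma sum3D F G : sum3 (fun a => F a + G a) = sum3 F + sum3 G.
Proof. by rewrite /sum3; ring. Qed.

Lemma sum3_only F b : b != LI -> (forall a, a != LI -> a != b -> F a = 0) ->
  sum3 F = F b.
Proof.
case: b => // _ F0; rewrite /sum3.
- by rewrite (F0 LY) // (F0 LZ) // !addr0.
- by rewrite (F0 LX) // (F0 LZ) // add0r addr0.
- by rewrite (F0 LX) // (F0 LY) // !add0r.
Qed.

Lemma sum_nat_only (F : nat -> R) n t0 : (t0 < n)%N ->
  (forall t, (t < n)%N -> t != t0 -> F t = 0) -> \sum_(0 <= t < n) F t = F t0.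
Proof.
move=> lt F0; rewrite big_mkord (bigD1 (Ordinal lt)) //= big1 ?addr0 // => t nt.
by apply: F0; rewrite ?ltn_ord.
Qed.

Lemma sum_nat_eq0 (F : nat -> R) n :
  (forall t, (t < n)%N -> F t = 0) -> \sum_(0 <= t < n) F t = 0.
Proof. by move=> F0; rewrite big_nat big1 // => t /andP[_ /F0]. Qed.

Lemma lsgn_self a : lsgn a a = 0. Proof. by case: a. Qed.

Lemma lsgnI a : lsgn a LI = 0. Proof. by case: a. Qed.

Lemma lsgnN a x : lsgn a (lmul a x) = - lsgn a x.
Proof. by case: a; case: x; rewrite /= ?oppr0 ?opprK. Qed.

Lemma lsgnC a x : lsgn a x = - lsgn x a.
Proof. by case: a; case: x; rewrite /= ?oppr0 ?opprK. Qed.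

End Letters.

Lemma lmulK a : involutive (lmul a).
Proof. by case: a; case. Qed.

Lemma lmul_neqI a x : x != a -> lmul a x != LI.
Proof. by case: a; case: x. Qed.

Lemma lmulIr a : lmul a LI = a. Proof. by case: a. Qed.

Lemma lmulxx a : lmul a a = LI. Proof. by case: a. Qed.

Lemma lmulC a x : lmul a x = lmul x a. Proof. by case: a; case: x. Qed.

Definition planar (x : letter) := (x == LX) || (x == LY).

Lemma planarP x : x != LI -> ~~ planar x -> x = LZ.
Proof. by case: x. Qed.

Lemma planarI x : planar x -> x != LI. Proof. by case: x. Qed.

Definition upd T (f : nat -> T) (t : nat) (z : T) : nat -> T :=
  fun u => if u == t then z else f u.

Definition scons T (x : T) (f : nat -> T) : nat -> T :=
  fun t => if t is t'.+1 then f t' else x.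

(** As [lmul a] is an involution, the string that a term of the Hamiltonian carries to the target
    [f] is that term times [f]: one letter changes for a field, two for a bond. *)
Definition mul1 (f : nat -> letter) t a := upd f t (lmul a (f t)).
Definition mul2 (f : nat -> letter) t a :=
  upd (upd f t (lmul a (f t))) t.+1 (lmul a (f t.+1)).

Lemma mul1E f t a u : mul1 f t a u = if u == t then lmul a (f u) else f u.
Proof. by rewrite /mul1 /upd; case: eqP => // ->. Qed.

Lemma mul2E f t a u :
  mul2 f t a u = if (u == t) || (u == t.+1) then lmul a (f u) else f u.
Proof.
rewrite /mul2 /upd; case: (eqVneq u t.+1) => [->|_]; first by rewrite orbT.
by rewrite orbF; case: eqP => // ->.
Qed.

Definition fill n (al x be : letter) (u : nat) :=
  if u == 0%N then al else if u == n.-1 then be else x.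

Definition fill1 n (al : letter) (t : nat) (y x be : letter) (u : nat) :=
  if u == 0%N then al else if u == n.-1 then be else if u == t then y else x.

Lemma fill_last n al x be : (1 < n)%N -> fill n al x be n.-1 = be.
Proof. by move=> n1; rewrite /fill eqxx ifN //; lia. Qed.

Lemma fill1_last n al t y x be : (1 < n)%N -> fill1 n al t y x be n.-1 = be.
Proof. by move=> n1; rewrite /fill1 eqxx ifN //; lia. Qed.

Lemma fill1_mid n al t y x be : (0 < t < n.-1)%N -> fill1 n al t y x be t = y.
Proof. by move=> tn; rewrite /fill1 eqxx !ifN //; lia. Qed.

(* [C i n f] stands for the coefficient of the Pauli string with letters
   [f 0, ..., f n.-1] on the sites [i, ..., i + n.-1] modulo [N].  [cc_comm] is the
   vanishing of the coefficient of the string [f] in the commutator with the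
   Hamiltonian, divided by 2i; the conditions [cc_supp*] are the part needed
   below of the fact that all strings fit in an interval of length [k]. *)
Record conserved_coeffs (R : realFieldType) (J h : letter -> R) (N k : nat)
    (C : nat -> nat -> (nat -> letter) -> R) : Prop := ConservedCoeffs {
  cc_ext : forall i n f g, (forall t, (t < n)%N -> f t = g t) -> C i n f = C i n g;
  cc_per : forall i n f, C (i + N)%N n f = C i n f;
  cc_shiftl : forall i n f, (n < N)%N -> f 0%N = LI ->
    C i n.+1 f = C i.+1 n (fun t => f t.+1);
  cc_shiftr : forall i n f, (n < N)%N -> f n = LI -> C i n.+1 f = C i n f;
  cc_supp1 : forall i f, f 0%N != LI -> f k != LI -> C i k.+1 f = 0;
  cc_supp2l : forall i f, f 0%N != LI -> f 1%N != LI -> f k.+1 != LI ->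
    C i k.+2 f = 0;
  cc_supp2r : forall i f, f 0%N != LI -> f k != LI -> f k.+1 != LI ->
    C i k.+2 f = 0;
  cc_comm : forall i n f, (2 <= n)%N -> (n <= N)%N -> f 0%N = LI -> f n.-1 = LI ->
    \sum_(0 <= t < n.-1) sum3 (fun a => J a * bsgn R a (f t) (f t.+1) *
                                        C i n (mul2 f t a))
    + \sum_(0 <= t < n) sum3 (fun a => h a * lsgn R a (f t) * C i n (mul1 f t a)) = 0
}.

(* [lia] on the arithmetic hypotheses only; the others slow it down. *)
Ltac nat_lia :=
  repeat match goal with
  | H : context [@eq_op _ ?x _] |- _ =>
    let T := type of x in tryif unify T nat then fail else clear H
  | H : @eq ?T _ _ |- _ => tryif (first [unify T nat | unify T bool]) then fail else clear H
  | H : forall _, _ |- _ => clear H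
  | H : conserved_coeffs _ _ _ _ _ |- _ => clear H
  end; lia.

Ltac case_nat_eqs :=
  repeat match goal with
  | |- context [@eq_op _ ?x ?y] =>
    let T := type of x in unify T nat; case: (eqVneq x y) => ?; try (by nat_lia)
  end.

(** * Relations between the coefficients of a conserved quantity *)

Section Levels.
Variables (R : realFieldType) (J h : letter -> R) (N k : nat).
Variable C : nat -> nat -> (nat -> letter) -> R.
Hypothesis CC : conserved_coeffs J h N k C.
Hypotheses (k3 : (3 <= k)%N) (kN : (2 * k <= N)%N).

(* The bond term [a a] on the sites [t, t.+1] maps the target [g] to a string that is
   shorter at one end. *)
Definition kills (g : nat -> letter) n t a :=
  ((t == 0%N) && (a == g 0%N)) || ((t == n.-2) && (a == g n.-1)).

(* Contributions to the target [g] on [i, i + n[ of strings with the same end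
   points. *)
Definition inner i n g : R :=
  \sum_(0 <= t < n.-1) sum3 (fun a => (~~ kills g n t a)%:R *
     (J a * bsgn R a (g t) (g t.+1) * C i n (mul2 g t a)))
  + \sum_(0 <= t < n) sum3 (fun a => h a * lsgn R a (g t) * C i n (mul1 g t a)).

Definition killl i n g : R :=
  J (g 0%N) * lsgn R (g 0%N) (g 1%N)
  * C i.+1 n.-1 (fun t => upd g 1 (lmul (g 0%N) (g 1%N)) t.+1).

Definition killr i n g : R :=
  J (g n.-1) * lsgn R (g n.-1) (g n.-2)
  * C i n.-1 (upd g n.-2 (lmul (g n.-1) (g n.-2))).

Definition extl i n g : R :=
  sum3 (fun a => J a * lsgn R a (g 0%N) * C i n.+1 (scons a (mul1 g 0 a))).

Definition extr i n g : R :=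
  sum3 (fun a => J a * lsgn R a (g n.-1) * C i n.+1 (upd (mul1 g n.-1 a) n a)).


Lemma bsgn_self a x : bsgn R a a x = lsgn R a x.
Proof. by rewrite /bsgn lsgn_self /lcom eqxx orbT mul0r add0r mul1r. Qed.

Lemma bsgnC a x y : bsgn R a x y = bsgn R a y x.
Proof. by rewrite /bsgn; ring. Qed.

Lemma bsgnI a x : bsgn R a LI x = lsgn R a x.
Proof. by case: a; case: x => //=; rewrite /bsgn /= ?mul0r ?mul1r ?add0r. Qed.


Lemma bsgn_nz a x y : bsgn R a x y != 0 ->
  (lcom a x /\ y != LI /\ y != a /\ lcom a y = false) \/ (lcom a y /\ x != LI /\ x != a /\ lcom a x = false).
Proof. by case: a; case: x; case: y; rewrite /bsgn /= ?mul0r ?mulr0 ?addr0 ?eqxx //; auto. Qed.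

(** The target is padded by one identity on each side, because only the two bonds crossing its
    border can lengthen it. Bonds that cancel an end letter shorten it, and all other terms keep
    both ends. The padding starts at [i], hence the target at [i.+1]. *)
Lemma level i n g : (2 <= n)%N -> (n.+2 <= N)%N -> g 0%N != LI -> g n.-1 != LI ->
  extl i n g + extr i.+1 n g + killl i.+1 n g + killr i.+1 n g + inner i.+1 n g = 0.
Proof.
move=> n2 nN g0 gl.
case: n n2 nN gl => [//|[//|m]] _ nN /= gl.
have [f [f0 fg fl]] : exists f, [/\ f 0%N = LI,
    forall t, (t < m.+2)%N -> f t.+1 = g t & f m.+3 = LI].
  exists (scons LI (upd g m.+2 LI)); split=> [//|t tm|]; rewrite /upd /= ?eqxx //.
  by rewrite ifN //; lia.
have := @cc_comm _ _ _ _ _ _ CC i m.+4 f isT nN f0 fl.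
have Cin F : F 0%N = LI -> F m.+3 = LI ->
    C i m.+4 F = C i.+1 m.+2 (fun t => F t.+1).
  move=> F0 Fl; rewrite (cc_shiftr CC) //.
  by rewrite (cc_shiftl CC) //; lia.
rewrite /= big_nat_recl // big_nat_recr //= [X in _ + X = 0]big_nat_recl //.
rewrite [X in _ + (_ + X) = 0]big_nat_recr //=.
rewrite [X in _ + (X + _) = 0](_ : _ = 0); last first.
  by apply: sum3_eq0 => a _; rewrite f0 /=; case: a; rewrite /= !(mulr0, mul0r).
rewrite [X in _ + (_ + (_ + X)) = 0](_ : _ = 0); last first.
  by apply: sum3_eq0 => a _; rewrite fl /=; case: a; rewrite /= !(mulr0, mul0r).
have -> : sum3 (fun a => J a * bsgn R a (f 0%N) (f 1%N) * C i m.+4 (mul2 f 0 a))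
    = extl i m.+2 g.
  apply: eq_sum3 => a _; rewrite f0 fg // bsgnI; congr (_ * _).
  rewrite (cc_shiftr CC); [|by lia|by rewrite /mul2 /upd /= fl].
  apply: (cc_ext CC) => -[|[|t]] tm; rewrite /mul2 /mul1 /upd /= ?fg ?f0 ?lmulIr //.
have -> : sum3 (fun a => J a * bsgn R a (f m.+2) (f m.+3) * C i m.+4 (mul2 f m.+2 a))
    = extr i.+1 m.+2 g.
  apply: eq_sum3 => a _; rewrite fl fg // bsgnC bsgnI; congr (_ * _).
  rewrite (cc_shiftl CC); [|by lia|by rewrite /mul2 /upd /=].
  apply: (cc_ext CC) => t tm; rewrite /mul2 /mul1 /upd !eqSS /=.
  case: eqVneq => [_|nt]; first by rewrite fl lmulIr.
  by case: eqVneq => [_|nt']; rewrite ?fg //; lia.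
rewrite (eq_big_nat _ _ (F2 := fun t => sum3 (fun a => J a * bsgn R a (g t) (g t.+1)
     * C i.+1 m.+2 (mul2 g t a)))); last first.
  move=> t /= tm; apply: eq_sum3 => a _; rewrite !fg; [|lia..].
  rewrite Cin; [|by []|by rewrite /mul2 /upd !ifN ?fl //; lia].
  congr (_ * _); apply: (cc_ext CC) => u um; rewrite /mul2 /upd !eqSS.
  by rewrite !fg //; lia.
rewrite [X in _ + (0 + (X + _))](eq_big_nat _ _ (F2 := fun t => sum3 (fun a =>
     h a * lsgn R a (g t) * C i.+1 m.+2 (mul1 g t a)))); last first.
  move=> t /= tm; apply: eq_sum3 => a _; rewrite !fg; [|lia..].
  rewrite Cin; [|by []|by rewrite /mul1 /upd !ifN ?fl //; lia].
  congr (_ * _); apply: (cc_ext CC) => u um; rewrite /mul1 /upd !eqSS.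
  by rewrite !fg //; lia.
set X := fun t a => J a * bsgn R a (g t) (g t.+1) * C i.+1 m.+2 (mul2 g t a).
have split_kills t a : X t a = ((t == 0%N) && (a == g 0%N))%:R * X t a
    + ((t == m) && (a == g m.+1))%:R * X t a + (~~ kills g m.+2 t a)%:R * X t a.
  rewrite /kills /=.
  case: (boolP (_ && _)) => [/andP[/eqP t0 /eqP ag]|_]; last first.
    by case: (boolP (_ && _)) => _; rewrite /= ?mul0r ?mul1r ?add0r ?addr0.
  case: (boolP (_ && _)) => [/andP[/eqP tm /eqP ag']|_]; last first.
    by rewrite /= ?mul0r ?mul1r ?add0r ?addr0.
  have -> : X t a = 0; last by rewrite !mulr0 !addr0.
  rewrite /X t0 -ag [g 1%N](_ : _ = a); last by rewrite ag' -tm t0.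
  by rewrite bsgn_self lsgn_self mulr0 mul0r.
have -> : \sum_(0 <= t < m.+1) sum3 (X t) = killl i.+1 m.+2 g + killr i.+1 m.+2 g
   + \sum_(0 <= t < m.+1) sum3 (fun a => (~~ kills g m.+2 t a)%:R * X t a).
  have -> : killl i.+1 m.+2 g = \sum_(0 <= t < m.+1) sum3 (fun a => 
     ((t == 0%N) && (a == g 0%N))%:R * X t a).
    rewrite (@sum_nat_only _ _ _ 0%N) //; last first.
      by move=> t _ t0; apply: sum3_eq0 => a _; rewrite (negPf t0) mul0r.
    rewrite (@sum3_only _ _ (g 0%N)) //; last first.
      by move=> a _ ag; rewrite (negPf ag) mul0r.
    rewrite !eqxx /= mul1r /X bsgn_self /killl; congr (_ * _).
    rewrite (cc_shiftl CC); [|by lia|by rewrite /mul2 /upd /=; case: (g 0%N)].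
    by apply: (cc_ext CC) => -[|t] _.
  have -> : killr i.+1 m.+2 g = \sum_(0 <= t < m.+1) sum3 (fun a => 
     ((t == m) && (a == g m.+1))%:R * X t a).
    rewrite (@sum_nat_only _ _ _ m) //; last first.
      by move=> t _ t0; apply: sum3_eq0 => a _; rewrite (negPf t0) mul0r.
    rewrite (@sum3_only _ _ (g m.+1)) //; last first.
      by move=> a _ ag; rewrite (negPf ag) andbF mul0r.
    rewrite !eqxx /= mul1r /X bsgnC bsgn_self /killr; congr (_ * _).
    rewrite (cc_shiftr CC); [|by lia|by rewrite /mul2 /upd eqxx; case: (g m.+1)].
    apply: (cc_ext CC) => t tm; rewrite /mul2 /upd /=. by rewrite [in RHS]ifN //; lia.
  rewrite -!big_split /=; apply: eq_bigr => t _; rewrite -!sum3D.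
  by apply: eq_sum3 => a _; exact: split_kills.
rewrite /inner /= add0r addr0 => E; rewrite -[RHS]E; ring.
Qed.

(** [level] speaks of successor positions only; periodicity of the ring recovers position 0. *)
Lemma all_pos (P : nat -> Prop) :
  (forall i, P i.+1) -> (forall i, P (i + N)%N -> P i) -> forall i, P i.
Proof.
move=> PS PN i; apply: PN; suff -> : (i + N = (i + N).-1.+1)%N by [].
by lia.
Qed.

Lemma kills_end g n t a : (2 <= n)%N -> (t < n.-1)%N -> g 0%N != LI -> g n.-1 != LI ->
  a != LI -> ~~ kills g n t a ->
  mul2 g t a 0 != LI /\ mul2 g t a n.-1 != LI.
Proof.
move=> n2 tn g0 gl a0; rewrite negb_or !negb_and => /andP[k0 kl]; rewrite !mul2E; split.
  case: ifP => // /orP[/eqP t0|/eqP//]; apply: lmul_neqI.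
  by move: k0; rewrite -t0 eqxx orFb eq_sym.
case: ifP => // tt; apply: lmul_neqI; rewrite eq_sym.
by case/orP: kl => //; lia.
Qed.

Lemma lsgn_neq a x : lsgn R a x != 0 -> x != LI /\ x != a.
Proof. by case: a; case: x; rewrite //= eqxx. Qed.

Lemma lsgn_nz a x : a != LI -> x != LI -> x != a -> lsgn R a x != 0.
Proof. by case: a; case: x => //= _ _ _; rewrite ?oppr_eq0 oner_eq0. Qed.

Lemma field_end g n t a : g 0%N != LI -> g n.-1 != LI -> lsgn R a (g t) != 0 ->
  mul1 g t a 0 != LI /\ mul1 g t a n.-1 != LI.
Proof.
move=> g0 gl /lsgn_neq[_ ag]; rewrite !mul1E; split; case: ifP => // /eqP E.
  by apply: lmul_neqI; rewrite E.
by apply: lmul_neqI; rewrite E.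
Qed.

Lemma mulr3_eq0 (x y z : R) : (y != 0 -> z = 0) -> x * y * z = 0.
Proof. by case: (eqVneq y 0) => [->|_ ->]; rewrite ?mulr0 ?mul0r. Qed.

(** Strings of support k + 1 and k + 2 have coefficient zero, so a target of support k + 1 only
    couples the two strings of support k obtained by removing one of its ends. *)
Lemma level_top i g : g 0%N != LI -> g k != LI ->
  killl i k.+1 g + killr i k.+1 g = 0.
Proof.
move=> g0 gk; move: i; apply: all_pos => i; last first.
  by rewrite /killl /killr -addSn !(cc_per CC).
have k1 : (1 < k.+1)%N by lia.
(* The padded target occupies k + 3 sites, which fit since k + 3 <= 2k <= N. *)
have k3N : (k.+3 <= N)%N by lia.
have := @level i k.+1 g k1 k3N g0 gk.
rewrite (_ : extl _ _ _ = 0); last first.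
  apply: sum3_eq0 => a a0; apply: mulr3_eq0 => /lsgn_neq[_ ag].
  apply: (cc_supp2l CC) => //; first by rewrite /= mul1E; exact: lmul_neqI.
  by rewrite /= mul1E ifN //; lia.
rewrite (_ : extr _ _ _ = 0); last first.
  apply: sum3_eq0 => a a0; apply: mulr3_eq0 => /lsgn_neq[_ ag].
  apply: (cc_supp2r CC); rewrite /upd ?eqxx //= mul1E ifN //; try lia.
  by rewrite eqxx; exact: lmul_neqI.
rewrite (_ : inner _ _ _ = 0) ?addr0 ?add0r //.
rewrite /inner !sum_nat_eq0 ?addr0 // => t tk; apply: sum3_eq0 => a a0.
  apply: mulr3_eq0 => /lsgn_neq[gt0 ag].
  by case: (@field_end g k.+1 t a g0 gk) => //; [exact: lsgn_nz|exact: (cc_supp1 CC)].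
case: (boolP (kills _ _ _ _)) => kl; rewrite ?mul0r // mul1r.
have [m0 ml] := kills_end k1 tk g0 gk a0 kl.
by rewrite (cc_supp1 CC) ?mulr0.
Qed.

Lemma inner_per i n g : inner (i + N)%N n g = inner i n g.
Proof.
by rewrite /inner; congr (_ + _); apply: eq_bigr => t _; apply: eq_sum3 => a _;
  rewrite (cc_per CC).
Qed.

Lemma level_mid i g : g 0%N != LI -> g k.-1 != LI ->
  killl i k g + killr i k g + inner i k g = 0.
Proof.
move=> g0 gk; move: i; apply: all_pos => i; last first.
  by rewrite /killl /killr -addSn !(cc_per CC) inner_per.
have k1 : (1 < k)%N by lia.
have k3N : (k.+2 <= N)%N by lia.
have := @level i k g k1 k3N g0 gk.
rewrite (_ : extl _ _ _ = 0); last first.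
  apply: sum3_eq0 => a a0; apply: mulr3_eq0 => /lsgn_neq[_ ag].
  apply: (cc_supp1 CC) => //; move: gk; case: k k1 => // k' ? ?.
  by rewrite /= mul1E ifN //; lia.
rewrite (_ : extr _ _ _ = 0); last first.
  apply: sum3_eq0 => a a0; apply: mulr3_eq0 => /lsgn_neq[_ ag].
  by apply: (cc_supp1 CC); rewrite /upd ?eqxx //= ifN ?mul1E ?ifN //; lia.
by rewrite !add0r.
Qed.

Lemma level_low i g : g 0%N != LI -> g k.-2 != LI ->
  extl i k.-1 g + extr i.+1 k.-1 g + killl i.+1 k.-1 g + killr i.+1 k.-1 g
  + inner i.+1 k.-1 g = 0.
Proof. by move=> g0 gl; apply: level => //; lia. Qed.

(* The target obtained from [f] by one bond at its right end is also reached
   from [shiftl_word f b], one site to the right, by a bond at its left end. *)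
Definition shiftl_word (f : nat -> letter) b u :=
  if u == 0%N then lmul (f 0%N) (f 1%N)
  else if u == k.-1 then b
  else if u == k.-2 then lmul b (f k.-1) else f u.+1.

Definition shiftr_word (f : nat -> letter) a u :=
  if u == 0%N then a
  else if u == 1%N then lmul a (f 0%N)
  else if u == k.-1 then lmul (f k.-1) (f k.-2) else f u.-1.

(** The transport relation behind all statements on support k: a bond added at the right end is
    traded for a bond removed at the left end, one site further on. When the left end admits no
    bond, because its coupling is zero or the bond commutes with the next letter, the first term
    stands alone. *)
Lemma top_right i f b : f 0%N != LI -> f k.-1 != LI -> b != LI -> b != f k.-1 ->
  J b * lsgn R b (lmul b (f k.-1)) * C i k f
  + J (f 0%N) * lsgn R (f 0%N) (f 1%N) * C i.+1 k (shiftl_word f b) = 0.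
Proof.
move=> f0 fl b0 bl; pose g := upd (upd f k.-1 (lmul b (f k.-1))) k b.
have gE u : g u = if u == k then b else if u == k.-1 then lmul b (f k.-1) else f u.
  by [].
have g0 : g 0%N = f 0%N by rewrite gE !ifN //; lia.
have g1 : g 1%N = f 1%N by rewrite gE !ifN //; lia.
have gk : g k = b by rewrite gE eqxx.
have gk1 : g k.-1 = lmul b (f k.-1) by rewrite gE eqxx ifN //; lia.
have := @level_top i g; rewrite g0 gk => /(_ f0 b0).
rewrite /killl /killr /= g0 g1 gk gk1 lmulK addrC => <-; congr (_ * _ + _ * _).
  apply: (cc_ext CC) => t tk; rewrite /upd gE.
  by case: eqVneq => [->//|tk1]; rewrite ifN //; lia.
apply: (cc_ext CC) => t tk; rewrite /upd gE eqSS /shiftl_word.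
case: eqVneq => // t0; rewrite [t.+1 == k](_ : _ = (t == k.-1)); last by lia.
by rewrite [t.+1 == k.-1](_ : _ = (t == k.-2)) //; lia.
Qed.

Lemma top_left i f a : f 0%N != LI -> f k.-1 != LI -> a != LI -> a != f 0%N ->
  J a * lsgn R a (lmul a (f 0%N)) * C i.+1 k f
  + J (f k.-1) * lsgn R (f k.-1) (f k.-2) * C i k (shiftr_word f a) = 0.
Proof.
move=> f0 fl a0 al; have [g [g0 g1 gS]] : exists g, [/\ g 0%N = a, g 1%N = lmul a (f 0%N) &
    forall t, (0 < t)%N -> g t.+1 = f t].
  by exists (scons a (upd f 0 (lmul a (f 0%N)))); split=> // -[].
have gk : g k = f k.-1 by rewrite -[k in LHS](@prednK k) ?gS //; lia.
have gk1 : g k.-1 = f k.-2 by rewrite -[k.-1](@prednK k.-1) ?gS //; lia.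
have := @level_top i g; rewrite g0 gk => /(_ a0 fl).
rewrite /killl /killr /= g0 g1 gk gk1 lmulK => <-; congr (_ * _ + _ * _).
  by apply: (cc_ext CC) => -[|t] tk; rewrite /upd //= gS.
apply: (cc_ext CC) => t tk; rewrite /upd /shiftr_word /=.
case: (eqVneq t k.-1) => [->|tk1]; first by rewrite !ifN //; lia.
by case: t tk tk1 => [|[|t]] //= _ _; rewrite gS.
Qed.

Lemma inner_fields i n g :
  (forall t a, (t < n.-1)%N -> a != LI -> J a != 0 -> bsgn R a (g t) (g t.+1) != 0 ->
     ~~ kills g n t a -> C i n (mul2 g t a) = 0) ->
  inner i n g
  = \sum_(0 <= t < n) sum3 (fun a => h a * lsgn R a (g t) * C i n (mul1 g t a)).
Proof.
move=> g0; rewrite /inner sum_nat_eq0 ?add0r // => t tn; apply: sum3_eq0 => a a0.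
case: (boolP (kills _ _ _ _)) => kl; rewrite ?mul0r // mul1r.
have [->|Ja] := eqVneq (J a) 0; first by rewrite !mul0r.
by apply: mulr3_eq0 => sg; exact: g0.
Qed.

Lemma fields_only i n g t0 : (t0 < n)%N ->
  (forall t a, (t < n)%N -> t != t0 -> a != LI -> h a != 0 -> lsgn R a (g t) != 0 ->
     C i n (mul1 g t a) = 0) ->
  \sum_(0 <= t < n) sum3 (fun a => h a * lsgn R a (g t) * C i n (mul1 g t a))
  = sum3 (fun a => h a * lsgn R a (g t0) * C i n (mul1 g t0 a)).
Proof.
move=> tn g0; rewrite (@sum_nat_only _ _ _ t0) // => t tn' tt0.
apply: sum3_eq0 => a a0; have [->|Ha] := eqVneq (h a) 0; first by rewrite !mul0r.
by apply: mulr3_eq0 => sg; exact: g0.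
Qed.

End Levels.

(** * Rank two *)

Section RankTwo.
Variables (R : realFieldType) (J h : letter -> R) (N k : nat).
Variable C : nat -> nat -> (nat -> letter) -> R.
Hypothesis CC : conserved_coeffs J h N k C.
Hypotheses (k3 : (3 <= k)%N) (kN : (2 * k <= N)%N).
Hypotheses (JX : J LX != 0) (JY : J LY != 0) (JZ : J LZ = 0).

Definition bar x := lmul LZ x.

Lemma planar_neq x : exists2 a, planar a & a != x.
Proof. by case: x; [exists LX|exists LY|exists LX|exists LX]. Qed.

Lemma bar_planar x : planar (bar x) = planar x. Proof. by case: x. Qed.

Lemma planarJ x : planar x -> J x != 0. Proof. by case: x. Qed.

Lemma lsgnZ_neq0 x : planar x -> lsgn R x LZ != 0.
Proof. by case: x => //= _; rewrite ?oppr_eq0 oner_eq0. Qed.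

(** No bond [Z Z] exists to be removed at the right end, so the transport relation to the left has a
    single term. *)
Lemma rank2_last i f : f 0%N != LI -> f k.-1 = LZ -> C i k f = 0.
Proof.
move=> f0 fl; move: i; apply: (all_pos k3 kN) => i; last by rewrite (cc_per CC).
have [a ap af] := planar_neq (f 0%N).
have flI : f k.-1 != LI by rewrite fl.
have := top_left CC k3 kN i f0 flI (planarI ap) af.
rewrite fl JZ !mul0r addr0 => /eqP; rewrite !mulf_eq0 (negPf (planarJ ap)) /=.
by case/orP=> /eqP // s0; case: (f 0%N) f0 af ap s0; case: a => //= _ _ _ /eqP;
  rewrite ?oppr_eq0 oner_eq0.
Qed.

Lemma rank2_first i f : f 0%N = LZ -> f k.-1 != LI -> C i k f = 0.
Proof.
move=> f0 fl.
have [a ap af] := planar_neq (f k.-1).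
have f0I : f 0%N != LI by rewrite f0.
have := top_right CC k3 kN i f0I fl (planarI ap) af.
rewrite f0 JZ !mul0r addr0 => /eqP; rewrite !mulf_eq0 (negPf (planarJ ap)) /=.
by case/orP=> /eqP // s0; case: (f k.-1) fl af ap s0; case: a => //= _ _ _ /eqP;
  rewrite ?oppr_eq0 oner_eq0.
Qed.

(** Transport moves the wrong letter towards the left end. Once it is next to that end, either it
    commutes with the bond to be removed or the transported string begins with [Z]. *)
Lemma rank2_inside t i f : f 0%N != LI -> f k.-1 != LI ->
  (0 < t < k.-1)%N -> f t != LZ -> C i k f = 0.
Proof.
elim: t i f => [//|t IHt] i f f0 fl /andP[_ tk] ft.
have [fp|/(planarP f0) fZ] := boolP (planar (f 0%N)); last exact: rank2_first.
have [flp|/(planarP fl) flZ] := boolP (planar (f k.-1)); last exact: rank2_last.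
have bp : planar (bar (f k.-1)) by rewrite bar_planar.
have bf : bar (f k.-1) != f k.-1 by case: (f k.-1) flp.
have := top_right CC k3 kN i f0 fl (planarI bp) bf.
have -> : lmul (bar (f k.-1)) (f k.-1) = LZ by case: (f k.-1) flp.
rewrite (_ : _ * C i.+1 k _ = 0) ?addr0.
  move/eqP; rewrite !mulf_eq0 (negPf (planarJ bp)) (negPf (lsgnZ_neq0 bp)) /=.
  by move/eqP.
have wl : shiftl_word k f (bar (f k.-1)) k.-1 = bar (f k.-1).
  by rewrite /shiftl_word eqxx ifN //; nat_lia.
apply: mulr3_eq0 => /lsgn_neq[f1 f10].
have [f1Z|f1Z] := eqVneq (f 1%N) LZ; last first.
  apply: rank2_first; last by rewrite wl planarI.
  rewrite /shiftl_word /=; case: (f 0%N) fp f10 => //; by case: (f 1%N) f1 f1Z.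
case: t IHt tk ft => [|t] IHt tk ft; first by rewrite f1Z in ft.
apply: IHt; rewrite ?wl ?planarI //; [|by nat_lia|].
  by rewrite /shiftl_word /= f1Z; case: (f 0%N) fp.
by rewrite /shiftl_word !ifN //; nat_lia.
Qed.

Lemma rank2_support i f : f 0%N != LI -> f k.-1 != LI -> C i k f != 0 ->
  [/\ planar (f 0%N), planar (f k.-1) & forall t, (0 < t < k.-1)%N -> f t = LZ].
Proof.
move=> f0 fl nz; split.
- apply: contraNT nz => /(planarP f0) fZ; exact/eqP/rank2_first.
- apply: contraNT nz => /(planarP fl) fZ; exact/eqP/rank2_last.
- move=> t tk; apply: contraNeq nz => fZ; exact/eqP/(rank2_inside _ f0 fl tk).
Qed.

Definition rank2_coeff i al be := C i k (fill k al LZ be).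
Notation q := rank2_coeff.

Lemma rank2_rec i al be : planar al -> planar be ->
  J al * lsgn R al LZ * q i.+1 (bar al) be + J be * lsgn R be LZ * q i al (bar be) = 0.
Proof.
move=> ap bp; pose f := fill k al LZ (bar be).
have f0 : f 0%N = al by [].
have f1 : f 1%N = LZ by rewrite /f /fill ifN //; nat_lia.
have fl : f k.-1 = bar be by apply: fill_last; nat_lia.
have := @top_right _ _ _ _ _ _ CC k3 kN i f be; rewrite f0 f1 fl.
have -> : lmul be (bar be) = LZ by case: (be) bp.
have bI : bar be != LI by rewrite planarI ?bar_planar.
have bb : be != bar be by case: (be) bp.
move=> /(_ (planarI ap) bI (planarI bp) bb); rewrite addrC => <-.
congr (_ * _ + _); apply: (cc_ext CC) => u uk.
rewrite /shiftl_word /fill f0 f1 fl /f /fill /bar.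
by case_nat_eqs => //; rewrite ?lmulK //; case: (al) ap; case: (be) bp.
Qed.

(** One of the two letters under a bond [a a] that contributes commutes with [a], so the bond
    exchanges [I] and [a] there. Neither is the [Z] required inside a surviving string, and at an
    end the target would contain [I] or the bond would be a killing one. *)
Lemma rank2_inner i g : g 0%N != LI -> g k.-1 != LI -> inner J h C i k g =
  \sum_(0 <= t < k) sum3 (fun a => h a * lsgn R a (g t) * C i k (mul1 g t a)).
Proof.
move=> g0 gl; apply: inner_fields => t a tk a0 Ja sg kl.
have k2 : (2 <= k)%N by nat_lia.
have [m0 ml] := kills_end k3 kN k2 tk g0 gl a0 kl.
apply/eqP; apply: contraT => nz.
have [p0 pl mid] := rank2_support m0 ml nz.
have aZ : a != LZ by apply: contraNneq Ja => ->; rewrite JZ.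
have xZ : (0 < t)%N -> lmul a (g t) = LZ.
  by move=> t0; rewrite -[RHS](mid t) ?mul2E ?eqxx //; nat_lia.
have yZ : (t.+1 < k.-1)%N -> lmul a (g t.+1) = LZ.
  by move=> t0; rewrite -[RHS](mid t.+1) ?mul2E ?eqxx ?orbT //; nat_lia.
case: (bsgn_nz sg) => -[]; rewrite /lcom => /orP[/eqP gt|/eqP gt] _.
- have t0 : t != 0%N by apply: contraNneq g0 => <-; rewrite gt.
  by move: aZ; rewrite -xZ ?gt ?lmulIr ?eqxx //; nat_lia.
- have aa : lmul a (g t) = LI by rewrite gt; case: (a).
  have [t0|t0] := eqVneq t 0%N; first by move: m0; rewrite -t0 mul2E eqxx aa.
  have : (0 < t)%N by nat_lia.
  by move=> /xZ; rewrite aa.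
- have t1 : t.+1 != k.-1 by apply: contraNneq gl => <-; rewrite gt.
  by move: aZ; rewrite -yZ ?gt ?lmulIr ?eqxx //; nat_lia.
- have aa : lmul a (g t.+1) = LI by rewrite gt; case: (a).
  have [t1|t1] := eqVneq t.+1 k.-1; last first.
    have : (t.+1 < k.-1)%N by nat_lia.
    by move=> /yZ; rewrite aa.
  by move: ml; rewrite -t1 mul2E eqxx orbT aa eqxx.
Qed.

(** * A field component in the plane of the two couplings *)

Section Transverse.
Variable a : letter.
Hypotheses (ap : planar a) (hb : h (bar a) != 0).
Notation b := (bar a).

Lemma lsgn_ba : lsgn R b a != 0.
Proof. by case: (a) ap => //= _; rewrite ?oppr_eq0 oner_eq0. Qed.

(** The inside of a surviving string consists of [Z] only, so among the fields only the one turning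
    the marked [a] into [Z] contributes, and that is the field along [b]. *)
Lemma rank2_mark i t al be : (0 < t < k.-1)%N -> planar al -> planar be ->
  killl J C i k (fill1 k al t a LZ be) + killr J C i k (fill1 k al t a LZ be)
  + h b * lsgn R b a * q i al be = 0.
Proof.
move=> tk alp bep; set g := fill1 _ _ _ _ _ _.
have g0 : g 0%N = al by [].
have gl : g k.-1 = be by apply: fill1_last; nat_lia.
have gt : g t = a by apply: fill1_mid.
have g0I : g 0%N != LI by rewrite g0 planarI.
have glI : g k.-1 != LI by rewrite gl planarI.
have := level_mid CC k3 kN i g0I glI; rewrite rank2_inner // => <-; congr (_ + _).
have tk' : (t < k)%N by nat_lia.
rewrite (@fields_only _ h C i k g t tk'); last first.
  move=> s c sk st c0 hc sg; apply/eqP; apply: contraT => nz.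
  have [m0 ml] := field_end g0I glI sg.
  have [_ _ /(_ t tk)] := rank2_support m0 ml nz.
  by rewrite mul1E eq_sym (negPf st) gt; case: (a) ap.
rewrite (@sum3_only _ _ b) ?gt //; first 1 last.
- by rewrite planarI ?bar_planar.
- move=> c c0 cb; have [sg|sg] := eqVneq (lsgn R c a) 0; first by rewrite sg mulr0 mul0r.
  have sg' : lsgn R c (g t) != 0 by rewrite gt.
  have [m0 ml] := field_end g0I glI sg'.
  suff -> : C i k (mul1 g t c) = 0 by rewrite mulr0.
  apply/eqP; apply: contraT => nz.
  have [_ _ /(_ t tk)] := rank2_support m0 ml nz.
  by rewrite mul1E eqxx gt; case: (a) ap cb c0 sg; case: (c) => //=; rewrite eqxx.
congr (_ * _); apply: (cc_ext CC) => u uk; rewrite mul1E /fill /g /fill1 /bar.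
by case_nat_eqs => //; case: (a) ap.
Qed.


Lemma mark_killr i t al be : (0 < t < k.-2)%N -> planar be ->
  killr J C i k (fill1 k al t a LZ be)
  = J be * lsgn R be LZ * C i k.-1 (fill1 k.-1 al t a LZ (bar be)).
Proof.
move=> tk bep; rewrite /killr fill1_last; last by nat_lia.
rewrite {1 3}/fill1 !ifN; try by nat_lia.
congr (_ * _); apply: (cc_ext CC) => u uk; rewrite /upd /fill1.
by case_nat_eqs => //; case: (be) bep.
Qed.

Lemma mark_killl i t al be : (1 < t < k.-1)%N -> planar al ->
  killl J C i k (fill1 k al t a LZ be)
  = J al * lsgn R al LZ * C i.+1 k.-1 (fill1 k.-1 (bar al) t.-1 a LZ be).
Proof.
move=> tk alp; set g := fill1 k _ _ _ _ _.
have g0 : g 0%N = al by [].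
have g1 : g 1%N = LZ by rewrite /g /fill1 !ifN //; nat_lia.
rewrite /killl g0 g1; congr (_ * _); apply: (cc_ext CC) => u uk.
by rewrite /upd /g /fill1; case_nat_eqs => //; case: (al) alp.
Qed.

(** The left end letter belonging to a mark on site [t]: removing a bond at the left brings the mark
    one site closer and exchanges [X] and [Y] at the end. At [t = 1] the end letter equals the mark
    and the left bond commutes with it, which starts the walk. *)
Definition alternate t := if odd t then a else b.

Lemma alternate_planar t : planar (alternate t).
Proof. by rewrite /alternate; case: odd; rewrite ?bar_planar. Qed.

Lemma alternateS t : bar (alternate t.+1) = alternate t.
Proof. by rewrite /alternate /=; case: odd => //=; case: (a). Qed.

Lemma barK x : bar (bar x) = x. Proof. by case: x. Qed.

Lemma mark_killl0 i be : killl J C i k (fill1 k a 1 a LZ be) = 0.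
Proof.
rewrite /killl; have -> : fill1 k a 1 a LZ be 0 = a by [].
have -> : fill1 k a 1 a LZ be 1 = a by apply: fill1_mid; nat_lia.
by rewrite lsgn_self mulr0 mul0r.
Qed.

Lemma transfer_step (A w c t m m' p : R) :
  A * m' + w * m = 0 -> w * p = - (t * (c * m')) -> w * (A * p) = w * (t * (c * m)).
Proof.
move=> /eqP; rewrite addr_eq0 => /eqP Em Ep; rewrite mulrCA Ep.
have -> : A * - (t * (c * m')) = - (t * c * (A * m')) by ring.
by rewrite Em; ring.
Qed.

(** The shortened string sits at [i.+1], where the walk expresses it through [q i.+1]; [rank2_rec]
    carries this back to [q i], so that the field terms of successive steps add up. *)
Lemma rank2_killl i t be : (0 < t < k.-2)%N ->
  (forall i be, planar be ->
     J be * lsgn R be LZ * C i k.-1 (fill1 k.-1 (alternate t) t a LZ (bar be))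
     = - (t%:R * (h b * lsgn R b a * q i (alternate t) be))) ->
  planar be ->
  killl J C i k (fill1 k (alternate t.+1) t.+1 a LZ be)
  = t%:R * (h b * lsgn R b a * q i (alternate t.+1) be).
Proof.
move=> tk IH bep; have bbep : planar (bar be) by rewrite bar_planar.
rewrite mark_killl ?alternate_planar ?alternateS //; last by nat_lia.
have nz : J (bar be) * lsgn R (bar be) LZ != 0.
  by rewrite mulf_neq0 ?planarJ ?lsgnZ_neq0.
have := IH i.+1 _ bbep; have := rank2_rec i (alternate_planar t.+1) bbep.
rewrite alternateS !barK /= => E1 E2; apply: (mulfI nz).
exact: (transfer_step E1 E2).
Qed.

(* The letter [a] on site [t] of the inner part of the string is the marked letter. *)
Lemma rank2_walk t : (0 < t < k.-2)%N -> forall i be, planar be ->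
  J be * lsgn R be LZ * C i k.-1 (fill1 k.-1 (alternate t) t a LZ (bar be))
  = - (t%:R * (h b * lsgn R b a * q i (alternate t) be)).
Proof.
elim: t => // t IHt tk i be bep.
have tk1 : (0 < t.+1 < k.-1)%N by nat_lia.
have := rank2_mark i tk1 (alternate_planar t.+1) bep.
rewrite mark_killr //; case: t IHt tk tk1 => [|t] IHt tk tk1 E.
  move/eqP: E; rewrite mark_killl0 add0r addr_eq0 mul1r => /eqP ->.
  by [].
have tk2 : (0 < t.+1 < k.-2)%N by nat_lia.
move/eqP: E; rewrite rank2_killl //; last by move=> *; apply: IHt.
by rewrite addrAC addrC addr_eq0 => /eqP ->; rewrite [t.+2%:R]mulrSr; ring.
Qed.

(** The mark is now next to the right end. The left side has collected k - 3 field terms and the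
    mark adds one more. *)
Lemma rank2_end i be : planar be ->
  killr J C i k (fill1 k (alternate k.-2) k.-2 a LZ be)
  + k.-2%:R * (h b * lsgn R b a * q i (alternate k.-2) be) = 0.
Proof.
move=> bep; have tk1 : (0 < k.-2 < k.-1)%N by nat_lia.
have := rank2_mark i tk1 (alternate_planar k.-2) bep.
have kk : (k.-2 = k.-2.-1.+1)%N by nat_lia.
(* For k = 3 the mark touches both ends and no walk precedes. *)
have [k30|k30] := eqVneq k.-2.-1 0%N.
  by rewrite kk k30 mark_killl0 add0r mul1r.
have tk2 : (0 < k.-2.-1 < k.-2)%N by nat_lia.
rewrite kk rank2_killl //; last by move=> *; apply: rank2_walk.
by move=> <-; rewrite [k.-2.-1.+1%:R]mulrSr; ring.
Qed.

(** With the mark and the right end letter equal, the right bond commutes with the mark and [killr]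
    vanishes. *)
Lemma rank2_same i : q i (alternate k.-2) a = 0.
Proof.
have := rank2_end i ap; rewrite /killr fill1_last; last by nat_lia.
rewrite fill1_mid; last by nat_lia.
rewrite lsgn_self mulr0 mul0r add0r => /eqP; rewrite !mulf_eq0.
have -> : (k.-2%:R == 0 :> R) = false by rewrite pnatr_eq0; nat_lia.
by rewrite (negPf hb) (negPf lsgn_ba) => /eqP.
Qed.

Notation al := (alternate k.-2).

Lemma rank2_same_bar i : q i (bar al) b = 0.
Proof.
have alp : planar (bar al) by rewrite bar_planar alternate_planar.
have := rank2_rec i alp ap; rewrite barK rank2_same mulr0 add0r => /eqP.
by rewrite mulf_eq0 mulf_eq0 (negPf (planarJ ap)) (negPf (lsgnZ_neq0 ap)) => /eqP.
Qed.

(** For the other right end letter, [killr] in [rank2_end] leaves a string of support k - 1 ending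
    in [Z]. The target ending in [Z] yields a second expression for it: the field along [b]
    contributes, the one along [a] does not by [rank2_same_bar]. *)
Lemma rank2_tail i :
  J (bar al) * lsgn R (bar al) LZ * C i.+1 k.-1 (fill k.-1 al LZ LZ)
  + h b * lsgn R b LZ * q i (bar al) a = 0.
Proof.
have alp : planar (bar al) by rewrite bar_planar alternate_planar.
set g := fill k (bar al) LZ LZ.
have g0 : g 0%N = bar al by [].
have g1 : g 1%N = LZ by rewrite /g /fill !ifN //; nat_lia.
have gl : g k.-1 = LZ by apply: fill_last; nat_lia.
have g0I : g 0%N != LI by rewrite g0 planarI.
have glI : g k.-1 != LI by rewrite gl.
have := level_mid CC k3 kN i g0I glI; rewrite rank2_inner //.
rewrite {1}/killr gl JZ !mul0r addr0 => <-; congr (_ + _).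
  rewrite /killl g0 g1; congr (_ * _); apply: (cc_ext CC) => u uk.
  rewrite /upd /g /fill; case_nat_eqs => //.
  by move: alp; rewrite bar_planar; case: al.
have tk' : (k.-1 < k)%N by nat_lia.
rewrite (@fields_only _ h C i k g _ tk'); last first.
  move=> s c sk sl c0 hc sg; have [m0 _] := field_end g0I glI sg.
  by apply: rank2_last; rewrite // mul1E eq_sym (negPf sl).
rewrite gl.
have fE c : C i k (mul1 g k.-1 c) = q i (bar al) (lmul c LZ).
  apply: (cc_ext CC) => u uk; rewrite mul1E /g /fill; case_nat_eqs => //.
have := rank2_same_bar i; rewrite /sum3 !fE.
by case: (a) ap => //= _ ->; ring.
Qed.

(** Comparing the two expressions for the string ending in [Z] adds one field term to the k - 2
    collected so far, whence the factor k - 1. *)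
Lemma rank2_diff i : q i.+1 al b = 0.
Proof.
have bp : planar b by rewrite bar_planar.
have alp : planar (bar al) by rewrite bar_planar alternate_planar.
have E1 := rank2_tail i; have := rank2_rec i alp bp; rewrite !barK => E2.
have := rank2_end i.+1 bp; rewrite /killr fill1_last; last by nat_lia.
rewrite fill1_mid; last by nat_lia.
rewrite (_ : C _ _ _ = C i.+1 k.-1 (fill k.-1 al LZ LZ)); last first.
  apply: (cc_ext CC) => u uk; rewrite /upd /fill1 /fill; case_nat_eqs => //.
  by case: (a) ap.
have nz : J (bar al) * lsgn R (bar al) LZ != 0.
  by rewrite mulf_neq0 ?planarJ ?lsgnZ_neq0.
move: E1 E2 nz; set A := J (bar al) * _; set P := C _ _ _; set Q' := q _ _ _.
set Q := q _ _ _; move=> E1 E2 nz E3.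
have /eqP : A * (J b * P - h b * Q) = 0.
  have -> : A * (J b * P - h b * Q) = J b * (A * P + h b * lsgn R b LZ * Q')
    - h b * (A * Q + J b * lsgn R b LZ * Q') by ring.
  by rewrite E1 E2; ring.
rewrite mulf_eq0 (negPf nz) subr_eq0 => /eqP E4.
have /eqP : lsgn R b a * k.-2.+1%:R * h b * Q = 0.
  rewrite -[RHS]E3 mulrSr.
  have -> : J b * lsgn R b a * P = lsgn R b a * (h b * Q) by rewrite -E4; ring.
  by ring.
rewrite !mulf_eq0 (negPf lsgn_ba) (negPf hb) pnatr_eq0 /=.
by move/eqP.
Qed.

Lemma rank2_coeff0 i x y : planar x -> planar y -> q i x y = 0.
Proof.
have alp := alternate_planar k.-2.
have pE x' : planar x' -> forall y', planar y' -> x' = y' \/ x' = bar y'.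
  by case: x' => // _; case=> //; auto.
have q2 j : q j al b = 0.
  by move: j; apply: (all_pos k3 kN) => j; rewrite ?rank2_diff // /q (cc_per CC).
have qab j y' : planar y' -> q j al y' = 0.
  by move=> yp; case: (pE y' yp a ap) => ->; rewrite ?rank2_same.
move=> xp yp; case: (pE x xp _ alp) => ->; first exact: qab.
have alp' : planar (bar al) by rewrite bar_planar.
have yp' : planar (bar y) by rewrite bar_planar.
have := rank2_rec i alp' yp'; rewrite !barK qab // mulr0 add0r => /eqP.
by rewrite mulf_eq0 mulf_eq0 (negPf (planarJ yp')) (negPf (lsgnZ_neq0 yp')) => /eqP.
Qed.

Lemma rank2_top0 i f : f 0%N != LI -> f k.-1 != LI -> C i k f = 0.
Proof.
move=> f0 fl; apply/eqP; apply: contraT => nz.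
have [p0 pl mid] := rank2_support f0 fl nz; move: nz.
suff -> : C i k f = q i (f 0%N) (f k.-1) by rewrite rank2_coeff0 ?eqxx.
apply: (cc_ext CC) => t tk; rewrite /fill; case_nat_eqs.
- by subst t.
- by subst t.
- by apply: mid; nat_lia.
Qed.

End Transverse.
End RankTwo.

(** * Rank one *)

Section RankOne.
Variables (R : realFieldType) (J h : letter -> R) (N k : nat).
Variable C : nat -> nat -> (nat -> letter) -> R.
Hypothesis CC : conserved_coeffs J h N k C.
Hypotheses (k3 : (3 <= k)%N) (kN : (2 * k <= N)%N).
Hypotheses (JX : J LX = 0) (JY : J LY = 0) (JZ : J LZ != 0).
Hypotheses (hX : h LX != 0) (hY : h LY = 0) (hZ : h LZ != 0).

Ltac word_eq := apply: (cc_ext CC) => ? ?;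
  rewrite ?mul1E /fill /fill1 /upd /shiftl_word /shiftr_word; case_nat_eqs => //;
  try (by subst).

Lemma planarJ0 x : planar x -> J x = 0. Proof. by case: x. Qed.

Definition field i n g s : R :=
  h LX * (lsgn R LX (g s) * C i n (mul1 g s LX))
  + h LZ * (lsgn R LZ (g s) * C i n (mul1 g s LZ)).

Lemma sum_ends n (F : nat -> R) : (2 <= n)%N ->
  (forall s, (0 < s < n.-1)%N -> F s = 0) -> \sum_(0 <= s < n) F s = F 0%N + F n.-1.
Proof.
case: n => [|[|n]] // _ F0; rewrite big_nat_recl // big_nat_recr //=.
by rewrite sum_nat_eq0 ?add0r // => s sn; apply: F0; lia.
Qed.

Lemma sum_ends1 n t (F : nat -> R) : (0 < t < n.-1)%N ->
  (forall s, (0 < s < n.-1)%N -> s != t -> F s = 0) ->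
  \sum_(0 <= s < n) F s = F 0%N + F n.-1 + F t.
Proof.
case: n => [|[|n]]; [lia|lia|]; case: t => [|t] tn F0; first by [].
rewrite big_nat_recl // big_nat_recr //= (@sum_nat_only _ _ _ t) //; last first.
  by move=> s sn st; apply: F0; lia.
by rewrite addrA addrAC.
Qed.

Lemma inner_rank1 i n g :
  (forall t, (t < n.-1)%N -> bsgn R LZ (g t) (g t.+1) != 0 ->
     ~~ kills g n t LZ -> C i n (mul2 g t LZ) = 0) ->
  inner J h C i n g = \sum_(0 <= s < n) field i n g s.
Proof.
move=> g0; rewrite inner_fields; last first.
  move=> t a tn a0 Ja; suff -> : a = LZ by exact: g0.
  by case: (a) a0 Ja => //; rewrite ?JX ?JY eqxx.
apply: eq_bigr => s _; rewrite /sum3 hY /field; ring.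
Qed.

(** [X] and [Y] both anticommute with [Z], so a bond [Z Z] over two such letters commutes with them.
    A bond over an end letter [Z] is a killing one and not part of [inner]. *)
Lemma inner_planar i n g : (2 <= n)%N -> g 0%N != LI -> g n.-1 != LI ->
  (forall t, (0 < t < n.-1)%N -> planar (g t)) ->
  inner J h C i n g = \sum_(0 <= s < n) field i n g s.
Proof.
move=> n2 g0 gl gp; apply: inner_rank1 => t tn sg kl.
have pl s : (s < n)%N -> s != 0%N \/ g 0%N != LZ -> s != n.-1 \/ g n.-1 != LZ -> planar (g s).
  move=> sn s0 sl; have [sE|sn0] := eqVneq s 0%N.
    by case: s0; rewrite sE ?eqxx // => gZ; apply: contraNT gZ => /(planarP g0) ->.
  have [sE|snl] := eqVneq s n.-1.
    by case: sl; rewrite sE ?eqxx // => gZ; apply: contraNT gZ => /(planarP gl) ->.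
  by apply: gp; nat_lia.
suff : bsgn R LZ (g t) (g t.+1) = 0 by move/eqP; rewrite (negPf sg).
suff p2 : planar (g t) && planar (g t.+1).
  by case: (g t) (g t.+1) p2 => [] [] //; rewrite /bsgn /= ?mulr0 ?mul0r ?addr0.
move: kl; rewrite negb_or !negb_and ![LZ == _]eq_sym => /andP[/orP k0 /orP kl].
by apply/andP; split; apply: pl => //;
  first [nat_lia|by left; nat_lia|by case: kl => [?|?]; [left; nat_lia|right]].
Qed.

(** A planar left end carries no bond, so the transport relation with [b = LZ] has a single term. *)
Lemma rank1_planar i f : planar (f 0%N) -> planar (f k.-1) -> C i k f = 0.
Proof.
move=> p0 pl; have f0 := planarI p0; have fl := planarI pl.
have Zl : LZ != f k.-1 by case: (f k.-1) pl.
have := @top_right _ _ _ _ _ _ CC k3 kN i f LZ f0 fl isT Zl.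
rewrite (planarJ0 p0) !mul0r addr0 => /eqP; rewrite !mulf_eq0 (negPf JZ) /=.
by case/orP=> /eqP //; case: (f k.-1) pl => //= _ /eqP; rewrite ?oppr_eq0 oner_eq0.
Qed.

Lemma rank1_left i f : f 0%N = LZ -> planar (f k.-1) -> lsgn R LZ (f 1%N) = 0 -> C i k f = 0.
Proof.
move=> f0 pl f1; have fl := planarI pl.
have f0I : f 0%N != LI by rewrite f0.
have Zl : LZ != f k.-1 by case: (f k.-1) pl.
have := @top_right _ _ _ _ _ _ CC k3 kN i f LZ f0I fl isT Zl.
rewrite f0 f1 mulr0 mul0r addr0 => /eqP; rewrite !mulf_eq0 (negPf JZ) /=.
by case/orP=> /eqP //; case: (f k.-1) pl => //= _ /eqP; rewrite ?oppr_eq0 oner_eq0.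
Qed.

(** Bonds, inner fields and the field along [Z] keep both ends planar, hence contribute zero by
    [rank1_planar]. Only the field along [X] on an end can turn it into [Z]. *)
Lemma rank1_ends i f : planar (f 0%N) -> planar (f k.-1) ->
  lsgn R LX (f 0%N) * C i k (mul1 f 0 LX) + lsgn R LX (f k.-1) * C i k (mul1 f k.-1 LX) = 0.
Proof.
move=> p0 pl; have f0 := planarI p0; have fl := planarI pl.
have k2 : (2 <= k)%N by nat_lia.
have pm t a u : planar (f u) -> (a == LZ) || (u != t) -> planar (mul1 f t a u).
  by rewrite mul1E; case: (u == t) => //=; rewrite orbF => + /eqP ->; case: (f u).
have := level_mid CC k3 kN i f0 fl; rewrite inner_rank1; last first.
  move=> t tk sg kl; apply: rank1_planar; rewrite mul2E; case: ifP => // _.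
    by case: (f 0%N) p0.
  by case: (f k.-1) pl.
rewrite /killl /killr !planarJ0 // !mul0r !add0r sum_ends // /field.
  rewrite (@rank1_planar _ (mul1 f 0 LZ)); try (by apply: pm => //; nat_lia).
  rewrite (@rank1_planar _ (mul1 f k.-1 LZ)); try (by apply: pm => //; nat_lia).
  rewrite !mulr0 !addr0 -mulrDr => /eqP; rewrite mulf_eq0 (negPf hX) /=.
  by move/eqP.
move=> s sk; rewrite !rank1_planar ?mulr0 ?addr0 //; apply: pm => //; apply/orP; right; nat_lia.
Qed.


Lemma rank1_ZX i f : f 0%N = LZ -> f k.-1 = LX -> C i k f = 0.
Proof.
move=> f0 fl; have := @rank1_ends i (upd f 0 LY).
rewrite /upd /= [k.-1 == 0%N](_ : _ = false) ?fl; last by nat_lia.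
move=> /(_ isT isT) /=; rewrite mul0r mul1r addr0 => <-.
by word_eq.
Qed.

Lemma rank1_XZ i f : f 0%N = LX -> f k.-1 = LZ -> C i k f = 0.
Proof.
move=> f0 fl; have := @rank1_ends i (upd f k.-1 LY).
rewrite /upd eqxx /= [_ == k.-1](_ : _ = false) ?f0; last by nat_lia.
move=> /(_ isT isT) /=; rewrite mul0r mul1r add0r => <-.
by word_eq.
Qed.

Lemma rank1_YZ i f : f 0%N = LY -> f k.-1 = LZ ->
  C i k f = - C i k (upd (upd f 0 LZ) k.-1 LY).
Proof.
move=> f0 fl; have := @rank1_ends i (upd f k.-1 LY).
rewrite /upd eqxx /= [_ == k.-1](_ : _ = false) ?f0; last by nat_lia.
move=> /(_ isT isT) /=; rewrite !mul1r addrC => /eqP; rewrite addr_eq0 => /eqP E.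
have -> : C i k f = C i k (mul1 (upd f k.-1 LY) k.-1 LX) by word_eq.
by rewrite E; congr (- _); word_eq; subst; rewrite f0.
Qed.

(** Transport turns [Z X ... Y] into a string from [Y] to [Z] one site further; the antisymmetry
    [rank1_YZ] exchanges the ends again, and the signs cancel. *)
Lemma rank1_shift i f : f 0%N = LZ -> f 1%N = LX -> f k.-1 = LY ->
  C i k f = C i.+1 k (fun u => if u == 0%N then LZ else if u == k.-1 then LY
                        else if u == k.-2 then LX else f u.+1).
Proof.
move=> f0 f1 fl; have f0I : f 0%N != LI by rewrite f0.
have flI : f k.-1 != LI by rewrite fl.
have Zl : LZ != f k.-1 by rewrite fl.
have := @top_right _ _ _ _ _ _ CC k3 kN i f LZ f0I flI isT Zl.
rewrite f0 f1 fl /= mulr1 -mulrDr => /eqP; rewrite mulf_eq0 (negPf JZ) /=.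
rewrite addr_eq0 => /eqP ->.
rewrite rank1_YZ ?opprK; first by word_eq; rewrite ?fl.
  by rewrite /shiftl_word /= f0 f1.
by rewrite /shiftl_word eqxx ifN //; nat_lia.
Qed.

(** The shift brings the wrong letter to site 1. There [I] and [Z] commute with the left bond, while
    [Y] produces a string from [X] to [Z], excluded by [rank1_XZ]. *)
Lemma rank1_ZY t i f : f 0%N = LZ -> f k.-1 = LY -> (0 < t < k.-1)%N -> f t != LX ->
  C i k f = 0.
Proof.
elim: t i f => [//|t IHt] i f f0 fl tk ft.
have f0I : f 0%N != LI by rewrite f0.
have flI : f k.-1 != LI by rewrite fl.
have [f1|f1] := eqVneq (f 1%N) LX.
  rewrite rank1_shift //; case: t IHt tk ft => [|t] IHt tk ft; first by rewrite f1 in ft.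
  apply: IHt => //; [by rewrite eqxx ifN //; nat_lia|by nat_lia|].
  by rewrite !ifN //; nat_lia.
have [f1Y|f1Y] := eqVneq (f 1%N) LY; last first.
  by apply: rank1_left; rewrite ?fl //; case: (f 1%N) f1 f1Y.
have Zl : LZ != f k.-1 by rewrite fl.
have := @top_right _ _ _ _ _ _ CC k3 kN i f LZ f0I flI isT Zl.
rewrite f0 f1Y fl /= mulr1 (@rank1_XZ i.+1).
- by rewrite mulr0 addr0 => /eqP; rewrite mulf_eq0 (negPf JZ) => /eqP.
- by rewrite /shiftl_word /= f0 f1Y.
- by rewrite /shiftl_word eqxx ifN //; nat_lia.
Qed.

Lemma rank1_YZ0 t i f : f 0%N = LY -> f k.-1 = LZ -> (0 < t < k.-1)%N -> f t != LX ->
  C i k f = 0.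
Proof.
move=> f0 fl tk ft; rewrite rank1_YZ // (@rank1_ZY t) ?oppr0 //; rewrite /upd.
- by rewrite ifN //; nat_lia.
- by rewrite eqxx.
- by rewrite !ifN //; nat_lia.
Qed.

Notation mu := (C 0 k (fill k LZ LX LY)).

Lemma rank1_mu i : C i k (fill k LZ LX LY) = mu.
Proof.
elim: i => // i <-; rewrite [RHS]rank1_shift ?fill_last //; try by nat_lia.
  by word_eq.
by rewrite /fill !ifN //; nat_lia.
Qed.

Lemma rank1_muN i : C i k (fill k LY LX LZ) = - mu.
Proof.
rewrite rank1_YZ ?fill_last //; last by nat_lia.
by rewrite -(rank1_mu i); congr (- _); word_eq.
Qed.


Lemma fill_mid n al x be t : (0 < t < n.-1)%N -> fill n al x be t = x.
Proof. by move=> tn; rewrite /fill !ifN //; nat_lia. Qed.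

Lemma fill1_other n al t y x be s : (0 < s < n.-1)%N -> s != t -> fill1 n al t y x be s = x.
Proof. by move=> sn st; rewrite /fill1 (negPf st) !ifN //; nat_lia. Qed.

Lemma planar_fill1 n al t y be s : planar y -> (0 < s < n.-1)%N ->
  planar (fill1 n al t y LX be s).
Proof.
move=> yp sn; have [<-|st] := eqVneq s t; first by rewrite fill1_mid.
by rewrite fill1_other.
Qed.

Lemma mul1_ne f t a u : u != t -> mul1 f t a u = f u.
Proof. by rewrite mul1E => /negPf->. Qed.

Lemma mul1_at f t a : mul1 f t a t = lmul a (f t).
Proof. by rewrite mul1E eqxx. Qed.

Notation p := (fun i => C i k.-1).

(* [target_uv] is the relation at a target of support [k] with end letters [u], [v],
   where [p] is [X] or [Y]; a third letter in between stands for a marked letter [Y] on an inner site. *)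
Lemma target_ZX i : J LZ * p i.+1 (fill k.-1 LY LX LX) + h LZ * mu = 0.
Proof.
have k2 : (2 <= k)%N by nat_lia.
have gl : fill k LZ LX LX k.-1 = LX by apply: fill_last.
have g1 : fill k LZ LX LX 1 = LX by apply: fill_mid; nat_lia.
have glI : fill k LZ LX LX k.-1 != LI by rewrite gl.
have := @level_mid _ _ _ _ _ _ CC k3 kN i (fill k LZ LX LX) isT glI.
rewrite inner_planar // => [|t tk]; last by rewrite fill_mid.
rewrite {1}/killr gl JX !mul0r addr0 => <-; congr (_ + _).
  by rewrite /killl g1 /= mulr1; congr (_ * _); word_eq.
rewrite sum_ends // => [|s sk].
  rewrite /field gl /= !(mul0r, mulr0, mul1r, addr0, add0r).
  rewrite (@rank1_planar i (mul1 (fill k LZ LX LX) 0 LX)).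
  - by rewrite !mulr0 add0r -(rank1_mu i); congr (_ * _); word_eq; subst.
  - by [].
  - by rewrite mul1_ne ?gl //; nat_lia.
rewrite /field fill_mid //= mul0r mulr0 mul1r rank1_ZX ?mulr0 ?addr0 //.
  by rewrite mul1_ne //; nat_lia.
by rewrite mul1_ne ?gl //; nat_lia.
Qed.

Lemma target_XZ i : J LZ * p i (fill k.-1 LX LX LY) - h LZ * mu = 0.
Proof.
have k2 : (2 <= k)%N by nat_lia.
have gl : fill k LX LX LZ k.-1 = LZ by apply: fill_last.
have g1 : fill k LX LX LZ k.-2 = LX by apply: fill_mid; nat_lia.
have glI : fill k LX LX LZ k.-1 != LI by rewrite gl.
have := @level_mid _ _ _ _ _ _ CC k3 kN i (fill k LX LX LZ) isT glI.
rewrite inner_planar // => [|t tk]; last by rewrite fill_mid.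
rewrite {1}/killl JX !mul0r add0r => <-; congr (_ + _).
  by rewrite /killr g1 gl /= mulr1; congr (_ * _); word_eq.
rewrite sum_ends // => [|s sk].
  rewrite /field gl /= !(mul0r, mulr0, mul1r, addr0, add0r).
  rewrite (@rank1_planar i (mul1 (fill k LX LX LZ) k.-1 LX)).
  - by rewrite !mulr0 addr0 -mulrN -(rank1_muN i); congr (_ * _); word_eq; subst.
  - by rewrite mul1_ne //; nat_lia.
  - by rewrite mul1_at gl.
rewrite /field fill_mid //= mul0r mulr0 mul1r rank1_XZ ?mulr0 ?addr0 //.
  by rewrite mul1_ne //; nat_lia.
by rewrite mul1_ne ?gl //; nat_lia.
Qed.

Definition marked_ZZ i t := C i k (fill1 k LZ t LY LX LZ).

Lemma target_ZYY i t : (0 < t < k.-1)%N ->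
  killl J C i k (fill1 k LZ t LY LX LY) + h LX * marked_ZZ i t - h LZ * mu = 0.
Proof.
move=> tk; set g := fill1 _ _ _ _ _ _.
have k2 : (2 <= k)%N by nat_lia.
have g0 : g 0%N = LZ by [].
have gl : g k.-1 = LY by apply: fill1_last.
have gt : g t = LY by apply: fill1_mid.
have glI : g k.-1 != LI by rewrite gl.
have := @level_mid _ _ _ _ _ _ CC k3 kN i g isT glI.
rewrite inner_planar // => [|s sk]; last by apply: planar_fill1.
rewrite {1}/killr gl JY !mul0r addr0 -addrA => <-; congr (_ + _).
rewrite (sum_ends1 (t := t)) // => [|s sk st].
  rewrite /field gt gl g0 /= !(mul0r, mulr0, mul1r, addr0, add0r, mulN1r, mulrN).
  rewrite (@rank1_planar i (mul1 g 0 LX)); [|by []|by rewrite mul1_ne ?gl //; nat_lia].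
  rewrite (@rank1_ZX _ (mul1 g k.-1 LZ)); [|by rewrite mul1_ne //; nat_lia|by rewrite mul1_at gl].
  rewrite (@rank1_ZY t _ (mul1 g t LX)) //; try by rewrite ?mul1_at ?gt // mul1_ne ?gl //; nat_lia.
  rewrite !mulr0 !(oppr0, addr0, add0r) -(rank1_mu i) /g; congr (_ * _ - _ * _).
    by word_eq; subst.
  by word_eq; subst.
have gs : g s = LX by apply: fill1_other.
rewrite /field gs /= mul0r mulr0 add0r mul1r.
by rewrite (@rank1_ZY t) ?mulr0 // mul1_ne ?gl ?gt // eq_sym //; nat_lia.
Qed.

Lemma target_YZZ i t : (0 < t < k.-1)%N ->
  killr J C i k (fill1 k LY t LY LX LZ) + h LX * marked_ZZ i t + h LZ * mu = 0.
Proof.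
move=> tk; set g := fill1 _ _ _ _ _ _.
have k2 : (2 <= k)%N by nat_lia.
have g0 : g 0%N = LY by [].
have gl : g k.-1 = LZ by apply: fill1_last.
have gt : g t = LY by apply: fill1_mid.
have glI : g k.-1 != LI by rewrite gl.
have := @level_mid _ _ _ _ _ _ CC k3 kN i g isT glI.
rewrite inner_planar // => [|s sk]; last by apply: planar_fill1.
rewrite {1}/killl g0 JY !mul0r add0r -addrA => <-; congr (_ + _).
rewrite (sum_ends1 (t := t)) // => [|s sk st].
  rewrite /field gt gl g0 /= !(mul0r, mulr0, mul1r, addr0, add0r, mulN1r, mulrN).
  rewrite (@rank1_planar i (mul1 g k.-1 LX)); [|by rewrite mul1_ne //; nat_lia|by rewrite mul1_at gl].
  rewrite (@rank1_XZ _ (mul1 g 0 LZ)); [|by rewrite mul1_at|by rewrite mul1_ne ?gl //; nat_lia].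
  rewrite (@rank1_YZ0 t _ (mul1 g t LX)) //; try by rewrite ?mul1_at ?gt // mul1_ne ?gl //; nat_lia.
  rewrite !mulr0 !(oppr0, addr0, add0r) -[mu]opprK -(rank1_muN i) /g mulrN.
  by congr (_ * _ - _ * _); word_eq; subst.
have gs : g s = LX by apply: fill1_other.
rewrite /field gs /= mul0r mulr0 add0r mul1r.
by rewrite (@rank1_YZ0 t) ?mulr0 // mul1_ne ?gl ?gt // eq_sym //; nat_lia.
Qed.

Lemma killl_mark1 i n be : (3 <= n)%N ->
  killl J C i n (fill1 n LZ 1 LY LX be) = - (J LZ * C i.+1 n.-1 (fill n.-1 LX LX be)).
Proof.
move=> n3; have g1 : fill1 n LZ 1 LY LX be 1 = LY by apply: fill1_mid; nat_lia.
by rewrite /killl g1 /= mulrN1 mulNr; congr (- (_ * _)); word_eq.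
Qed.

Lemma killl_markS i n t be : (0 < t < n.-2)%N ->
  killl J C i n (fill1 n LZ t.+1 LY LX be) = J LZ * C i.+1 n.-1 (fill1 n.-1 LY t LY LX be).
Proof.
move=> tn; have g1 : fill1 n LZ t.+1 LY LX be 1 = LX.
  by apply: fill1_other; nat_lia.
by rewrite /killl g1 /= mulr1; congr (_ * _); word_eq.
Qed.

Lemma killr_mark_last i n al : (3 <= n)%N ->
  killr J C i n (fill1 n al n.-2 LY LX LZ) = - (J LZ * C i n.-1 (fill n.-1 al LX LX)).
Proof.
move=> n3; have g1 : fill1 n al n.-2 LY LX LZ n.-2 = LY by apply: fill1_mid; nat_lia.
rewrite /killr g1 fill1_last; last by nat_lia.
by rewrite /= mulrN1 mulNr; congr (- (_ * _)); word_eq.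
Qed.

Lemma killr_mark i n t al : (0 < t < n.-2)%N ->
  killr J C i n (fill1 n al t LY LX LZ) = J LZ * C i n.-1 (fill1 n.-1 al t LY LX LY).
Proof.
move=> n3; have g1 : fill1 n al t LY LX LZ n.-2 = LX by apply: fill1_other; nat_lia.
rewrite /killr g1 fill1_last; last by nat_lia.
by rewrite /= mulr1; congr (_ * _); word_eq.
Qed.

(** The targets [target_ZYY] with mark [t.+1] at [i] and [target_YZZ] with mark [t] at [i.+1] share
    the same string of support k - 1. Eliminating it moves the mark by one site, and each of the two
    targets contributes one [h LZ * mu], hence the 2. *)
Lemma marked_walk t i : (0 < t < k.-1)%N ->
  h LX * marked_ZZ i t = t%:R * (2%:R * (h LZ * mu)).
Proof.
elim: t i => // -[|t] IHt i tk.
  by have := target_ZYY i tk; have := target_XZ i.+1; rewrite killl_mark1 //; lra.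
have tk1 : (0 < t.+1 < k.-1)%N by nat_lia.
have tk2 : (0 < t.+1 < k.-2)%N by nat_lia.
have := target_ZYY i tk; have := target_YZZ i.+1 tk1; rewrite IHt //.
rewrite killl_markS // killr_mark // => E1 E2.
rewrite [t.+2%:R]mulrSr; lra.
Qed.

(** At the right end the shortened string is the one of [target_ZX]. The 2(k - 2) terms of the walk
    and one term from each of these two targets give 2(k - 1). *)
Lemma rank1_mu0 : mu = 0.
Proof.
have k0 : (0 < k.-2 < k.-1)%N by nat_lia.
have := target_YZZ 1 k0; rewrite killr_mark_last // marked_walk //.
have := target_ZX 0 => E1 E2.
have /eqP : 2%:R * k.-2.+1%:R * (h LZ * mu) = 0 by rewrite mulrSr; lra.
by rewrite !mulf_eq0 !pnatr_eq0 (negPf hZ) /= => /eqP.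
Qed.


Lemma rank1_Zp i f : f 0%N = LZ -> planar (f k.-1) -> C i k f = 0.
Proof.
move=> f0 pl; have [fl|fl] := eqVneq (f k.-1) LX; first exact: rank1_ZX.
have {}fl : f k.-1 = LY by case: (f k.-1) pl fl.
apply/eqP; apply: contraT => nz; case/eqP: nz.
rewrite -rank1_mu0 -(rank1_mu i).
have [ok|] := boolP (all (fun t => f t == LX) (iota 1 k.-2)).
  apply: (cc_ext CC) => t tk; rewrite /fill; case_nat_eqs; try by subst.
  by apply/eqP/(allP ok); rewrite mem_iota; nat_lia.
move=> /allPn[t]; rewrite mem_iota => tk ft.
by rewrite rank1_mu rank1_mu0 (@rank1_ZY t) //; nat_lia.
Qed.

Lemma rank1_pZ i f : planar (f 0%N) -> f k.-1 = LZ -> C i k f = 0.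
Proof.
move=> p0 fl; have [f0|f0] := eqVneq (f 0%N) LX; first exact: rank1_XZ.
have {}f0 : f 0%N = LY by case: (f 0%N) p0 f0.
rewrite rank1_YZ // rank1_Zp ?oppr0 // /upd ?eqxx //.
by rewrite ifN //; nat_lia.
Qed.

Lemma target_Zp i g : g 0%N = LZ -> planar (g k.-1) ->
  J LZ * lsgn R LZ (g 1%N) * p i.+1 (fun t => upd g 1 (lmul LZ (g 1%N)) t.+1)
  + h LX * (lsgn R LX (g k.-1) * C i k (mul1 g k.-1 LX)) = 0.
Proof.
move=> g0 pl; have k2 : (2 <= k)%N by nat_lia.
have g0I : g 0%N != LI by rewrite g0.
have glI := planarI pl.
have := level_mid CC k3 kN i g0I glI; rewrite inner_rank1; last first.
  move=> t tk _; rewrite /kills g0 eqxx andbT negb_or => /andP[t0 _].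
  apply: rank1_Zp; first by rewrite mul2E ifN //; nat_lia.
  by rewrite mul2E; case: ifP => // _; case: (g k.-1) pl.
rewrite /killr planarJ0 // !mul0r addr0 sum_ends // => [|s sk].
  rewrite /field g0 /= !(mul0r, mulr0, addr0).
  rewrite (@rank1_planar i (mul1 g 0 LX)); [|by rewrite mul1_at g0|by rewrite mul1_ne //; nat_lia].
  rewrite (@rank1_Zp i (mul1 g k.-1 LZ)); [|by rewrite mul1_ne //; nat_lia|]; last first.
    by rewrite mul1_at; case: (g k.-1) pl.
  by rewrite !mulr0 add0r addr0 /killl g0.
by rewrite /field !rank1_Zp ?mulr0 ?addr0 // mul1_ne //; nat_lia.
Qed.

Lemma target_pZ i g : planar (g 0%N) -> g k.-1 = LZ ->
  J LZ * lsgn R LZ (g k.-2) * p i (upd g k.-2 (lmul LZ (g k.-2)))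
  + h LX * (lsgn R LX (g 0%N) * C i k (mul1 g 0 LX)) = 0.
Proof.
move=> p0 gl; have k2 : (2 <= k)%N by nat_lia.
have glI : g k.-1 != LI by rewrite gl.
have g0I := planarI p0.
have := level_mid CC k3 kN i g0I glI; rewrite inner_rank1; last first.
  move=> t tk _; rewrite /kills gl eqxx andbT negb_or => /andP[_ tl].
  apply: rank1_pZ; last by rewrite mul2E ifN //; nat_lia.
  by rewrite mul2E; case: ifP => // _; case: (g 0%N) p0.
rewrite /killl planarJ0 // !mul0r add0r sum_ends // => [|s sk].
  rewrite /field gl /= !(mul0r, mulr0, addr0).
  rewrite (@rank1_planar i (mul1 g k.-1 LX)); [|by rewrite mul1_ne //; nat_lia|by rewrite mul1_at gl].
  rewrite (@rank1_pZ i (mul1 g 0 LZ)); [|by rewrite mul1_at; case: (g 0%N) p0|]; last first.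
    by rewrite mul1_ne //; nat_lia.
  by rewrite !mulr0 !addr0 /killr gl.
by rewrite /field !rank1_pZ ?mulr0 ?addr0 // mul1_ne //; nat_lia.
Qed.

(** * Strings with Z at both ends *)

Lemma lsgnZ_bar x : planar x -> lsgn R LZ (lmul LZ x) != 0.
Proof. by case: x => //= _; rewrite ?oppr_eq0 oner_eq0. Qed.

(** The string is extended at the right by a bond [Z Z]. In that target the field along [X] commutes
    with the first letter, so nothing of support k remains. *)
Lemma low_X_first i u : u 0%N = LX -> planar (u k.-2) -> p i u = 0.
Proof.
move=> u0 ul; pose g t := if t == k.-1 then LZ else if t == k.-2 then lmul LZ (u k.-2) else u t.
have g0 : g 0%N = LX by rewrite /g !ifN //; nat_lia.
have g2 : g k.-2 = lmul LZ (u k.-2) by rewrite /g ifN ?eqxx //; nat_lia.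
have gl : g k.-1 = LZ by rewrite /g eqxx.
have := @target_pZ i g; rewrite g0 g2 gl lsgn_self mul0r mulr0 addr0 => /(_ isT erefl) /eqP.
rewrite !mulf_eq0 (negPf JZ) (negPf (lsgnZ_bar ul)) !orFb => /eqP <-.
by rewrite lmulK; word_eq; rewrite /g; case_nat_eqs.
Qed.

Lemma low_X_last i u : planar (u 0%N) -> u k.-2 = LX -> p i u = 0.
Proof.
move=> u0 ul; move: i; apply: (all_pos k3 kN) => i; last by rewrite (cc_per CC).
have [g [g0 g1 gS]] : exists g, [/\ g 0%N = LZ, g 1%N = lmul LZ (u 0%N)
    & forall t, (0 < t)%N -> g t.+1 = u t].
  by exists (scons LZ (upd u 0 (lmul LZ (u 0%N)))); split=> // -[].
have gl : g k.-1 = LX by rewrite -[k.-1](@prednK k.-1) ?gS //; nat_lia.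
have := @target_Zp i g g0; rewrite g1 gl lsgn_self mul0r mulr0 addr0 => /(_ isT) /eqP.
rewrite !mulf_eq0 (negPf JZ) (negPf (lsgnZ_bar u0)) !orFb => /eqP <-.
by rewrite lmulK; apply: (cc_ext CC) => -[|t] tk; rewrite /upd //= gS.
Qed.


Lemma rank1_ZZ_first i f : f 0%N = LZ -> f k.-1 = LZ -> f 1%N != LX -> C i k f = 0.
Proof.
move=> f0 fl f1; pose g := upd f k.-1 LY.
have g0 : g 0%N = LZ by rewrite /g /upd ifN //; nat_lia.
have g1 : g 1%N = f 1%N by rewrite /g /upd ifN //; nat_lia.
have gl : g k.-1 = LY by rewrite /g /upd eqxx.
have := @target_Zp i g g0; rewrite g1 gl => /(_ isT).
rewrite (_ : _ * p i.+1 _ = 0) => [|].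
  rewrite add0r /= mul1r => /eqP; rewrite mulf_eq0 (negPf hX) => /eqP <-.
  by rewrite /g; word_eq; subst; rewrite fl.
have [f1Y|f1Y] := eqVneq (f 1%N) LY; last first.
  suff -> : lsgn R LZ (f 1%N) = 0 by rewrite mulr0 mul0r.
  by case: (f 1%N) f1 f1Y.
rewrite f1Y low_X_first ?mulr0 //.
by rewrite /upd ifN ?prednK ?gl //; nat_lia.
Qed.

Definition shift_ZZ (f : nat -> letter) u :=
  if u == 0%N then LZ else if u == k.-1 then LZ else if u == k.-2 then LX else f u.+1.

(** Strings from [Z] to [Z] do not enter the targets of support k + 1: they would need a bond acting
    on a neighbour [I], which gives no commutator. The shift comes instead from two targets of
    support k, at [i] and [i.+1], that share one string of support k - 1. *)
Lemma rank1_ZZ_shift i f : f 0%N = LZ -> f k.-1 = LZ -> f 1%N = LX ->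
  C i k f = C i.+1 k (shift_ZZ f).
Proof.
move=> f0 fl f1; pose g := upd f k.-1 LY.
have g0 : g 0%N = LZ by rewrite /g /upd ifN //; nat_lia.
have g1 : g 1%N = LX by rewrite /g /upd ifN //; nat_lia.
have gl : g k.-1 = LY by rewrite /g /upd eqxx.
have := @target_Zp i g g0; rewrite g1 gl /= mulr1 mul1r => /(_ isT) E1.
pose g' := upd (shift_ZZ f) 0 LY.
have g'0 : g' 0%N = LY by [].
have g'1 : g' k.-2 = LX by rewrite /g' /upd /shift_ZZ eqxx !ifN //; nat_lia.
have g'l : g' k.-1 = LZ by rewrite /g' /upd /shift_ZZ eqxx !ifN //; nat_lia.
have := @target_pZ i.+1 g'; rewrite g'0 g'1 g'l /= mulr1 mul1r => /(_ isT erefl) E2.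
apply: (mulfI hX); move: E1 E2.
rewrite (_ : C i k (mul1 g k.-1 LX) = C i k f); last by rewrite /g; word_eq; subst.
rewrite (_ : C i.+1 k (mul1 g' 0 LX) = C i.+1 k (shift_ZZ f)); last first.
  by rewrite /g' /shift_ZZ; word_eq; subst.
rewrite (_ : C i.+1 k.-1 (upd g' _ _) = C i.+1 k.-1 (fun t => upd g 1 LY t.+1)); last first.
  by rewrite /g' /g /shift_ZZ; word_eq; subst.
by move=> E1 E2; lra.
Qed.

Lemma rank1_ZZ t i f : f 0%N = LZ -> f k.-1 = LZ -> (0 < t < k.-1)%N -> f t != LX ->
  C i k f = 0.
Proof.
elim: t i f => [//|t IHt] i f f0 fl tk ft.
have [f1|f1] := eqVneq (f 1%N) LX; last exact: rank1_ZZ_first.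
case: t IHt tk ft => [|t] IHt tk ft; first by rewrite f1 in ft.
rewrite rank1_ZZ_shift // IHt //.
- by rewrite /shift_ZZ eqxx ifN //; nat_lia.
- by nat_lia.
- by rewrite /shift_ZZ !ifN //; nat_lia.
Qed.

Notation nu := (C 0 k (fill k LZ LX LZ)).

Lemma rank1_nu i : C i k (fill k LZ LX LZ) = nu.
Proof.
have gl : fill k LZ LX LZ k.-1 = LZ by apply: fill_last; nat_lia.
have g1 : fill k LZ LX LZ 1 = LX by apply: fill_mid; nat_lia.
by elim: i => // i <-; rewrite [RHS]rank1_ZZ_shift // /shift_ZZ; word_eq.
Qed.

Lemma low_YXY i : J LZ * p i (fill k.-1 LY LX LY) + h LX * nu = 0.
Proof.
move: i; apply: (all_pos k3 kN) => i; last by rewrite /= (cc_per CC).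
have gl : fill k LZ LX LY k.-1 = LY by apply: fill_last; nat_lia.
have g1 : fill k LZ LX LY 1 = LX by apply: fill_mid; nat_lia.
have := @target_Zp i (fill k LZ LX LY) erefl; rewrite g1 gl /= mulr1 mul1r => /(_ isT) <-.
by rewrite -(rank1_nu i); congr (_ * _ + _ * _); word_eq; subst.
Qed.

Lemma low_YY_eq0 t i u : u 0%N = LY -> u k.-2 = LY -> (0 < t < k.-2)%N -> u t != LX -> p i u = 0.
Proof.
move=> u0 ul tk ut; move: i; apply: (all_pos k3 kN) => i; last by rewrite (cc_per CC).
have [g [g0 g1 gS]] : exists g, [/\ g 0%N = LZ, g 1%N = LX
    & forall t, (0 < t)%N -> g t.+1 = u t].
  by exists (scons LZ (upd u 0 LX)); split=> // -[].
have gl : g k.-1 = LY by rewrite -[k.-1](@prednK k.-1) ?gS //; nat_lia.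
have := @target_Zp i g g0; rewrite g1 gl => /(_ isT).
rewrite (@rank1_ZZ t.+1 i).
- rewrite !mulr0 addr0 => /eqP; rewrite !mulf_eq0 (negPf JZ) oner_eq0 !orFb => /eqP <-.
  by apply: (cc_ext CC) => -[|s] sk; rewrite /upd //= gS.
- by rewrite mul1_ne //; nat_lia.
- by rewrite mul1_at gl.
- by nat_lia.
- by rewrite mul1_ne ?gS //; nat_lia.
Qed.


Lemma target_ZYZ i t : (0 < t < k.-1)%N ->
  killl J C i k (fill1 k LZ t LY LX LZ) + killr J C i k (fill1 k LZ t LY LX LZ)
  - h LZ * nu = 0.
Proof.
move=> tk; set g := fill1 _ _ _ _ _ _.
have k2 : (2 <= k)%N by nat_lia.
have g0 : g 0%N = LZ by [].
have gl : g k.-1 = LZ by apply: fill1_last.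
have gt : g t = LY by apply: fill1_mid.
have glI : g k.-1 != LI by rewrite gl.
have := @level_mid _ _ _ _ _ _ CC k3 kN i g isT glI.
rewrite inner_planar // => [|s sk]; last by apply: planar_fill1.
move=> <-; congr (_ + _).
rewrite (sum_ends1 (t := t)) // => [|s sk st].
  rewrite /field gt gl g0 /= !(mul0r, mulr0, mul1r, addr0, add0r, mulN1r, mulrN).
  rewrite (@rank1_pZ i (mul1 g 0 LX)); [|by rewrite mul1_at g0|by rewrite mul1_ne ?gl //; nat_lia].
  rewrite (@rank1_Zp i (mul1 g k.-1 LX)); [|by rewrite mul1_ne //; nat_lia|by rewrite mul1_at gl].
  rewrite (@rank1_ZZ t _ (mul1 g t LX)) //; try by rewrite ?mul1_at ?gt // mul1_ne ?gl //; nat_lia.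
  rewrite !mulr0 !(oppr0, addr0, add0r) -(rank1_nu i) /g.
  by congr (- (_ * _)); word_eq; subst.
have gs : g s = LX by apply: fill1_other.
rewrite /field gs /= mul0r mulr0 add0r mul1r.
by rewrite (@rank1_ZZ t) ?mulr0 // mul1_ne ?gl ?gt // eq_sym //; nat_lia.
Qed.

Lemma scons_pos (x : letter) f n : (0 < n)%N -> scons x f n = f n.-1.
Proof. by case: n. Qed.

(** At support k - 1 the lengthened strings have [Z] at one end and a planar letter at the other,
    already excluded by [rank1_Zp] and [rank1_pZ]; shortening would need a coupling along a planar
    letter. So support k - 2 never enters. *)
Lemma target_low i u : planar (u 0%N) -> planar (u k.-2) ->
  (forall t, (0 < t < k.-2)%N -> planar (u t)) ->
  \sum_(0 <= s < k.-1) field i k.-1 u s = 0.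
Proof.
move=> p0 pl pm; have k2 : (2 <= k.-1)%N by nat_lia.
have u0 := planarI p0; have ul := planarI pl.
rewrite -inner_planar //; move: i; apply: (all_pos k3 kN) => i.
  have := level_low CC k3 kN i u0 ul; rewrite /killl /killr !planarJ0 // !mul0r !addr0.
  have kk : k.-1.+1 = k by rewrite prednK //; nat_lia.
  rewrite (_ : extl _ _ _ _ _ = 0); last first.
    apply: sum3_eq0 => a a0; have [aZ|aZ] := eqVneq a LZ; last first.
      by rewrite planarJ0 ?mul0r //; case: (a) a0 aZ.
    rewrite aZ kk rank1_Zp ?mulr0 // scons_pos ?mul1_ne //; nat_lia.
  rewrite (_ : extr _ _ _ _ _ = 0) ?add0r //.
  apply: sum3_eq0 => a a0; have [aZ|aZ] := eqVneq a LZ; last first.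
    by rewrite planarJ0 ?mul0r //; case: (a) a0 aZ.
  rewrite aZ kk rank1_pZ ?mulr0 // /upd ?eqxx // ifN ?mul1_ne //; nat_lia.
by rewrite (inner_per CC).
Qed.

Lemma low_planar_eq0 i u : planar (u 0%N) -> planar (u k.-2) ->
  (u 0%N != LY) || (u k.-2 != LY) -> p i u = 0.
Proof.
move=> p0 pl /orP[n0|nl]; first by apply: low_X_first => //; case: (u 0%N) p0 n0.
by apply: low_X_last => //; case: (u k.-2) pl nl.
Qed.

Lemma low_ZX i : J LZ * p i (fill k.-1 LZ LX LX) = h LZ * nu.
Proof.
set u := fill k.-1 LY LX LX.
have u0 : u 0%N = LY by [].
have ul : u k.-2 = LX by apply: fill_last; nat_lia.
have um t : (0 < t < k.-2)%N -> u t = LX by move=> tk; apply: fill_mid; nat_lia.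
have k2 : (2 <= k.-1)%N by nat_lia.
have := @target_low i u isT; rewrite ul => /(_ isT); rewrite sum_ends // => [|s sk].
  rewrite /field u0 ul /= !(mul0r, mulr0, mul1r, addr0, add0r, mulN1r, mulrN).
  rewrite (@low_planar_eq0 i (mul1 u 0 LZ)); try by rewrite ?mul1_at ?u0 // mul1_ne ?ul //; nat_lia.
  rewrite (_ : C i k.-1 (mul1 u 0 LX) = p i (fill k.-1 LZ LX LX)); last by rewrite /u; word_eq; subst.
  rewrite (_ : C i k.-1 (mul1 u k.-2 LZ) = p i (fill k.-1 LY LX LY)); last by rewrite /u; word_eq; subst.
  move=> E; have E1 : h LX * p i (fill k.-1 LZ LX LX) + h LZ * p i (fill k.-1 LY LX LY) = 0.
    by rewrite -[RHS]E => [|t tk]; [ring|rewrite um].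
  have := low_YXY i; move: E1 => E1 E2; apply: (mulfI hX).
  have -> : h LX * (J LZ * p i (fill k.-1 LZ LX LX))
    = J LZ * (h LX * p i (fill k.-1 LZ LX LX) + h LZ * p i (fill k.-1 LY LX LY))
    - h LZ * (J LZ * p i (fill k.-1 LY LX LY) + h LX * nu) + h LX * (h LZ * nu) by ring.
  by rewrite E1 E2; ring.
rewrite /field um //= mul0r mulr0 add0r mul1r low_planar_eq0 ?mulr0 //.
all: rewrite ?mul1_ne ?ul ?u0 //; nat_lia.
Qed.


Lemma low_XZ i : J LZ * p i (fill k.-1 LX LX LZ) = h LZ * nu.
Proof.
set u := fill k.-1 LX LX LY.
have u0 : u 0%N = LX by [].
have ul : u k.-2 = LY by apply: fill_last; nat_lia.
have um t : (0 < t < k.-2)%N -> u t = LX by move=> tk; apply: fill_mid; nat_lia.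
have k2 : (2 <= k.-1)%N by nat_lia.
have := @target_low i u isT; rewrite ul => /(_ isT); rewrite sum_ends // => [|s sk].
  rewrite /field u0 ul /= !(mul0r, mulr0, mul1r, addr0, add0r, mulN1r, mulrN).
  rewrite (@low_planar_eq0 i (mul1 u k.-2 LZ)); try by rewrite ?mul1_at ?ul // mul1_ne ?u0 //; nat_lia.
  rewrite (_ : C i k.-1 (mul1 u k.-2 LX) = p i (fill k.-1 LX LX LZ)); last by rewrite /u; word_eq; subst.
  rewrite (_ : C i k.-1 (mul1 u 0 LZ) = p i (fill k.-1 LY LX LY)); last by rewrite /u; word_eq; subst.
  move=> E; have E1 : h LX * p i (fill k.-1 LX LX LZ) + h LZ * p i (fill k.-1 LY LX LY) = 0.
    by rewrite -[RHS]E => [|t tk]; [ring|rewrite um].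
  have := low_YXY i; move: E1 => E1 E2; apply: (mulfI hX).
  have -> : h LX * (J LZ * p i (fill k.-1 LX LX LZ))
    = J LZ * (h LX * p i (fill k.-1 LX LX LZ) + h LZ * p i (fill k.-1 LY LX LY))
    - h LZ * (J LZ * p i (fill k.-1 LY LX LY) + h LX * nu) + h LX * (h LZ * nu) by ring.
  by rewrite E1 E2; ring.
rewrite /field um //= mul0r mulr0 add0r mul1r low_planar_eq0 ?mulr0 //.
all: rewrite ?mul1_ne ?ul ?u0 //; nat_lia.
Qed.

(** In the target [Y..Y..Y] the field along [X] on either end gives the two unknowns, and the field
    along [Z] on the mark gives the unmarked string known from [low_YXY]. The common factor [h LX]
    cancels. *)
Lemma low_marked i t : (0 < t < k.-2)%N ->
  J LZ * p i (fill1 k.-1 LZ t LY LX LY) + J LZ * p i (fill1 k.-1 LY t LY LX LZ)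
  = - (h LZ * nu).
Proof.
move=> tk; set u := fill1 k.-1 LY t LY LX LY.
have u0 : u 0%N = LY by [].
have ul : u k.-2 = LY by apply: fill1_last; nat_lia.
have ut : u t = LY by apply: fill1_mid; nat_lia.
have k2 : (2 <= k.-1)%N by nat_lia.
have up s : (0 < s < k.-2)%N -> planar (u s) by move=> sk; apply: planar_fill1 => //; nat_lia.
have := @target_low i u isT; rewrite ul => /(_ isT up); rewrite (sum_ends1 (t := t)) // => [|s sk st].
  rewrite /field u0 ul ut /= !(mul0r, mulr0, mul1r, addr0, add0r, mulN1r, mulrN).
  rewrite (@low_planar_eq0 i (mul1 u 0 LZ)); try by rewrite ?mul1_at ?u0 // mul1_ne ?ul //; nat_lia.
  rewrite (@low_planar_eq0 i (mul1 u k.-2 LZ)); try by rewrite ?mul1_at ?ul ?orbT // mul1_ne ?u0 //; nat_lia.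
  rewrite (@low_YY_eq0 t i (mul1 u t LX)); try by rewrite ?mul1_at ?ut // mul1_ne ?u0 ?ul //; nat_lia.
  rewrite (_ : C i k.-1 (mul1 u 0 LX) = p i (fill1 k.-1 LZ t LY LX LY)); last by rewrite /u; word_eq; subst.
  rewrite (_ : C i k.-1 (mul1 u k.-2 LX) = p i (fill1 k.-1 LY t LY LX LZ)); last by rewrite /u; word_eq; subst.
  rewrite (_ : C i k.-1 (mul1 u t LZ) = p i (fill k.-1 LY LX LY)); last by rewrite /u; word_eq; subst.
  have := low_YXY i; set A := p i _; set A' := p i _; set B := p i _ => E1 E2; apply: (mulfI hX).
  have -> : h LX * (J LZ * A' + J LZ * B) = J LZ * (h LX * A' + h LX * B - h LZ * A)
    + h LZ * (J LZ * A + h LX * nu) + h LX * - (h LZ * nu) by ring.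
  rewrite E1; have -> : h LX * A' + h LX * B - h LZ * A = 0 by rewrite -[RHS]E2; ring.
  by ring.
have us : u s = LX by apply: fill1_other.
rewrite /field us /= mul0r mulr0 add0r mul1r.
by rewrite (@low_YY_eq0 t) ?mulr0 // mul1_ne ?ul ?ut // eq_sym //; nat_lia.
Qed.

(** [target_ZYZ] trades a right shortened string for a left shortened one, [low_marked] exchanges
    the ends of the latter; each contributes one [h LZ * nu] per step. *)
Lemma low_walk t i : (0 < t < k.-2)%N ->
  J LZ * p i (fill1 k.-1 LZ t LY LX LY) = t%:R * (2%:R * (h LZ * nu)).
Proof.
elim: t i => // -[|t] IHt i tk.
  have tk1 : (0 < 1 < k.-1)%N by nat_lia.
  by have := target_ZYZ i tk1; rewrite killl_mark1 // killr_mark // low_XZ; lra.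
have tk1 : (0 < t.+1 < k.-2)%N by nat_lia.
have tk2 : (0 < t.+2 < k.-1)%N by nat_lia.
have := target_ZYZ i tk2; have := low_marked i.+1 tk1; rewrite IHt //.
by rewrite killl_markS // killr_mark // => E1 E2; rewrite [t.+2%:R]mulrSr; lra.
Qed.

(** Up to sign, the last target collects 2(k - 3) terms from the walk and one each from
    [low_marked], from [low_ZX] and from its own field, in total 2k - 3. *)
Lemma rank1_nu0 : nu = 0.
Proof.
have k0 : (0 < k.-2 < k.-1)%N by nat_lia.
have := target_ZYZ 0 k0; rewrite killr_mark_last // low_ZX.
(* For k = 3 the mark is next to both ends, and the three single terms come without a walk. *)
have [k1|k1] := eqVneq k.-2 1%N.
  rewrite k1 killl_mark1 // low_XZ => E; apply: (mulfI hZ); lra.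
have kS : (k.-2 = k.-2.-1.+1)%N by nat_lia.
have tk : (0 < k.-2.-1 < k.-2)%N by nat_lia.
rewrite [X in killl _ _ _ _ (fill1 _ _ X _ _ _)]kS killl_markS //.
have := low_marked 1 tk; rewrite low_walk // => E1 E2.
have /eqP : (2%:R * k.-2.-1%:R + 3%:R) * (h LZ * nu) = 0 by lra.
rewrite !mulf_eq0 (negPf hZ) orFb -natrM -natrD pnatr_eq0 => /orP[/eqP ?|/eqP //].
by exfalso; nat_lia.
Qed.

Lemma rank1_top0 i f : f 0%N != LI -> f k.-1 != LI -> C i k f = 0.
Proof.
move=> f0 fl; have [p0|/(planarP f0) f0Z] := boolP (planar (f 0%N)).
  have [pl|/(planarP fl) flZ] := boolP (planar (f k.-1)); first exact: rank1_planar.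
  exact: rank1_pZ.
have [pl|/(planarP fl) flZ] := boolP (planar (f k.-1)); first exact: rank1_Zp.
apply/eqP; apply: contraT => nz; case/eqP: nz.
rewrite -rank1_nu0 -(rank1_nu i).
have [ok|] := boolP (all (fun t => f t == LX) (iota 1 k.-2)).
  apply: (cc_ext CC) => t tk; rewrite /fill; case_nat_eqs; try by subst.
  by apply/eqP/(allP ok); rewrite mem_iota; nat_lia.
move=> /allPn[t]; rewrite mem_iota => tk ft.
by rewrite rank1_nu rank1_nu0 (@rank1_ZZ t) //; nat_lia.
Qed.

End RankOne.

(** * Rank three *)

Section Nested.
Variables (R : realFieldType) (J h : letter -> R).

Definition nonid (w : seq letter) := all (fun x => x != LI) w.

(** Up to a constant, the coefficient at [w] of the commutator of [F], living on all sites but the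
    last, with the bond operator [g] on the last two. The argument [g] is left general because the
    bond rotated by the field occurs as well. *)
Fixpoint bracket_right (g : letter -> letter -> R) (F : seq letter -> R) w : R :=
  match w with
  | [::] => 0
  | z :: v =>
    match v with
    | [:: b] => sum3 (fun x => lsgn R x z * g x b * F [:: lmul x z])
    | _ => bracket_right g (fun u => F (z :: u)) v
    end
  end.

Definition bracket_left (F : seq letter -> R) w : R :=
  if w is a :: x :: s then J a * lsgn R a x * F (lmul a x :: s) else 0.

(** Coefficients of the commutator with the total field, as a sum over the sites of the word. *)
Fixpoint rotate (F : seq letter -> R) w : R :=
  if w is x :: v then
    sum3 (fun c => h c * lsgn R c x * F (lmul c x :: v)) + rotate (fun u => F (x :: u)) v
  else 0.

Definition bond (x y : letter) : R := (x == y)%:R * J x.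

Definition rotated_bond (x y : letter) : R := rotate (fun w => bond (nth LI w 0) (nth LI w 1)) [:: x; y].

Fixpoint nest_from (g : letter -> letter -> R) c w : R :=
  match w with
  | [::] => 0
  | [:: d] => g c d
  | d :: s => J c * lsgn R c (lmul c d) * nest_from g (lmul c d) s
  end.

(* [nest g] is the coefficient function of the iterated commutator
   [h_1, [h_2, ... [h_m, g]]] of the bond operators, with last bond [g]. *)
Definition nest g w : R := if w is c :: v then nest_from g c v else 0.

Lemma nest_cons g a d s : (0 < size s)%N ->
  nest g [:: a, d & s] = - bracket_left (nest g) [:: a, d & s].
Proof.
case: s => //= y s _; rewrite -!mulNr; congr (_ * _).
by case: a; case: d; rewrite /= ?mulr1 ?mulr0 ?mulrN1 ?oppr0 ?opprK.
Qed.

Lemma bracket_right_cons g F z b c v :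
  bracket_right g F [:: z, b, c & v] = bracket_right g (fun u => F (z :: u)) [:: b, c & v].
Proof. by []. Qed.

Lemma bracket_right_ext g F G w :
  (forall u, nonid u -> size u = (size w).-1 -> F u = G u) -> nonid w ->
  bracket_right g F w = bracket_right g G w.
Proof.
elim: w F G => // z [|b [|c v]] IHw F G FG wn //.
  apply: eq_sum3 => x x0; have [->|zx] := eqVneq z x; first by rewrite lsgn_self !mul0r.
  by rewrite FG //= lmul_neqI.
rewrite !bracket_right_cons; apply: IHw; last by case/andP: wn.
by move=> u un us; apply: FG; rewrite /= ?us // un; case/andP: wn => ->.
Qed.

Lemma bracket_right_lin g F G a b w :
  bracket_right g (fun u => a * F u + b * G u) w
  = a * bracket_right g F w + b * bracket_right g G w.
Proof.
elim: w F G => [|z [|y [|c v]] IHw] F G; rewrite ?bracket_right_cons ?IHw //=.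
- by rewrite !mulr0 addr0.
- by rewrite !mulr0 addr0.
- by rewrite /sum3; ring.
Qed.

Lemma rotate_cons F x v : rotate F (x :: v) =
  sum3 (fun c => h c * lsgn R c x * F (lmul c x :: v)) + rotate (fun u => F (x :: u)) v.
Proof. by []. Qed.

Lemma rotate_ext F G w : (forall u, nonid u -> size u = size w -> F u = G u) ->
  nonid w -> rotate F w = rotate G w.
Proof.
elim: w F G => // x w IHw F G FG /= /andP[x0 wn]; congr (_ + _).
  apply: eq_sum3 => c c0; have [->|cx] := eqVneq x c; first by rewrite lsgn_self mulr0 !mul0r.
  by rewrite FG //= lmul_neqI.
by apply: IHw => // u un us; apply: FG; rewrite /= ?us // x0.
Qed.

Lemma rotate_scale F a w : rotate (fun u => a * F u) w = a * rotate F w.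
Proof.
elim: w F => [|x w IHw] F; rewrite /= ?mulr0 // IHw /sum3; ring.
Qed.

Lemma rotated_bondE x y : rotated_bond x y =
  sum3 (fun c => h c * lsgn R c x * bond (lmul c x) y)
  + sum3 (fun c => h c * lsgn R c y * bond x (lmul c y)).
Proof. by rewrite /rotated_bond /= addr0. Qed.

(** Leibniz rule: the commutator with the field is a derivation and falls either on [F] or on the
    bond. *)
Lemma rotate_bracket_right F w : (1 < size w)%N -> nonid w ->
  rotate (bracket_right bond F) w
  = bracket_right bond (rotate F) w + bracket_right rotated_bond F w.
Proof.
elim: w F => // z [|b [|c v]] IHw F // _ wn.
  rewrite /= !addr0 /sum3 !rotated_bondE /bond /sum3; clear IHw wn.
  by case: z; case: b; rewrite /=; ring.
have /andP[z0 vn] := wn.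
have -> : rotate (bracket_right bond F) [:: z, b, c & v] =
    sum3 (fun e => h e * lsgn R e z * bracket_right bond (fun u => F (lmul e z :: u)) [:: b, c & v])
    + rotate (bracket_right bond (fun u => F (z :: u))) [:: b, c & v].
  rewrite rotate_cons; apply: (f_equal2 +%R); first by [].
  by apply: rotate_ext => // -[|b' [|c' v']].
rewrite IHw // addrA; congr (_ + _).
rewrite bracket_right_cons /sum3.
have -> : bracket_right bond (fun u => rotate F (z :: u)) [:: b, c & v] =
  bracket_right bond (fun u => 1 * (h LX * lsgn R LX z * F (lmul LX z :: u)
    + h LY * lsgn R LY z * F (lmul LY z :: u)) + 1 * (
    1 * rotate (fun u => F (z :: u)) u + h LZ * lsgn R LZ z * F (lmul LZ z :: u))) [:: b, c & v].
  by apply: bracket_right_ext => // u _ _; rewrite rotate_cons /sum3; ring.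
rewrite !bracket_right_lin; ring.
Qed.

Lemma nest_cons2 g a d s : (0 < size s)%N ->
  nest g [:: a, d & s] = J a * lsgn R a (lmul a d) * nest g (lmul a d :: s).
Proof. by case: s. Qed.

(** By the Jacobi identity, since the first bond commutes with a last bond that it does not touch,
    the iterated commutator can be opened at its right end as well. *)
Lemma nest_right g c s : (1 < size s)%N -> nonid (c :: s) ->
  nest g (c :: s) = bracket_right g (nest bond) (c :: s).
Proof.
elim: s c => // d [//|b [|e s]] IHs c _ wn.
  rewrite /= /sum3 /bond; clear IHs wn.
  by case: c; case: d; case: b; rewrite /=; ring.
rewrite bracket_right_cons bracket_right_cons nest_cons2 //.
have /andP[c0 /andP[d0 sn]] := wn.
have -> : bracket_right g (fun u => nest bond [:: c, d & u]) [:: b, e & s]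
   = bracket_right g (fun u => J c * lsgn R c (lmul c d) * nest bond (lmul c d :: u)
      + 0 * nest bond u) [:: b, e & s].
  apply: bracket_right_ext => // u _ us; rewrite mul0r addr0 nest_cons2 //.
  by rewrite us.
rewrite bracket_right_lin mul0r addr0.
have [->|dc] := eqVneq d c.
  by rewrite lmulxx lsgnI mulr0 !mul0r.
by rewrite IHs //= lmul_neqI.
Qed.

Hypothesis JN : forall x, x != LI -> J x != 0.

Lemma other_letter y : exists2 b, b != LI & b != y.
Proof. by case: y; [exists LX|exists LY|exists LX|exists LX]. Qed.

(** A bond [b b] with [b] different from the last letter never commutes with the word, and the word
    can be read off the result; so bracketing with a fresh bond loses nothing. *)
Lemma bracket_right_inj F w : (0 < size w)%N -> nonid w ->
  (forall v, nonid v -> size v = (size w).+1 -> bracket_right bond F v = 0) -> F w = 0.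
Proof.
elim: w F => // y [|y' w] IHw F _ wn F0.
  have [b b0 by_] := other_letter y.
  have /andP[y0 _] := wn.
  have yb : y != b by rewrite eq_sym.
  have := F0 [:: lmul b y; b]; rewrite /= lmul_neqI // b0 => /(_ isT erefl).
  rewrite (@sum3_only _ _ b) // => [|x _ xb]; last by rewrite /bond (negPf xb) !(mul0r, mulr0).
  rewrite /bond eqxx lmulK mul1r => /eqP; rewrite !mulf_eq0 (negPf (JN b0)) /=.
  have by' : lmul b y != b by case: (b) b0 y0 by_; case: (y).
  by rewrite (negPf (lsgn_nz R b0 (lmul_neqI yb) by')) => /eqP.
have /andP[y0 wn'] := wn.
apply: (IHw (fun u => F (y :: u))) => // v vn vs.
have := F0 (y :: v); rewrite /= y0 vn vs => /(_ isT erefl) => <-.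
by case: v vn vs => [|? [|? ?]].
Qed.

Definition peel_letter c := match c with LX => LY | LY => LZ | _ => LX end.

Lemma peel_letterP c : c != LI -> peel_letter c != LI /\ peel_letter c != c.
Proof. by case: c. Qed.

(** A left inverse of [bracket_left] up to sign: a letter is the product of two others in two
    orders, [peel_letter] selects one of them, and [split_swap] makes the choice immaterial. *)
Definition peel (P : seq letter -> R) w : R :=
  if w is c :: s then
    P [:: peel_letter c, lmul (peel_letter c) c & s]
      / (J (peel_letter c) * lsgn R (peel_letter c) c)
  else 0.

(** * The homogeneous equation between the two end brackets *)

Section Split.
Variables (n : nat) (P X : seq letter -> R).
Hypothesis n3 : (3 <= n)%N.
Hypothesis PX : forall w, nonid w -> size w = n.+1 ->
  bracket_right bond P w + bracket_left X w = 0.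

Lemma split_eq a x v : a != LI -> x != LI -> nonid v -> size v = n.-1 ->
  bracket_right bond (fun u => P [:: a, x & u]) v = - (J a * lsgn R a x * X (lmul a x :: v)).
Proof.
move=> a0 x0 vn vs; have := PX (w := [:: a, x & v]); rewrite /= a0 x0 vn vs.
case: v vn vs => [|y [|z v]] //= vn vs; [lia|lia|].
by move=> /(_ isT) E; apply/eqP; rewrite -addr_eq0; apply/eqP/E; lia.
Qed.

(** The left bracket sees the first two letters only through their product, up to the factor
    [J a * lsgn R a x], which after division by the coupling is antisymmetric. Injectivity of the
    right bracket transfers this to [P]. *)
Lemma split_swap a x u : a != LI -> x != LI -> nonid u -> size u = n.-2 ->
  J x * P [:: a, x & u] + J a * P [:: x, a & u] = 0.
Proof.
move=> a0 x0 un us.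
apply: (@bracket_right_inj (fun u => J x * P [:: a, x & u] + J a * P [:: x, a & u])) => //.
  by rewrite us; lia.
move=> v vn vs; rewrite bracket_right_lin !split_eq //; try by rewrite vs us; lia.
by rewrite [lmul x a]lmulC [lsgn R x a]lsgnC; ring.
Qed.

Lemma split_peel w : nonid w -> size w = n -> P w = - bracket_left (peel P) w.
Proof.
case: w => [|a [|x u]] wn ws; [move: ws => /=; lia|move: ws => /=; lia|].
have /andP[a0 /andP[x0 un]] := wn.
have us : size u = n.-2 by move: ws => /=; lia.
rewrite /=; have [xa|xa] := eqVneq x a.
  have := split_swap a0 x0 un us; rewrite xa lsgn_self mulr0 mul0r oppr0 => /eqP.
  by rewrite -mulr2n mulrn_eq0 /= mulf_eq0 (negPf (JN a0)) => /eqP.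
have c0 : lmul a x != LI by apply: lmul_neqI.
have [p0 pc] := peel_letterP c0.
have nzp : lsgn R (peel_letter (lmul a x)) (lmul a x) != 0.
  by apply: lsgn_nz; rewrite // eq_sym.
have Jp := JN p0.
have [E|E] : peel_letter (lmul a x) = a \/ peel_letter (lmul a x) = x.
- by case: (a) a0 xa; case: (x) x0 => //; auto.
- move: nzp Jp; rewrite E lmulK lsgnN oppr_eq0 => nzp Jp; rewrite mulrN invrN mulrN mulrN opprK.
  by rewrite mulrC divfK ?mulf_neq0.
- move: nzp Jp; rewrite E [lmul a x]lmulC lmulK lsgnN [lsgn R x a]lsgnC opprK => nzp Jp.
  have := split_swap a0 x0 un us => /eqP; rewrite addr_eq0 => /eqP E2.
  by apply: (mulfI Jp); rewrite E2; field; rewrite nzp Jp.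
Qed.

Lemma split_right w : nonid w -> size w = n -> X w = bracket_right bond (peel P) w.
Proof.
case: w => [|c v] wn ws; first by move: ws => /=; lia.
have /andP[c0 vn] := wn; have vs : size v = n.-1 by move: ws => /=; lia.
have [p0 pc] := peel_letterP c0.
have Jp := JN p0.
have nzp : lsgn R (peel_letter c) c != 0 by apply: lsgn_nz; rewrite // eq_sym.
have d0 : lmul (peel_letter c) c != LI by rewrite lmul_neqI // eq_sym.
have := split_eq p0 d0 vn vs; rewrite lmulK lsgnN => E.
have -> : bracket_right bond (peel P) (c :: v) = bracket_right bond
  (fun u => (J (peel_letter c) * lsgn R (peel_letter c) c)^-1 *
     P [:: peel_letter c, lmul (peel_letter c) c & u] + 0 * P u) v.
  have v2 : (1 < size v)%N by lia.
  case: v v2 {wn ws vs E} vn => [|b [|e v]] // _ vn; rewrite bracket_right_cons.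
  by apply: bracket_right_ext => // u _ _; rewrite mul0r addr0 mulrC.
by rewrite bracket_right_lin E mul0r addr0; field; rewrite nzp Jp.
Qed.

End Split.

(** On three sites the two bonds overlap and [split_peel] does not apply; the linear system is
    solved directly. *)
Lemma split2 P X :
  (forall w, nonid w -> size w = 3%N -> bracket_right bond P w + bracket_left X w = 0) ->
  exists mu, forall x y, x != LI -> y != LI ->
    P [:: x; y] = mu * bond x y /\ X [:: x; y] = mu * bond x y.
Proof.
move=> PX.
have E a x b : a != LI -> x != LI -> b != LI ->
    J b * lsgn R b x * P [:: a; lmul b x] + J a * lsgn R a x * X [:: lmul a x; b] = 0.
  move=> a0 x0 b0; have := PX [:: a; x; b]; rewrite /= a0 x0 b0 => /(_ isT erefl).
  rewrite (@sum3_only _ _ b) // => [|c _ cb]; first by rewrite /bond eqxx mul1r [lsgn R b x * _]mulrC.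
  by rewrite /bond (negPf cb) !(mulr0, mul0r).
exists (P [:: LX; LX] / J LX).
have JX := @JN LX isT; have JY := @JN LY isT; have JZ := @JN LZ isT.
have PXX : P [:: LX; LX] = (P [:: LX; LX] / J LX) * J LX by rewrite divfK.
set mu := P _ / _ in PXX *.
move: (E LX LY LZ isT isT isT) (E LX LZ LY isT isT isT) (E LY LX LZ isT isT isT)
 (E LY LZ LX isT isT isT) (E LZ LX LY isT isT isT) (E LZ LY LX isT isT isT).
move: (E LX LX LY isT isT isT) (E LX LX LZ isT isT isT) (E LY LY LX isT isT isT)
 (E LY LY LZ isT isT isT) (E LZ LZ LY isT isT isT) (E LZ LZ LX isT isT isT).
move: (E LX LY LY isT isT isT) (E LX LZ LZ isT isT isT) (E LY LX LX isT isT isT)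
 (E LY LZ LZ isT isT isT) (E LZ LX LX isT isT isT) (E LZ LY LY isT isT isT).
rewrite /= !(mulr0, mul0r, mulr1, mul1r, addr0, add0r, mulrN1, mulN1r, mulNr).
(* The twelve equations with a repeated letter kill all off-diagonal coefficients; those with three
   distinct letters tie the diagonal ones together. *)
do 12!(move=> /eqP; rewrite ?oppr_eq0 mulf_eq0 ?(negPf JX) ?(negPf JY) ?(negPf JZ) /=;
  move=> /eqP ?).
move=> d1 d2 d3 d4 d5 _; clearbody mu.
have XZZ : X [:: LZ; LZ] = mu * J LZ by apply: (mulfI JX); rewrite PXX in d1; lra.
have XYY : X [:: LY; LY] = mu * J LY by apply: (mulfI JX); rewrite PXX in d2; lra.
have PYY : P [:: LY; LY] = mu * J LY by apply: (mulfI JZ); rewrite XZZ in d3; lra.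
have XXX : X [:: LX; LX] = mu * J LX by apply: (mulfI JY); rewrite PYY in d4; lra.
have PZZ : P [:: LZ; LZ] = mu * J LZ by apply: (mulfI JY); rewrite XYY in d5; lra.
by rewrite /bond => -[] -[] //= _ _; rewrite ?mul1r ?mul0r ?mulr0; split.
Qed.

Lemma rotated_bond_diag x : x != LI -> rotated_bond x x = 0.
Proof. by rewrite rotated_bondE /bond /sum3; case: x => //= _; ring. Qed.

Lemma rotated_bond_neq x y : x != LI -> y != LI -> x != y ->
  rotated_bond x y = h (lmul x y) * lsgn R x y * (J y - J x).
Proof.
by rewrite rotated_bondE /bond /sum3; case: x; case: y => //= _ _ _; ring.
Qed.

Notation B := (nest bond).
Notation G := (nest rotated_bond).

Lemma rotate_nest w : (2 < size w)%N -> nonid w ->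
  rotate B w = bracket_right bond (rotate B) w + G w.
Proof.
move=> w3 wn; rewrite [G w](_ : _ = bracket_right rotated_bond B w); last first.
  by case: w w3 wn => // c s ? ?; apply: nest_right.
rewrite -rotate_bracket_right //; last by lia.
apply: rotate_ext => // u un us; case: u un us => [|c u] un us.
  by move: w3; rewrite -us.
by apply: nest_right => //; move: w3; rewrite -us.
Qed.

(* Induction on [n]: the source terms [rotate B] and [G] can be absorbed in the two
   brackets by shifting [q], and the solution of the resulting homogeneous
   equation is a left bracket of a family on words of length [n.-1], which solves
   the same equation with [ka] replaced by [ka + al]. *)
Lemma nested_family n al ka (q : nat -> seq letter -> R) : (2 <= n)%N ->
  (forall i w, nonid w -> size w = n.+1 ->
     bracket_right bond (q i) w + bracket_left (q i.+1) w
     + al * rotate B w + ka * G w = 0) ->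
  (forall x y, x != LI -> y != LI -> (n%:R * al + ka) * rotated_bond x y = 0) /\
  (al = 0 -> ka = 0 ->
   exists la, forall i w, nonid w -> size w = n -> q i w = la * B w).
Proof.
elim: n ka q => // n IHn ka q n2 E.
pose P i w := 1 * q i w + al * rotate B w.
pose X i w := q i w - (al + ka) * G w.
have PX i w : nonid w -> size w = n.+2 ->
    bracket_right bond (P i) w + bracket_left (X i.+1) w = 0.
  move=> wn ws; rewrite -(E i w wn ws) bracket_right_lin.
  have -> : bracket_left (X i.+1) w = bracket_left (q i.+1) w + (al + ka) * G w.
    case: w wn ws => [|a [|x w]] // wn ws; rewrite nest_cons; last by move: ws => /=; lia.
    by rewrite /X /=; ring.
  by rewrite rotate_nest ?ws //; ring.
have [n3|n3] := leqP 3 n.+1; last first.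
  have n1 : n = 1%N by lia.
  move: IHn E PX; rewrite n1 => {n1 n2 n3} _ E PX.
  have JX := @JN LX isT.
  pose mu i := P i [:: LX; LX] / J LX.
  have muP i x y : x != LI -> y != LI ->
      P i [:: x; y] = mu i * bond x y /\ X i.+1 [:: x; y] = mu i * bond x y.
    move=> x0 y0; have [w wn ws|m mP] := @split2 (P i) (X i.+1); first exact: PX.
    rewrite (_ : mu i = m); first exact: mP.
    by rewrite /mu; have [-> _] := mP LX LX isT isT; rewrite /bond eqxx mul1r mulfK.
  split=> [x y x0 y0|al0 ka0].
    have [<-|xy] := eqVneq x y; first by rewrite rotated_bond_diag // mulr0.
    (* [P 1] and [X 1] come from the same [q 1] and both vanish off the diagonal, so their
       difference, which consists of source terms only, vanishes too. *)
    have [E1 _] := muP 1%N x y x0 y0; have [_ E2] := muP 0%N x y x0 y0.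
    move: E1 E2; rewrite /P /X /bond (negPf xy) mul0r !mulr0 => E1 E2.
    have -> : rotated_bond x y = rotate B [:: x; y].
      by rewrite /rotated_bond /= /sum3.
    have <- : 1 * q 1%N [:: x; y] + al * rotate B [:: x; y]
       - (q 1%N [:: x; y] - (al + ka) * G [:: x; y])
       = (2%:R * al + ka) * rotate B [:: x; y].
      by rewrite (_ : G _ = rotate B [:: x; y]) //; ring.
    by rewrite E1 E2 subr0.
  have PE i w : P i w = q i w by rewrite /P al0 mul0r addr0 mul1r.
  have XE i w : X i w = q i w by rewrite /X al0 ka0 addr0 mul0r subr0.
  have muS i : mu i.+1 = mu i.
    have [_] := muP i LX LX isT isT; rewrite XE -PE => E1.
    by apply: (mulIf JX); rewrite {1}/mu divfK // E1 /bond eqxx mul1r.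
  have mu0 i : mu i = mu 0%N by elim: i => // i <-.
  exists (mu 0%N) => i [|x [|y [|z w]]] // /andP[x0 /andP[y0 _]] _.
  by have [E1 _] := muP i x y x0 y0; rewrite -PE E1 mu0.
pose Q i := peel (P i).
have PQ i w : nonid w -> size w = n.+1 -> P i w = - bracket_left (Q i) w.
  by apply: (split_peel n3 (fun w => @PX i w)).
have XQ i w : nonid w -> size w = n.+1 -> X i.+1 w = bracket_right bond (Q i) w.
  by apply: (split_right n3 (fun w => @PX i w)).
have n2' : (2 <= n)%N by lia.
have [|c0 cq] := IHn (ka + al) Q n2'.
  move=> i w wn ws; rewrite -XQ //.
  have -> : bracket_left (Q i.+1) w = - P i.+1 w by rewrite PQ // opprK.
  by rewrite /P /X; ring.
split=> [x y x0 y0|al0 ka0].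
  by rewrite -(c0 x y x0 y0) mulrSr; ring.
have [||la laP] := cq; rewrite ?al0 ?ka0 ?addr0 //.
exists la => i [|a [|x w]] wn ws; [by move: ws => /=; lia|by move: ws => /=; lia|].
have -> : q i [:: a, x & w] = P i [:: a, x & w] by rewrite /P al0 mul0r addr0 mul1r.
rewrite PQ // nest_cons; last by move: ws => /=; lia.
have /andP[a0 /andP[x0 wn']] := wn.
rewrite /bracket_left; have [->|xa] := eqVneq x a.
  by rewrite lsgn_self !(mulr0, mul0r, oppr0).
rewrite laP; first by ring.
  by rewrite /= lmul_neqI.
by case: ws.
Qed.

End Nested.

(** * Top coefficients in rank three *)

Section RankThree.
Variables (R : realFieldType) (J h : letter -> R) (N k : nat).
Variable C : nat -> nat -> (nat -> letter) -> R.
Hypothesis CC : conserved_coeffs J h N k C.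
Hypotheses (k3 : (3 <= k)%N) (kN : (2 * k <= N)%N).
Hypothesis JN : forall x, x != LI -> J x != 0.

Definition word_coeff i w := C i (size w) (nth LI w).

Lemma bracket_rightE F w m : size w = m.+2 -> nth LI w m.+1 != LI ->
  bracket_right (bond J) F w = J (nth LI w m.+1) * lsgn R (nth LI w m.+1) (nth LI w m)
    * F (rcons (take m w) (lmul (nth LI w m.+1) (nth LI w m))).
Proof.
elim: m w F => [|m IHm] [|z [|b [|c w]]] F // ws b0.
  rewrite /= (@sum3_only _ _ b) // => [|x _ xb].
    by rewrite /bond eqxx mul1r [lsgn R b z * _]mulrC.
  by rewrite /bond (negPf xb) !(mul0r, mulr0).
have ws' : size [:: b, c & w] = m.+2 by case: ws => /= ->.
by rewrite bracket_right_cons (IHm _ _ ws').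
Qed.

Lemma killr_word i n w : size w = n -> (1 < n)%N -> nonid w ->
  killr J C i n (nth LI w) = bracket_right (bond J) (word_coeff i) w.
Proof.
move=> ws n1 wn; have [m nm] : exists m, n = m.+2 by exists n.-2; nat_lia.
have wl t : (t < n)%N -> nth LI w t != LI by move=> tn; apply: (allP wn); rewrite mem_nth ?ws.
rewrite nm in ws n1 wl *; rewrite (bracket_rightE _ ws) ?wl // /killr /=; congr (_ * _).
have sm : size (take m w) = m by apply: size_takel; rewrite ws; nat_lia.
rewrite /word_coeff size_rcons sm; apply: (cc_ext CC) => t tm.
rewrite /upd nth_rcons sm.
case: (eqVneq t m) => [->|tm']; first by rewrite ltnn.
by rewrite nth_take [(t < m)%N](_ : _ = true) //; nat_lia.
Qed.

Lemma killl_word i n w : size w = n -> (1 < n)%N ->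
  killl J C i n (nth LI w) = bracket_left J (word_coeff i.+1) w.
Proof.
case: w => [|a [|x w]] <- // _; rewrite /killl /=; congr (_ * _).
by apply: (cc_ext CC) => -[|t] _.
Qed.

(** Transport moves the identity towards the left end, where it commutes with the bond to be
    removed. *)
Lemma rank3_inside t i f : f 0%N != LI -> f k.-1 != LI ->
  (0 < t < k.-1)%N -> f t = LI -> C i k f = 0.
Proof.
elim: t i f => [//|t IHt] i f f0 fl /andP[_ tk] ft.
have [b b0 bl] := other_letter (f k.-1).
have nz : J b * lsgn R b (lmul b (f k.-1)) != 0.
  by rewrite mulf_neq0 ?JN // lsgnN oppr_eq0 lsgn_nz // eq_sym.
have := top_right CC k3 kN i f0 fl b0 bl.
rewrite (_ : _ * C i.+1 k _ = 0) ?addr0.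
  by move/eqP; rewrite mulf_eq0 (negPf nz) => /eqP.
apply: mulr3_eq0 => /lsgn_neq[f1 f10].
case: t IHt tk ft => [|t] IHt tk ft; first by rewrite ft eqxx in f1.
apply: IHt.
- by rewrite /shiftl_word /= lmul_neqI.
- by rewrite /shiftl_word eqxx ifN //; nat_lia.
- nat_lia.
- by rewrite /shiftl_word !ifN //; nat_lia.
Qed.

Lemma word_support i f : f 0%N != LI -> f k.-1 != LI -> C i k f != 0 ->
  forall t, (t < k)%N -> f t != LI.
Proof.
move=> f0 fl nz t tk; apply: contraNneq nz => ft.
have [t0|t0] := eqVneq t 0%N; first by rewrite -t0 ft in f0.
have [tl|tl] := eqVneq t k.-1; first by rewrite -tl ft in fl.
by rewrite (@rank3_inside t) //; nat_lia.
Qed.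

Lemma rotate_nth F w :
  \sum_(0 <= t < size w) sum3 (fun a => h a * lsgn R a (nth LI w t)
     * F (set_nth LI w t (lmul a (nth LI w t)))) = rotate h F w.
Proof.
elim: w F => [|x w IHw] F; first by rewrite big_nil.
by rewrite [size _]/= big_nat_recl // rotate_cons -IHw.
Qed.

(** In a word without [I], a letter commuting with the bond [a a] is [a] itself and becomes [I]; by
    [word_support] such a string has coefficient zero. Hence only fields act inside. *)
Lemma inner_word i w : size w = k -> nonid w ->
  inner J h C i k (nth LI w) = rotate h (word_coeff i) w.
Proof.
move=> ws wn.
have wl t : (t < k)%N -> nth LI w t != LI by move=> tn; apply: (allP wn); rewrite mem_nth ?ws.
have g0 : nth LI w 0 != LI by apply: wl; nat_lia.
have gl : nth LI w k.-1 != LI by apply: wl; nat_lia.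
have k2 : (2 <= k)%N by nat_lia.
rewrite inner_fields; last first.
  move=> t a tk a0 Ja sg kl; have [m0 ml] := kills_end k3 kN k2 tk g0 gl a0 kl.
  apply/eqP; apply: contraT => nz.
  have sup := word_support m0 ml nz.
  have t1 : (t < k)%N by nat_lia.
  have t2 : (t.+1 < k)%N by nat_lia.
  have := sup t t1; have := sup t.+1 t2; rewrite !mul2E !eqxx orbT /=.
  have := wl t t1; have := wl t.+1 t2; case: (bsgn_nz sg) => -[].
    by rewrite /lcom => /orP[/eqP->|/eqP->] _; rewrite ?lmulxx ?eqxx.
  by rewrite /lcom => /orP[/eqP->|/eqP->] _; rewrite ?lmulxx ?eqxx.
rewrite -rotate_nth ws !big_nat; apply: eq_bigr => t /andP[_ tk]; apply: eq_sum3 => a a0.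
congr (_ * _); rewrite /word_coeff size_set_nth ws (maxn_idPr tk).
by apply: (cc_ext CC) => u uk; rewrite /mul1 /upd nth_set_nth.
Qed.

Lemma rank3_top0 x y i f : x != LI -> y != LI -> x != y ->
  h (lmul x y) != 0 -> J x != J y ->
  f 0%N != LI -> f k.-1 != LI -> C i k f = 0.
Proof.
move=> x0 y0 xy hxy Jxy f0 fl.
have E1 j w : nonid w -> size w = k.+1 ->
    bracket_right (bond J) (word_coeff j) w + bracket_left J (word_coeff j.+1) w
    + 0 * rotate h (nest J (bond J)) w + 0 * nest J (rotated_bond J h) w = 0.
  move=> wn ws; rewrite !mul0r !addr0 -(@killr_word j k.+1) // -?(@killl_word j k.+1) //; try nat_lia.
  have wl t : (t < k.+1)%N -> nth LI w t != LI by move=> tn; apply: (allP wn); rewrite mem_nth ?ws.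
  by rewrite addrC (level_top CC) // wl.
have k2 : (2 <= k)%N by nat_lia.
(* First use, without source terms: it determines the coefficients of support k. *)
have [_ [//|//|la laP]] := nested_family JN k2 E1.
have E2 j w : nonid w -> size w = k.-1.+1 ->
    bracket_right (bond J) (word_coeff j) w + bracket_left J (word_coeff j.+1) w
    + la * rotate h (nest J (bond J)) w + 0 * nest J (rotated_bond J h) w = 0.
  rewrite prednK; last by nat_lia.
  move=> wn ws; rewrite -(@killr_word j k) // -?(@killl_word j k) //; try nat_lia.
  have wl t : (t < k)%N -> nth LI w t != LI by move=> tn; apply: (allP wn); rewrite mem_nth ?ws.
  rewrite -rotate_scale -(@rotate_ext _ _ (word_coeff j)) //; last first.
    by move=> u un us; rewrite laP // us.
  rewrite -inner_word // mul0r addr0 [X in X + _ = _]addrC (level_mid CC) //; apply: wl; nat_lia.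
have k1 : (2 <= k.-1)%N by nat_lia.
(* Second use, one support lower: the source is the field acting on [la] times the nest, and the
   solvability condition is what is wanted. *)
have [c0 _] := nested_family JN k1 E2.
have la0 : la = 0.
  have := c0 x y x0 y0; rewrite addr0 rotated_bond_neq // => /eqP.
  rewrite !mulf_eq0 (negPf hxy) subr_eq0 [_ == J x]eq_sym (negPf Jxy) !orbF.
  have yx : y != x by rewrite eq_sym.
  rewrite (negPf (lsgn_nz R x0 y0 yx)) orbF pnatr_eq0 => /orP[k10|/eqP//].
  by case/orP: k10 => [k10|/eqP //]; exfalso; nat_lia.
apply/eqP; apply: contraT => nz; have sup := word_support f0 fl nz.
have wn : nonid (mkseq f k).
  by apply/allP => z /mapP[t]; rewrite mem_iota add0n => /andP[_ /sup] fI ->.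
have := laP i (mkseq f k) wn; rewrite size_mkseq la0 mul0r => /(_ erefl).
rewrite /word_coeff size_mkseq => E; move: nz; rewrite -[X in _ != X]E.
suff -> : C i k (nth LI (mkseq f k)) = C i k f by rewrite eqxx.
by apply: (cc_ext CC) => t tk; rewrite nth_mkseq.
Qed.

End RankThree.

(** * Pauli strings as operators *)

Local Open Scope complex_scope.

Lemma eq_from_bits n a b : (a < 2 ^ n)%N -> (b < 2 ^ n)%N ->
  (forall j, (j < n)%N -> odd (a %/ 2 ^ j) = odd (b %/ 2 ^ j)) -> a = b.
Proof.
elim: n a b => [|n IHn] a b; first by rewrite expn0 !ltnS !leqn0 => /eqP-> /eqP->.
move=> an bn ab; rewrite (divn_eq a 2) (divn_eq b 2) !modn2.
rewrite (IHn (a %/ 2)%N (b %/ 2)%N).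
- by have := ab 0%N isT; rewrite expn0 !divn1 => ->.
- by rewrite ltn_divLR // -expnSr.
- by rewrite ltn_divLR // -expnSr.
- by move=> j jn; rewrite -!divnMA -expnS; apply: ab.
Qed.

Section Tensor.
Variables (R : realType) (N : nat).
Local Notation C := (R[i]).

Definition bits (a : 'I_(2 ^ N)) : {ffun 'I_N -> bool} := [ffun j => bit j a].

Lemma bits_inj : injective bits.
Proof.
move=> a b ab; apply: val_inj; apply: (@eq_from_bits N); rewrite ?ltn_ord // => j jN.
by have /ffunP/(_ (Ordinal jN)) := ab; rewrite !ffunE.
Qed.

Lemma bits_bij : bijective bits.
Proof.
apply: inj_card_bij; first exact: bits_inj.
by rewrite card_ffun card_bool !card_ord.
Qed.

Lemma sum_bits (V : nmodType) (F : {ffun 'I_N -> bool} -> V) :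
  \sum_(a : 'I_(2 ^ N)) F (bits a) = \sum_f F f.
Proof. by rewrite [RHS](reindex bits) //; apply: onW_bij; exact: bits_bij. Qed.

Definition tensor (g : 'I_N -> bool -> bool -> C) : op R N :=
  \matrix_(r, c) \prod_i g i (bit i r) (bit i c).

Lemma tensorM g g' : tensor g *m tensor g'
  = tensor (fun i r c => \sum_(b : bool) g i r b * g' i b c).
Proof.
apply/matrixP => r c; rewrite !mxE.
transitivity (\sum_t \prod_i (g i (bit i r) (bits t i) * g' i (bits t i) (bit i c))).
  by apply: eq_bigr => t _; rewrite !mxE -big_split; apply: eq_bigr => i _; rewrite ffunE.
rewrite (sum_bits (fun f : {ffun _} => \prod_i (g i (bit i r) (f i) * g' i (f i) (bit i c)))).
by rewrite bigA_distr_bigA.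
Qed.

Lemma eq_tensor g g' : (forall i r c, g i r c = g' i r c) -> tensor g = tensor g'.
Proof.
by move=> gg; apply/matrixP => r c; rewrite !mxE; apply: eq_bigr => i _.
Qed.

Lemma tensorZ g i0 x : tensor (fun i r c => (if i == i0 then x else 1) * g i r c)
  = x *: tensor g.
Proof.
apply/matrixP => r c; rewrite !mxE big_split /=; congr (_ * _).
by rewrite -big_mkcond /= big_pred1_eq.
Qed.

End Tensor.

(** * Rotated Pauli matrices *)

Section Spin.
Variables (R : realType) (Q : 'M[R]_3).
Local Notation C := (R[i]).

Definition axis (a : letter) : 'I_3 :=
  match a with LY => lift ord0 ord0 | LZ => ord_max | _ => ord0 end.

Definition spin (a : letter) (r c : bool) : C :=
  if a is LI then (r == c)%:R else \sum_be (Q (axis a) be)%:C * pauli R be r c.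

(* The matrix of x X + y Y + z Z. *)
Definition vec_spin (x y z : R) (r c : bool) : C :=
  if r == c then (if r then - z else z)%:C else x +i* (if r then y else - y).

Lemma spinE a : a != LI -> forall r c, spin a r c = vec_spin (Q (axis a) ord0)
  (Q (axis a) (lift ord0 ord0)) (Q (axis a) ord_max) r c.
Proof.
move=> a0 r c; have -> : spin a r c = \sum_be (Q (axis a) be)%:C * pauli R be r c.
  by case: (a) a0.
rewrite !big_ord_recl big_ord0 /=.
have -> : lift ord0 (lift ord0 ord0) = ord_max :> 'I_3 by apply: val_inj.
rewrite /pauli /vec_spin /=.
by case: r; case: c => /=; apply/eqP; rewrite eq_complex /=; apply/andP; split; apply/eqP; ring.
Qed.

End Spin.

Section Rot.
Variables (R : realType).
Local Notation C := (R[i]).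
Notation o0 := (ord0 : 'I_3).
Notation o1 := (lift ord0 ord0 : 'I_3).
Notation o2 := (ord_max : 'I_3).

Lemma det3 (Q : 'M[R]_3) : \det Q =
  Q o0 o0 * (Q o1 o1 * Q o2 o2 - Q o1 o2 * Q o2 o1)
  - Q o0 o1 * (Q o1 o0 * Q o2 o2 - Q o1 o2 * Q o2 o0)
  + Q o0 o2 * (Q o1 o0 * Q o2 o1 - Q o1 o1 * Q o2 o0).
Proof.
pose q (i j : nat) : R := Q (inord i) (inord j).
have -> : Q = \matrix_(i, j) q (val i) (val j).
  by apply/matrixP => i j; rewrite mxE /q !inord_val.
rewrite (expand_det_row _ ord0) !big_ord_recl big_ord0 /cofactor.
rewrite !(expand_det_row _ ord0) !big_ord_recl !big_ord0 /cofactor !det_mx11 !mxE /=.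
rewrite /bump /=; ring.
Qed.

Lemma sum_ord3 (V : nmodType) (F : 'I_3 -> V) : \sum_i F i = F o0 + F o1 + F o2.
Proof.
rewrite !big_ord_recl big_ord0 addr0 addrA; congr (_ + _ + F _).
by apply: val_inj.
Qed.

Lemma SO3_orth (Q : 'M[R]_3) : SO3 Q -> forall a b,
  Q a o0 * Q b o0 + Q a o1 * Q b o1 + Q a o2 * Q b o2 = (a == b)%:R.
Proof.
move=> [QQ _] a b; have /matrixP/(_ a b) := mulmx1C QQ.
by rewrite !mxE sum_ord3 !mxE.
Qed.

Lemma SO3_orthT (Q : 'M[R]_3) : SO3 Q -> forall a b,
  Q o0 a * Q o0 b + Q o1 a * Q o1 b + Q o2 a * Q o2 b = (a == b)%:R.
Proof.
move=> [QQ _] a b; have /matrixP/(_ a b) := QQ.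
by rewrite !mxE sum_ord3 !mxE.
Qed.

Definition cross (Q : 'M[R]_3) (a b i : 'I_3) : R :=
  match val i with
  | 0 => Q a o1 * Q b o2 - Q a o2 * Q b o1
  | 1 => Q a o2 * Q b o0 - Q a o0 * Q b o2
  | _ => Q a o0 * Q b o1 - Q a o1 * Q b o0
  end.

(** The rows of a rotation form a right-handed orthonormal basis. The determinant fixes the
    handedness, and with it the signs in the products of rotated Pauli matrices. *)
Lemma SO3_cross (Q : 'M[R]_3) : SO3 Q -> forall i,
  [/\ cross Q o0 o1 i = Q o2 i, cross Q o1 o2 i = Q o0 i & cross Q o2 o0 i = Q o1 i].
Proof.
move=> QS i; have := det3 Q; rewrite QS.2 => D.
(* Expansion of a vector in the orthonormal basis of rows. *)
have key (v : 'I_3 -> R) : v i = (v o0 * Q o0 o0 + v o1 * Q o0 o1 + v o2 * Q o0 o2) * Q o0 i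
   + (v o0 * Q o1 o0 + v o1 * Q o1 o1 + v o2 * Q o1 o2) * Q o1 i
   + (v o0 * Q o2 o0 + v o1 * Q o2 o1 + v o2 * Q o2 o2) * Q o2 i.
  have E j := SO3_orthT QS j i.
  transitivity (\sum_j v j * (Q o0 j * Q o0 i + Q o1 j * Q o1 i + Q o2 j * Q o2 i)).
    rewrite (bigD1 i) //= E eqxx mulr1 big1 ?addr0 // => j ji.
    by rewrite E (negPf ji) mulr0.
  by rewrite sum_ord3; ring.
split; rewrite (key (cross Q _ _)) /cross /= -[RHS]mul1r D; ring.
Qed.

Lemma lsgn_imag (a b : letter) : lsgn C a b = (lsgn R a b)%:C.
Proof. by case: a; case: b => //=; rewrite ?rmorphN ?rmorph1 ?rmorph0. Qed.

Definition lphase (a x : letter) : C := if lcom a x then 1 else 'i * lsgn C a x.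
Definition rphase (a x : letter) : C := if lcom a x then 1 else - ('i * lsgn C a x).

Lemma vec_spinM (x y z x' y' z' : R) r c :
  \sum_(b : bool) vec_spin x y z r b * vec_spin x' y' z' b c
  = (x * x' + y * y' + z * z')%:C * (r == c)%:R
    + 'i * vec_spin (y * z' - z * y') (z * x' - x * z') (x * y' - y * x') r c.
Proof.
rewrite big_bool /vec_spin; case: r; case: c => /=; apply/eqP;
  by rewrite eq_complex /=; apply/andP; split; apply/eqP; ring.
Qed.

Lemma vec_spinN (x y z : R) r c : vec_spin (- x) (- y) (- z) r c = - vec_spin x y z r c.
Proof.
rewrite /vec_spin; case: r; case: c => /=; apply/eqP;
  by rewrite eq_complex /=; apply/andP; split; apply/eqP; ring.
Qed.

Section SpinProduct.
Variable (Q : 'M[R]_3).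
Hypothesis QS : SO3 Q.

Definition row_cross (a b : letter) i := cross Q (axis a) (axis b) i.

Lemma row_crossE a b i : a != LI -> b != LI ->
  row_cross a b i = lsgn R a b * Q (axis (lmul a b)) i.
Proof.
have [c01 c12 c20] := SO3_cross QS i.
have crossC x y : cross Q x y i = - cross Q y x i.
  by rewrite /cross; case: (val i) => [|[|m]]; ring.
have crossI x : cross Q x x i = 0.
  by rewrite /cross; case: (val i) => [|[|m]]; ring.
have c10 := crossC o1 o0; have c21 := crossC o2 o1; have c02 := crossC o0 o2.
rewrite c01 in c10; rewrite c12 in c21; rewrite c20 in c02.
by rewrite /row_cross; case: a; case: b => //= _ _;
  rewrite ?crossI ?c01 ?c12 ?c20 ?c10 ?c21 ?c02 ?mul1r ?mulN1r ?mul0r.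
Qed.

(** By the product formula for u.sigma and v.sigma, scalar and cross products of rows determine the
    table, and for a rotation they are those of the standard basis. *)
Lemma spinM a x r c : a != LI -> \sum_(b : bool) spin Q a r b * spin Q x b c
  = lphase a x * spin Q (lmul a x) r c.
Proof.
move=> a0; have [->|x0] := eqVneq x LI.
  rewrite /lphase /lcom eqxx mul1r lmulIr big_bool /spin; case: c => /=.
    by rewrite mulr1 mulr0 addr0.
  by rewrite mulr1 mulr0 add0r.
under eq_bigr => b _ do rewrite !spinE //.
rewrite vec_spinM (SO3_orth QS) /lphase /lcom (negPf x0) orFb.
have -> : vec_spin (Q (axis a) o1 * Q (axis x) o2 - Q (axis a) o2 * Q (axis x) o1)
   (Q (axis a) o2 * Q (axis x) o0 - Q (axis a) o0 * Q (axis x) o2)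
   (Q (axis a) o0 * Q (axis x) o1 - Q (axis a) o1 * Q (axis x) o0) r c
  = vec_spin (row_cross a x o0) (row_cross a x o1) (row_cross a x o2) r c by [].
rewrite !row_crossE //; have [->|xa] := eqVneq x a.
  rewrite eqxx lmulxx /lsgn; case: (a) a0 => //= _; rewrite !mul0r /vec_spin;
  case: r; case: c => /=; apply/eqP;
  by rewrite eq_complex /=; apply/andP; split; apply/eqP; ring.
have ax : lmul a x != LI by apply: lmul_neqI.
rewrite (_ : axis a == axis x = false); last by case: (a) a0 x0 xa; case: (x).
rewrite mul0r add0r (spinE Q ax) lsgn_imag.
case: (a) a0 x0 xa ax; case: (x) => //= _ _ _ _; rewrite ?mul1r ?mulN1r ?vec_spinN ?rmorphN ?rmorph1;
  ring.
Qed.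

End SpinProduct.
End Rot.

(** * Pauli strings in a rotated frame *)

Section Strings.
Variables (R : realType) (N : nat) (Q : 'M[R]_3).
Local Notation C := (R[i]).
Notation o0 := (ord0 : 'I_3).
Notation o1 := (lift ord0 ord0 : 'I_3).
Notation o2 := (ord_max : 'I_3).
Hypothesis QS : SO3 Q.
Notation spin := (spin Q).

Lemma sum_letter (V : nmodType) (F : letter -> V) :
  \sum_a F a = F LI + (F LX + (F LY + F LZ)).
Proof.
rewrite (bigD1 LI) // (bigD1 LX) // (bigD1 LY) // (bigD1 LZ) //= big1 ?addr0 //.
by case; rewrite ?eqxx ?andbF.
Qed.

Lemma spinMr a x r c : a != LI -> \sum_(b : bool) spin x r b * spin a b c
  = rphase R a x * spin (lmul a x) r c.
Proof.
move=> a0; have [->|x0] := eqVneq x LI.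
  rewrite /rphase /lcom eqxx mul1r lmulIr big_bool /=; case: r => /=.
    by rewrite mul1r mul0r addr0.
  by rewrite mul1r mul0r add0r.
rewrite spinM // [lmul x a]lmulC; congr (_ * _).
rewrite /lphase /rphase /lcom (negPf a0) (negPf x0) eq_sym !orFb; case: ifP => // _.
by rewrite !lsgn_imag lsgnC rmorphN mulrN.
Qed.

Lemma spin_tr0 a : a != LI -> spin a false false + spin a true true = 0.
Proof.
by move=> a0; rewrite !spinE // /vec_spin /= rmorphN subrr.
Qed.

(** Completeness of the four matrices in the 2 by 2 matrices, from the orthonormality of the columns
    of [Q]. *)
Lemma spin_complete x y z w : \sum_a spin a x y * spin a z w = 2%:R * ((y == z) && (x == w))%:R.
Proof.
rewrite sum_letter !(@spinE _ Q LX) // !(@spinE _ Q LY) // !(@spinE _ Q LZ) //.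
have E i j := SO3_orthT QS i j.
move: (E o0 o0) (E o1 o1) (E o2 o2) (E o0 o1) (E o0 o2) (E o1 o2).
rewrite /= => {E} E1 E2 E3 E4 E5 E6; rewrite /vec_spin.
have -> : 2%:R * ((y == z) && (x == w))%:R = (2%:R * ((y == z) && (x == w))%:R : R)%:C :> C.
  by rewrite rmorphM !rmorph_nat.
case: x; case: y; case: z; case: w => /=; apply/eqP;
  rewrite eq_complex /=; apply/andP; split; apply/eqP; lra.
Qed.

Definition pstring (f : {ffun 'I_N -> letter}) : op R N := tensor (fun i => spin (f i)).

Definition fupd (f : {ffun 'I_N -> letter}) i x : {ffun 'I_N -> letter} :=
  [ffun j => if j == i then x else f j].

Definition single (i : 'I_N) a := fupd [ffun => LI] i a.

Lemma pstringMl f i a : a != LI ->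
  pstring (single i a) *m pstring f = lphase R a (f i) *: pstring (fupd f i (lmul a (f i))).
Proof.
move=> a0; rewrite tensorM -(tensorZ _ i); apply: eq_tensor => j r c; rewrite !ffunE.
case: eqVneq => [->|ji]; first exact: spinM.
by rewrite big_bool /=; case: r; rewrite /= !(mul0r, mul1r, addr0, add0r).
Qed.

Lemma pstringMr f i a : a != LI ->
  pstring f *m pstring (single i a) = rphase R a (f i) *: pstring (fupd f i (lmul a (f i))).
Proof.
move=> a0; rewrite tensorM -(tensorZ _ i); apply: eq_tensor => j r c; rewrite !ffunE.
case: eqVneq => [->|ji]; first exact: spinMr.
by rewrite big_bool /=; case: c; rewrite /= !(mulr0, mulr1, mul1r, addr0, add0r).
Qed.

Lemma prod_sites (i : 'I_N) (F : 'I_N -> C) (P : pred 'I_N) :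
  (forall j, j != i -> F j = (P j)%:R) ->
  \prod_j F j = F i * (([forall j, (j != i) ==> P j]) : nat)%:R.
Proof.
move=> FP; rewrite (bigD1 i) //=; congr (_ * _).
rewrite (eq_bigr (fun j => (P j)%:R)) //.
case: (boolP [forall j, (j != i) ==> P j]) => [/forallP ok|/forallPn[j]].
  by rewrite big1 // => j ji; rewrite (implyP (ok j) ji).
by rewrite negb_imply => /andP[ji Pj]; rewrite (bigD1 j) //= (negPf Pj) mul0r.
Qed.

Lemma rsig_single i a : a != LI -> rsig Q (axis a) i = pstring (single i a).
Proof.
move=> a0; apply/matrixP => r c; rewrite /rsig summxE !mxE.
rewrite (@prod_sites i _ (fun j => bit j r == bit j c)) => [|j ji]; last first.
  by rewrite !ffunE (negPf ji).
rewrite !ffunE eqxx [spin a _ _](_ : _ = \sum_be (Q (axis a) be)%:C * pauli R be (bit i r) (bit i c)).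
  by rewrite mulr_suml; apply: eq_bigr => be _; rewrite !mxE mulrA.
by case: (a) a0.
Qed.

End Strings.

(** * Commutation with the Hamiltonian in terms of coefficients *)

Section Commutator.
Variables (R : realType) (N : nat) (Q : 'M[R]_3).
Local Notation C := (R[i]).
Hypothesis QS : SO3 Q.
Hypothesis N2 : (2 <= N)%N.
Variables (Jm : 'M[R]_3) (hv : 'I_3 -> R) (J h : letter -> R).
Hypothesis JmE : forall a b, a != LI -> b != LI -> Jm (axis a) (axis b) = if a == b then J a else 0.
Hypothesis hvE : forall a, a != LI -> hv (axis a) = h a.
Variable A : op R N.
Hypothesis AH : A *m hamil (rsig Q) Jm hv = hamil (rsig Q) Jm hv *m A.

Notation pstring := (pstring Q).
Notation sg a i := (pstring (single i a)).

(** Strings are orthogonal for the trace, so this is 2^N times the coefficient of [f] in [A]. *)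
Definition coef (f : {ffun 'I_N -> letter}) : C := \tr (A *m pstring f).

Definition fupd2 (f : {ffun 'I_N -> letter}) i a :=
  fupd (fupd f i (lmul a (f i))) (nxt i) (lmul a (f (nxt i))).

Lemma nxt_neq (i : 'I_N) : nxt i != i.
Proof.
apply/negP => /eqP /(congr1 val) /= E; have i0 := ltn_ord i.
have [iN|iN] := ltnP i.+1 N; first by move: E; rewrite modn_small //; lia.
by move: E; rewrite (_ : i.+1 = N) ?modnn; lia.
Qed.

Lemma hamilE : hamil (@rsig R N Q) Jm hv = \sum_i
  ((J LX)%:C *: (sg LX i *m sg LX (nxt i)) + (J LY)%:C *: (sg LY i *m sg LY (nxt i))
   + (J LZ)%:C *: (sg LZ i *m sg LZ (nxt i))
   + ((h LX)%:C *: sg LX i + (h LY)%:C *: sg LY i + (h LZ)%:C *: sg LZ i)).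
Proof.
apply: eq_bigr => i _; rewrite !sum_ord3.
rewrite -(hvE (a := LX)) // -(hvE (a := LY)) // -(hvE (a := LZ)) //.
rewrite -!rsig_single //; congr (_ + _).
have JE a b : a != LI -> b != LI -> (Jm (axis a) (axis b))%:C = if a == b then (J a)%:C else 0.
  by move=> a0 b0; rewrite JmE //; case: ifP.
move: (JE LX LX isT isT) (JE LX LY isT isT) (JE LX LZ isT isT)
  (JE LY LX isT isT) (JE LY LY isT isT) (JE LY LZ isT isT)
  (JE LZ LX isT isT) (JE LZ LY isT isT) (JE LZ LZ isT isT) => /=.
by do 9!move=> ->; rewrite !scale0r !addr0 !add0r.
Qed.

Variable f : {ffun 'I_N -> letter}.
Let P := pstring f.
Let W := P *m A - A *m P.

Lemma trW B : \tr (B *m W) = \tr (A *m (B *m P)) - \tr (A *m (P *m B)).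
Proof.
rewrite /W mulmxBr raddfB /= !mulmxA; congr (_ - _).
  by rewrite mxtrace_mulC mulmxA.
by rewrite -mulmxA mxtrace_mulC.
Qed.

Lemma trW_site a i : a != LI -> \tr (sg a i *m W)
  = 2%:R * 'i * ((lsgn R a (f i))%:C * coef (fupd f i (lmul a (f i)))).
Proof.
move=> a0; rewrite trW /P pstringMl // pstringMr // -!scalemxAr !mxtraceZ -/(coef _).
rewrite /lphase /rphase -lsgn_imag; case: ifP => [|_]; last by ring.
rewrite /lcom => /orP[/eqP->|/eqP->]; rewrite ?lsgn_self ?lsgnI; ring.
Qed.

Lemma trW_bond a i : a != LI -> \tr (sg a i *m sg a (nxt i) *m W)
  = 2%:R * 'i * ((bsgn R a (f i) (f (nxt i)))%:C * coef (fupd2 f i a)).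
Proof.
move=> a0; have ni := nxt_neq i; have ni' : (i == nxt i) = false by rewrite eq_sym (negPf ni).
have swap : fupd (fupd f (nxt i) (lmul a (f (nxt i)))) i (lmul a (f i)) = fupd2 f i a.
  by apply/ffunP => j; rewrite !ffunE; case: (eqVneq j i) => // ->; rewrite ni'.
have El : sg a i *m sg a (nxt i) *m P
    = (lphase R a (f (nxt i)) * lphase R a (f i)) *: pstring (fupd2 f i a).
  by rewrite -mulmxA pstringMl // -scalemxAr pstringMl // scalerA !ffunE ni' swap.
have Er : P *m (sg a i *m sg a (nxt i))
    = (rphase R a (f i) * rphase R a (f (nxt i))) *: pstring (fupd2 f i a).
  by rewrite mulmxA pstringMr // -scalemxAl pstringMr // scalerA !ffunE (negPf ni).
rewrite trW El Er -!scalemxAr !mxtraceZ -/(coef _) -mulrBl mulrA; congr (_ * _).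
rewrite /bsgn /lphase /rphase rmorphD !rmorphM !rmorph_nat /= -!lsgn_imag.
have ii : 'i * 'i = -1 :> C by rewrite -expr2 sqr_i.
case: (boolP (lcom a (f i))) => [ci|_]; case: (boolP (lcom a (f (nxt i)))) => [cj|_] /=.
- have l0 x : lcom a x -> lsgn C a x = 0.
    by move=> /orP[/eqP->|/eqP->]; rewrite ?lsgn_self ?lsgnI.
  by rewrite !l0 //; ring.
- by ring.
- by ring.
- by ring.
Qed.

Lemma mxtrace_lin6 n (c1 c2 c3 c4 c5 c6 : C) (A1 A2 A3 A4 A5 A6 B : 'M[C]_n) :
  \tr ((c1 *: A1 + c2 *: A2 + c3 *: A3 + (c4 *: A4 + c5 *: A5 + c6 *: A6)) *m B)
  = c1 * \tr (A1 *m B) + c2 * \tr (A2 *m B) + c3 * \tr (A3 *m B)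
    + (c4 * \tr (A4 *m B) + c5 * \tr (A5 *m B) + c6 * \tr (A6 *m B)).
Proof. by rewrite !mulmxDl !mxtraceD -!scalemxAl !mxtraceZ. Qed.

(** As [A] commutes with the Hamiltonian, the trace of the Hamiltonian against [W] is zero. Moving
    the commutator onto the string, each term contributes 2i times a coefficient of [A]; the common
    factor is cancelled. *)
Lemma commutator_eq :
  \sum_i (sum3 (fun a => (J a * bsgn R a (f i) (f (nxt i)))%:C * coef (fupd2 f i a))
    + sum3 (fun a => (h a * lsgn R a (f i))%:C * coef (fupd f i (lmul a (f i))))) = 0.
Proof.
have trK : \tr (hamil (rsig Q) Jm hv *m W) = 0.
  by rewrite trW mulmxA AH -mulmxA mxtrace_mulC mulmxA subrr.
have nz : 2%:R * 'i != 0 :> C by rewrite mulf_neq0 ?pnatr_eq0 // neq0Ci.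
apply: (mulfI nz); rewrite mulr0 -[RHS]trK hamilE mulmx_suml [RHS]raddf_sum [LHS]mulr_sumr /=.
apply: eq_bigr => i _; rewrite mxtrace_lin6.
rewrite !trW_bond // !trW_site // /sum3.
move: (coef (fupd2 f i LX)) (coef (fupd2 f i LY)) (coef (fupd2 f i LZ)).
move: (coef (fupd f i (lmul LX (f i)))) (coef (fupd f i (lmul LY (f i)))).
move: (coef (fupd f i (lmul LZ (f i)))) => c1 c2 c3 c4 c5 c6.
rewrite !rmorphM /=.
move: ((bsgn R LX (f i) (f (nxt i)))%:C) ((bsgn R LY (f i) (f (nxt i)))%:C)
 ((bsgn R LZ (f i) (f (nxt i)))%:C) ((lsgn R LX (f i))%:C) ((lsgn R LY (f i))%:C)
 ((lsgn R LZ (f i))%:C) => b1 b2 b3 b4 b5 b6; ring.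
Qed.

End Commutator.

(** * Windows on the ring *)

Section Place.
Variables (N : nat).
Hypothesis N2 : (2 <= N)%N.

Lemma N_gt0 : (0 < N)%N. Proof. exact: ltnW. Qed.

Definition site i t : 'I_N := Ordinal (ltn_pmod (i + t) N_gt0).

(** The inverse of [site i]; adding [N - i %% N] avoids a truncated subtraction. *)
Definition offset i (j : 'I_N) := ((j + (N - i %% N)) %% N)%N.

Lemma offset_lt i j : (offset i j < N)%N.
Proof. by rewrite ltn_pmod // N_gt0. Qed.

Lemma offset_eqn i t : ((i + t + (N - i %% N)) %% N = t %% N)%N.
Proof.
have iN : (i %% N < N)%N by rewrite ltn_pmod // N_gt0.
rewrite -[RHS](modnMDl (i %/ N).+1); congr (_ %% _)%N.
by rewrite {1}(divn_eq i N) mulSn; lia.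
Qed.

Lemma siteK i t : (t < N)%N -> offset i (site i t) = t.
Proof. by move=> tN; rewrite /offset /= modnDml offset_eqn modn_small. Qed.

Lemma offsetK i j : site i (offset i j) = j.
Proof.
by apply: val_inj; rewrite /= /offset modnDmr addnA offset_eqn modn_small.
Qed.

Lemma nxt_site i t : nxt (site i t) = site i t.+1.
Proof. by apply: val_inj; rewrite /= -addn1 modnDml addn1 addnS. Qed.

Lemma siteS i t : site i.+1 t = site i t.+1.
Proof. by apply: val_inj; rewrite /= addSnnS. Qed.

Lemma site_per i t : site (i + N) t = site i t.
Proof. by apply: val_inj; rewrite /= addnAC modnDr. Qed.

Lemma site_N i : site i N = site i 0.
Proof. by apply: val_inj; rewrite /= modnDr addn0. Qed.

Lemma site_inj i t u : (t < N)%N -> (u < N)%N -> site i t = site i u -> t = u.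
Proof. by move=> tN uN E; rewrite -(siteK i tN) -(siteK i uN) E. Qed.

Lemma site_eq i t u : (t < N)%N -> (u < N)%N -> (site i t == site i u) = (t == u).
Proof. by move=> tN uN; apply/eqP/eqP => [/site_inj|->//]; apply. Qed.

Definition place i n (f : nat -> letter) : {ffun 'I_N -> letter} :=
  [ffun j => if (offset i j < n)%N then f (offset i j) else LI].

Lemma placeE i n f t : (t < N)%N -> place i n f (site i t) = if (t < n)%N then f t else LI.
Proof. by move=> tN; rewrite ffunE siteK. Qed.

Lemma place_eqP i f (g : {ffun 'I_N -> letter}) n :
  (forall t, (t < N)%N -> (if (t < n)%N then f t else LI) = g (site i t)) -> place i n f = g.
Proof.
by move=> fg; apply/ffunP => j; rewrite -(offsetK i j) placeE ?fg ?offset_lt.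
Qed.

Lemma sum_site (V : nmodType) (G : 'I_N -> V) i :
  \sum_j G j = \sum_(0 <= t < N) G (site i t).
Proof.
rewrite big_mkord (reindex (fun t : 'I_N => site i t)) //.
exists (fun j => Ordinal (offset_lt i j)) => j _; last exact: offsetK.
by apply: val_inj; rewrite /= siteK.
Qed.

End Place.

(** * From an operator to its system of real relations *)

Section Coefficients.
Variables (R : realType) (N : nat) (Q : 'M[R]_3).
Local Notation C := (R[i]).
Hypothesis QS : SO3 Q.
Hypothesis N2 : (2 <= N)%N.
Variables (Jm : 'M[R]_3) (hv : 'I_3 -> R) (J h : letter -> R).
Hypothesis JmE : forall a b, a != LI -> b != LI -> Jm (axis a) (axis b) = if a == b then J a else 0.
Hypothesis hvE : forall a, a != LI -> hv (axis a) = h a.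
Variable A : op R N.
Hypothesis AH : A *m hamil (rsig Q) Jm hv = hamil (rsig Q) Jm hv *m A.
Variable k : nat.
Hypotheses (k3 : (3 <= k)%N) (kN : (2 * k <= N)%N).
Hypothesis A_supp : forall f, coef Q A f != 0 ->
  exists s, forall j, f j != LI -> exists2 u, (u < k)%N & j = site N2 s u.
Variable re : C -> R.
Hypotheses (reD : forall x y, re (x + y) = re x + re y)
  (reZ : forall x y, re (x%:C * y) = x * re y).

(** [re] stands for the real or the imaginary part: the relations have real coefficients, so each
    part satisfies them separately. *)
Definition place_coef i n f := re (coef Q A (@place N i n f)).

Lemma re0 : re 0 = 0.
Proof. by have := reZ 0 0; rewrite mulr0 mul0r. Qed.

Lemma re_sum n (F : nat -> C) : re (\sum_(0 <= t < n) F t) = \sum_(0 <= t < n) re (F t).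
Proof. by apply: (big_morph re reD re0). Qed.

Lemma re_sum3 F : re (sum3 F) = sum3 (fun a => re (F a)).
Proof. by rewrite /sum3 !reD. Qed.

Lemma place_support i n f : (n <= N)%N -> place_coef i n f != 0 ->
  exists s, forall v, (v < n)%N -> f v != LI -> exists2 w, (w < k)%N & ((i + v) %% N = (s + w) %% N)%N.
Proof.
move=> nN nz.
have [|s sP] := A_supp (f := @place N i n f).
  by apply: contraNneq nz => E; rewrite /place_coef E re0.
exists s => v vn fv; have [|w wk E] := sP (site N2 i v).
  by rewrite placeE ?vn //; lia.
by exists w => //; have := congr1 val E.
Qed.


Lemma mod_diff s w w' m : (w < N)%N -> (w' < N)%N -> (m < N)%N ->
  ((s + w' + m) %% N = (s + w) %% N)%N -> (w' + m = w \/ w' + m = w + N)%N.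
Proof.
move=> wN wN' mN; rewrite -addnA => /eqP; rewrite eqn_modDl => /eqP.
rewrite [RHS]modn_small //; have [E|E] := ltnP (w' + m) N.
  by rewrite modn_small // => ->; left.
by rewrite -[(w' + m)%N](subnK E) modnDr modn_small; [right; lia|lia].
Qed.

(* As [2 * k <= N], two sites at distance [k] in the window are also at distance
   at least [k] on the ring. *)
Lemma place_far i n f v : (n <= N)%N -> (v + k < n)%N ->
  f v != LI -> f (v + k)%N != LI -> place_coef i n f = 0.
Proof.
move=> nN vn fv fk; apply/eqP; apply: contraT => nz.
have [s sP] := place_support nN nz.
have [|w wk E] := sP v _ fv; first by lia.
have [|w' wk' E'] := sP _ _ fk; first by [].
have := @mod_diff s w' w k; rewrite -(modnDml (s + w)) -E modnDml -addnA E'.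
by case; lia.
Qed.

Lemma place_coef_conserved : conserved_coeffs J h N k place_coef.
Proof.
have N0 : (0 < N)%N by lia.
split.
- move=> i n f g fg; congr (re (coef Q A _)); apply: (@place_eqP N N2) => t tN.
  by rewrite placeE //; case: ifP => // tn; exact: fg.
- move=> i n f; congr (re (coef Q A _)); apply: (@place_eqP N N2) => t tN.
  by rewrite site_per placeE.
- move=> i n f nN f0; congr (re (coef Q A _)); apply: (@place_eqP N N2) => -[|t] tN.
    (* Read from [i.+1], the dropped site is the last one of the ring, and [n < N] leaves it outside
       the window. *)
    have sE : site N2 i 0 = site N2 i.+1 N.-1 by rewrite siteS prednK // site_N.
    by rewrite /= f0 sE placeE ?ifN //; lia.
  by rewrite -siteS placeE //; lia.
- move=> i n f nN fn0; congr (re (coef Q A _)); apply: (@place_eqP N N2) => t tN.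
  rewrite placeE // ltnS leq_eqVlt; have [tn|_] //= := eqVneq t n.
  by rewrite tn ltnn fn0.
- move=> i f f0 fk; apply: (@place_far _ _ _ 0%N) => //; lia.
- move=> i f _ f1 fk; apply: (@place_far _ _ _ 1%N) => //; lia.
- move=> i f f0 fk _; apply: (@place_far _ _ _ 0%N) => //; lia.
- move=> i n f n2 nN f0 fl.
have := commutator_eq QS N2 JmE hvE AH (@place N i n f) => /(congr1 re).
rewrite (sum_site N2 _ i) re_sum re0 => E; rewrite -[RHS]E.
have pl t : (t < N)%N -> @place N i n f (site N2 i t) = if (t < n)%N then f t else LI.
  exact: placeE.
(* The bound [t = N] is included because the last bond of the ring leads back to the site [i], where
   [f 0 = LI]. *)
have pn t : (n.-1 <= t <= N)%N -> @place N i n f (site N2 i t) = LI.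
  move=> /andP[nt tN]; have [tN'|tN'] := ltnP t N.
    by rewrite pl //; case: ifP => // tn; rewrite -fl; congr f; lia.
  have -> : t = N by lia.
  by rewrite site_N pl // f0; case: ifP.
transitivity (\sum_(0 <= t < N) sum3 (fun a => J a * bsgn R a (@place N i n f (site N2 i t))
     (@place N i n f (site N2 i t.+1)) * re (coef Q A (fupd2 (@place N i n f) (site N2 i t) a)))
   + \sum_(0 <= t < N) sum3 (fun a => h a * lsgn R a (@place N i n f (site N2 i t)) *
     re (coef Q A (fupd (@place N i n f) (site N2 i t) (lmul a (@place N i n f (site N2 i t))))))); last first.
  rewrite -big_split; apply: eq_bigr => t _; rewrite /= reD !re_sum3 nxt_site.
  by congr (_ + _); apply: eq_sum3 => a _; rewrite reZ.
congr (_ + _).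
  rewrite [RHS](@big_cat_nat _ _ _ n.-1) //=; last by lia.
  rewrite [X in _ = _ + X]big_nat_cond [X in _ = _ + X]big1 ?addr0; last first.
    move=> t; rewrite andbT => /andP[nt tN]; apply: sum3_eq0 => a _.
    by rewrite !pn ?bsgnI ?lsgnI ?mulr0 ?mul0r //; lia.
  apply: eq_big_nat => t /andP[_ tn]; apply: eq_sum3 => a _.
  rewrite !pl; [|lia..]; rewrite !ifT; [|lia..].
  congr (_ * re (coef Q A _)); apply: (@place_eqP N N2) => u uN.
  rewrite /fupd2 /fupd !ffunE nxt_site !site_eq //; [|lia..].
  rewrite !siteK; [|lia..]; rewrite mul2E.
  case: (eqVneq u t.+1) => [->|ut]; first by rewrite orbT !ifT //; lia.
  by rewrite orbF; case: (eqVneq u t) => [->|//]; rewrite !ifT //; lia.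
rewrite [RHS](@big_cat_nat _ _ _ n) //=.
rewrite [X in _ = _ + X]big_nat_cond [X in _ = _ + X]big1 ?addr0; last first.
  move=> t; rewrite andbT => /andP[nt tN]; apply: sum3_eq0 => a _.
  by rewrite pn ?lsgnI ?mulr0 ?mul0r //; lia.
apply: eq_big_nat => t /andP[_ tn]; apply: eq_sum3 => a _.
have tN : (t < N)%N by lia.
rewrite !pl // tn; congr (_ * re (coef Q A _)); apply: (@place_eqP N N2) => u uN.
rewrite /fupd !ffunE site_eq // !siteK // mul1E.
by case: (eqVneq u t) => [->|//]; rewrite tn.
Qed.

End Coefficients.

(** * Supports of operators and of strings *)

Section Support.
Variables (R : realType) (N : nat) (Q : 'M[R]_3).
Local Notation C := (R[i]).
Hypothesis QS : SO3 Q.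
Hypothesis N2 : (2 <= N)%N.
Notation pstring := (@pstring R N Q).
Notation coef := (@coef R N Q).

(* Flipping the bit [j] of both indices changes the sign of the trace. *)
Lemma acts_on_coef0 (S : {set 'I_N}) (B : op R N) (f : {ffun 'I_N -> letter}) j :
  acts_on S B -> f j != LI -> j \notin S -> coef B f = 0.
Proof.
move=> [B0 BE] fj jS; have [binv bK Kb] := bits_bij N.
pose flip (a : 'I_(2 ^ N)) : 'I_(2 ^ N) := binv [ffun i => (i == j) (+) bit i a].
have bit_flip i a : bit i (flip a) = (i == j) (+) bit i a.
  by have /ffunP/(_ i) := Kb [ffun i => (i == j) (+) bit i a]; rewrite !ffunE.
have flipK : involutive flip.
  by move=> a; apply: bits_inj; apply/ffunP => i; rewrite !ffunE !bit_flip addbA addbb.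
pose P (a b : 'I_(2 ^ N)) := \prod_i spin Q (f i) (bit i b) (bit i a).
have coefE : coef B f = \sum_a \sum_b B a b * P a b.
  by rewrite /coef /mxtrace; apply: eq_bigr => a _; rewrite mxE; apply: eq_bigr => b _; rewrite mxE.
have coefE' : coef B f = \sum_a \sum_b B (flip a) (flip b) * P (flip a) (flip b).
  rewrite coefE (reindex_inj (inv_inj flipK)); apply: eq_bigr => a _.
  by rewrite (reindex_inj (inv_inj flipK)).
have : coef B f + coef B f = 0.
  rewrite {1}coefE coefE' -big_split big1 // => a _; rewrite -big_split big1 // => b _ /=.
  case: (boolP [exists i, (i \notin S) && (bit i a != bit i b)]).
    move=> /existsP[i /andP[iS ab]].
    have ab' : bit i (flip a) != bit i (flip b).
      by rewrite !bit_flip; apply: contra ab => /eqP/addbI/eqP.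
    by rewrite !B0 ?mul0r ?addr0 //; exists i.
  move=> /existsPn ab.
  have {}ab i : i \notin S -> bit i a = bit i b.
    by move=> iS; apply/eqP; have := ab i; rewrite iS negbK.
  have <- : B a b = B (flip a) (flip b).
    apply: BE => i iS; rewrite !bit_flip; last by rewrite !ab.
    by case: eqVneq => // ij; rewrite -ij iS in jS.
  rewrite -mulrDr /P (bigD1 j) //= [X in _ + X](bigD1 j) //=.
  rewrite [X in _ + _ * X](eq_bigr (fun i => spin Q (f i) (bit i b) (bit i a))); last first.
    by move=> i ij; rewrite !bit_flip (negPf ij).
  rewrite -mulrDl !bit_flip eqxx ab //.
  have := spin_tr0 Q fj; case: (bit j b) => /= E; last by rewrite E mul0r mulr0.
  by rewrite addrC E mul0r mulr0.
by move/eqP; rewrite -mulr2n mulrn_eq0 /= => /eqP.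
Qed.

Lemma pstring_acts_on (S : {set 'I_N}) (f : {ffun 'I_N -> letter}) :
  (forall j, f j != LI -> j \in S) -> acts_on S (pstring f).
Proof.
move=> fS; split=> [a b [j jS ab]|a b c d H1 H2].
  rewrite mxE (bigD1 j) //=.
  have -> : f j = LI by apply/eqP; apply: contraNT jS => /fS.
  by rewrite /spin (negPf ab) mul0r.
rewrite !mxE; apply: eq_bigr => j _; have [jS|jS] := boolP (j \in S).
  by have [-> ->] := H1 j jS.
have -> : f j = LI by apply/eqP; apply: contraNT jS => /fS.
by have [-> ->] := H2 j jS; rewrite /= !eqxx.
Qed.

Lemma pstring_complete (A : op R N) : A = \sum_f ((2 ^+ N)^-1 * coef A f) *: pstring f.
Proof.
have nz : 2 ^+ N != 0 :> C by rewrite expf_neq0 // pnatr_eq0.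
(* The sum over strings factors into one completeness relation per site, each with a factor 2. *)
have key r c a b : \sum_f pstring f b a * pstring f r c = 2 ^+ N * ((a == r) && (b == c))%:R.
  under eq_bigr => f _ do rewrite !mxE -big_split /=.
  rewrite -(bigA_distr_bigA (fun i l => spin Q l (bit i b) (bit i a) * spin Q l (bit i r) (bit i c))) /=.
  under eq_bigr => i _ do rewrite spin_complete //.
  rewrite big_split /= prodr_const card_ord; congr (_ * _).
  case: eqVneq => [->|ar]; [case: eqVneq => [->|bc]|]; rewrite /=.
  - by rewrite big1 // => i _; rewrite !eqxx.
  - have /existsP[i bci] : [exists i : 'I_N, bit i b != bit i c].
      apply: contraNT bc => /existsPn bc; apply/eqP/bits_inj/ffunP => i; rewrite !ffunE.
      by apply/eqP; have := bc i; rewrite negbK.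
    by rewrite (bigD1 i) //= (negPf bci) andbF mul0r.
  - have /existsP[i ari] : [exists i : 'I_N, bit i a != bit i r].
      apply: contraNT ar => /existsPn ar; apply/eqP/bits_inj/ffunP => i; rewrite !ffunE.
      by apply/eqP; have := ar i; rewrite negbK.
    by rewrite (bigD1 i) //= (negPf ari) mul0r.
apply/matrixP => r c; rewrite summxE.
transitivity ((2 ^+ N)^-1 * \sum_a \sum_b A a b * \sum_f pstring f b a * pstring f r c).
  rewrite (bigD1 r) //= [X in _ + X]big1 ?addr0 => [|a ar]; last first.
    by rewrite big1 // => b _; rewrite key (negPf ar) !mulr0.
  rewrite (bigD1 c) //= [X in _ * (_ + X)]big1 ?addr0 => [|b bc].
    by rewrite key !eqxx mulr1 mulrCA mulVf ?mulr1.
  by rewrite key (negPf bc) andbF !mulr0.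
rewrite mulr_sumr [RHS](eq_bigr (fun f => \sum_a (2 ^+ N)^-1 * \sum_b A a b * (pstring f b a * pstring f r c))).
  rewrite [RHS]exchange_big /=; apply: eq_bigr => a _; rewrite -mulr_sumr; congr (_ * _).
  by rewrite exchange_big /=; apply: eq_bigr => b _; rewrite mulr_sumr.
move=> f _; rewrite !mxE /coef /mxtrace mulr_sumr mulr_suml; apply: eq_bigr => a _.
by rewrite -mulrA; congr (_ * _); rewrite [(_ *m _) _ _]mxE mulr_suml; apply: eq_bigr => b _; rewrite -mulrA.
Qed.

Lemma acts_onZ (S : {set 'I_N}) x (B : op R N) : acts_on S B -> acts_on S (x *: B).
Proof.
move=> [B0 BE]; split=> [a b ab|a b c d H1 H2]; rewrite !mxE.
  by rewrite B0 ?mulr0.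
by rewrite (BE a b c d).
Qed.

Lemma mem_interval i l j : (j \in Defs.interval i l) = [exists t : 'I_l, j == site N2 i t].
Proof.
rewrite inE; apply: eq_existsb => t; congr (_ == _).
elim: (val t) => [|m /= ->]; last by rewrite nxt_site.
by apply: val_inj; rewrite /= addn0 modn_small.
Qed.

(** The summands in [sum_supp_le] must have an exact support length, so the least admissible length
    is selected. *)
Lemma within_ksupp m (B : op R N) : within m B -> exists2 l, (l <= m)%N & ksupp_op l B.
Proof.
elim/ltn_ind: m => m IHm wm.
have [[l lm wl]|none] := EM (exists2 l, (l < m)%N & within l B).
  by have [l' l'l kl'] := IHm l lm wl; exists l' => //; exact: leq_trans l'l (ltnW lm).
by exists m => //; split=> // l lm wl; apply: none; exists l.
Qed.

Lemma sum_supp_le_string k (A : op R N) (f : {ffun 'I_N -> letter}) : (k <= N)%N ->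
  sum_supp_le k A -> coef A f != 0 ->
  exists s : 'I_N, forall j, f j != LI -> exists2 u, (u < k)%N & j = site N2 s u.
Proof.
move=> kN [s [sP ->]]; have -> : coef (\sum_(B <- s) B) f = \sum_(B <- s) coef B f.
  by rewrite /coef mulmx_suml raddf_sum.
move=> nz; have [B Bs Bnz] : exists2 B, B \in s & coef B f != 0.
  apply/hasP; apply: contraNT nz => /hasPn B0.
  by rewrite big_seq big1 // => B /B0; rewrite negbK => /eqP.
have [l lk [[[_ B0]|[i Bi]] _]] := sP B Bs.
  exists (site N2 0 0) => j fj; move: Bnz.
  by rewrite (acts_on_coef0 B0 fj) ?eqxx // inE.
exists i => j fj; have : j \in Defs.interval i l.
  by apply: contraNT Bnz => jS; rewrite (acts_on_coef0 Bi fj jS).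
by rewrite mem_interval => /existsP[t /eqP ->]; exists t => //; exact: leq_trans (ltn_ord t) lk.
Qed.

Lemma strings_sum_supp_le m (x : {ffun 'I_N -> letter} -> C) :
  (forall f, x f != 0 -> exists i : 'I_N, forall j, f j != LI -> j \in Defs.interval i m) ->
  sum_supp_le m (\sum_f x f *: pstring f).
Proof.
move=> xP; exists [seq x f *: pstring f | f <- enum {ffun 'I_N -> letter} & x f != 0]; split.
  move=> B /mapP[f]; rewrite mem_filter => /andP[/xP[i fi] _] ->.
  by apply: within_ksupp; right; exists i; apply/acts_onZ/pstring_acts_on.
rewrite big_map big_filter big_enum_cond /= [LHS](bigID (fun f => x f != 0)) /=.
by rewrite [X in _ + X]big1 ?addr0 // => f; rewrite negbK => /eqP ->; rewrite scale0r.
Qed.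

End Support.

Section NoConserved.
Variables (R : realType) (N : nat) (Q : 'M[R]_3).
Local Notation C := (R[i]).
Hypothesis QS : SO3 Q.
Variables (Jm : 'M[R]_3) (hv : 'I_3 -> R) (J h : letter -> R).
Hypothesis JmE : forall a b, a != LI -> b != LI -> Jm (axis a) (axis b) = if a == b then J a else 0.
Hypothesis hvE : forall a, a != LI -> hv (axis a) = h a.
Variable k : nat.
Hypotheses (k3 : (3 <= k)%N) (kN : (2 * k <= N)%N).
Hypothesis top0 : forall D, conserved_coeffs J h N k D ->
  forall i f, f 0%N != LI -> f k.-1 != LI -> D i k f = 0.

(** Once the strings with letters at both ends of a window of length [k] have disappeared, each
    remaining string fits into [k.-1] sites, so [A] is a sum of shorter operators. *)
Lemma no_conserved (A : op R N) : ~ ksupp_conserved (hamil (rsig Q) Jm hv) k A.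
Proof.
have N2 : (2 <= N)%N by lia.
move=> [[Ak nAk] AH]; apply: nAk.
have kN' : (k <= N)%N by lia.
have supp f : coef Q A f != 0 ->
    exists s, forall j, f j != LI -> exists2 u, (u < k)%N & j = site N2 s u.
  by move=> /(sum_supp_le_string N2 kN' Ak)[s sP]; exists s.
have ReZ (x : R) (y : C) : complex.Re (x%:C * y) = x * complex.Re y.
  by case: y => a b /=; rewrite mul0r subr0.
have ImZ (x : R) (y : C) : complex.Im (x%:C * y) = x * complex.Im y.
  by case: y => a b /=; rewrite mul0r addr0.
have ReD (x y : C) : complex.Re (x + y) = complex.Re x + complex.Re y by case: x; case: y.
have ImD (x y : C) : complex.Im (x + y) = complex.Im x + complex.Im y by case: x; case: y.
have cRe := place_coef_conserved QS JmE hvE AH k3 kN supp ReD ReZ.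
have cIm := place_coef_conserved QS JmE hvE AH k3 kN supp ImD ImZ.
have top i f : f 0%N != LI -> f k.-1 != LI -> coef Q A (place N i k f) = 0.
  move=> f0 fl; apply/eqP; rewrite eq_complex.
  by apply/andP; split; apply/eqP; [exact: top0 cRe i f f0 fl|exact: top0 cIm i f f0 fl].
rewrite (pstring_complete QS A); apply: strings_sum_supp_le => // f xf.
have [|s sP] := supp f; first by apply: contraNneq xf => ->; rewrite mulr0.
(* With an identity on the first site the window can start one site later; otherwise, as shown
   below, the last site carries an identity. *)
have [g0|g0] := eqVneq (f (site N2 s 0)) LI.
  exists (site N2 s 1) => j /[dup] fj /sP[[|u] uk ju].
    by rewrite ju g0 eqxx in fj.
  rewrite (mem_interval N2); apply/existsP; have uk' : (u < k.-1)%N by lia.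
  exists (Ordinal uk'); apply/eqP; rewrite ju; apply: val_inj.
  by rewrite /= modnDml -addnA add1n.
exists (site N2 s 0) => j /[dup] fj /sP[u uk ju].
have [uk1|uk1] := eqVneq u k.-1.
  have := top s (fun t => f (site N2 s t)) g0; rewrite -uk1 -ju => /(_ fj) E.
  have fE : place N s k (fun t => f (site N2 s t)) = f.
    apply: (@place_eqP N N2) => t tN; case: ltnP => // kt; apply/eqP; rewrite eq_sym.
    apply: contraT => /sP[w wk /(site_inj tN) tw]; lia.
  by move: xf; rewrite -fE E mulr0 eqxx.
rewrite (mem_interval N2); apply/existsP; have uk' : (u < k.-1)%N by lia.
exists (Ordinal uk'); apply/eqP; rewrite ju; apply: val_inj.
by rewrite /= modnDml addn0.
Qed.

End NoConserved.

(** * Rotations and the classification of the couplings *)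

Section Frames.
Variables (R : realType) (N k : nat).
Local Notation C := (R[i]).
Notation o0 := (ord0 : 'I_3).
Notation o1 := (lift ord0 ord0 : 'I_3).
Notation o2 := (ord_max : 'I_3).

Lemma exchange4 (V : nmodType) (I : finType) (F : I -> I -> I -> I -> V) :
  \sum_a \sum_b \sum_c \sum_d F a b c d = \sum_c \sum_d \sum_b \sum_a F a b c d.
Proof.
rewrite exchange_big /=.
under eq_bigr => b _ do rewrite exchange_big /=.
rewrite exchange_big /=; apply: eq_bigr => c _.
under eq_bigr => b _ do rewrite exchange_big /=.
by rewrite exchange_big.
Qed.

Definition rotv (Q : 'M[R]_3) (h : 'I_3 -> R) (a : 'I_3) : R := \sum_b Q b a * h b.

Lemma rsigM (Q P : 'M[R]_3) a (i : 'I_N) :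
  rsig (Q *m P) a i = \sum_c (Q a c)%:C *: rsig P c i.
Proof.
rewrite /rsig; under [RHS]eq_bigr => c _ do rewrite scaler_sumr.
rewrite exchange_big /=; apply: eq_bigr => b _.
rewrite mxE rmorph_sum scaler_suml; apply: eq_bigr => c _.
by rewrite scalerA -rmorphM.
Qed.

Lemma hamil_rot (Q P J : 'M[R]_3) h :
  hamil (@rsig R N P) (Q^T *m J *m Q) (rotv Q h) = hamil (@rsig R N (Q *m P)) J h.
Proof.
apply: eq_bigr => i _; congr (_ + _); last first.
  under [RHS]eq_bigr => a _ do rewrite rsigM scaler_sumr.
  rewrite exchange_big /=; apply: eq_bigr => b _.
  rewrite rmorph_sum scaler_suml; apply: eq_bigr => c _.
  by rewrite scalerA -rmorphM mulrC.
transitivity (\sum_(a : 'I_3) \sum_(b : 'I_3) \sum_(c : 'I_3) \sum_(d : 'I_3)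
    (Q a c * J a b * Q b d)%:C *: (rsig P c i *m rsig P d (nxt i))).
  rewrite exchange4; apply: eq_bigr => c _; apply: eq_bigr => d _.
  rewrite mxE rmorph_sum scaler_suml; apply: eq_bigr => b _.
  rewrite mxE mulr_suml rmorph_sum scaler_suml; apply: eq_bigr => a _.
  by rewrite mxE.
apply: eq_bigr => a _; apply: eq_bigr => b _.
rewrite !rsigM mulmx_suml scaler_sumr; apply: eq_bigr => c _.
rewrite mulmx_sumr scaler_sumr; apply: eq_bigr => d _.
by rewrite -scalemxAl -scalemxAr !scalerA -!rmorphM; congr ((_)%:C *: _); ring.
Qed.

Lemma SO3_mul (Q P : 'M[R]_3) : SO3 Q -> SO3 P -> SO3 (Q *m P).
Proof.
move=> [Q1 dQ] [P1 dP]; split; last by rewrite det_mulmx dQ dP mulr1.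
by rewrite trmx_mul mulmxA -(mulmxA P^T) Q1 mulmx1.
Qed.

Lemma SO3_tr (Q : 'M[R]_3) : SO3 Q -> SO3 Q^T.
Proof. by move=> [Q1 dQ]; split; rewrite ?det_tr ?trmxK //; exact: mulmx1C. Qed.

Lemma SO3_1 : SO3 (1%:M : 'M[R]_3).
Proof. by split; rewrite ?det1 // trmx1 mulmx1. Qed.

(** Quantifying over all frames [O] makes the property invariant under rotation of the couplings, so
    it may be proved after any convenient rotation. Couplings of an excluded model satisfy it
    vacuously. *)
Definition nonintegrable (J : 'M[R]_3) h :=
  (forall S, SO3 S -> ~ is_special_model (rotH N S J h)) ->
  forall O, SO3 O -> forall A, ~ ksupp_conserved (hamil (@rsig R N O) J h) k A.

Lemma nonintegrable_rot (Q J : 'M[R]_3) h : SO3 Q ->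
  nonintegrable J h -> nonintegrable (Q^T *m J *m Q) (rotv Q h).
Proof.
move=> QS nJ ns O OS A; rewrite hamil_rot; apply: nJ => [S SS|]; last exact: SO3_mul.
have QtS := SO3_mul (SO3_tr QS) SS.
have QQ : Q *m Q^T = 1%:M by exact: mulmx1C QS.1.
by have := ns _ QtS; rewrite /rotH hamil_rot mulmxA QQ mul1mx.
Qed.

Lemma rsig1 a (i : 'I_N) : rsig 1%:M a i = sig R a i.
Proof.
rewrite /rsig (bigD1 a) //= mxE eqxx scale1r big1 ?addr0 // => b ba.
by rewrite mxE eq_sym (negPf ba) scale0r.
Qed.

Lemma hamil_rsig1 J h : hamil (@rsig R N 1%:M) J h = H N J h.
Proof.
rewrite /H; congr (hamil _ J h); apply/funext => a; apply/funext => i; exact: rsig1.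
Qed.

Lemma special_nonintegrable J h : is_special_model (H N J h) -> nonintegrable J h.
Proof.
by move=> sp ns; case: (ns 1%:M SO3_1); rewrite /rotH hamil_rsig1.
Qed.

Definition mx3 a b c d e f g h i : 'M[R]_3 :=
  \matrix_(x, y) nth 0 (nth [::] [:: [:: a; b; c]; [:: d; e; f]; [:: g; h; i]] x) y.

Lemma mx3_eq (A B : 'M[R]_3) :
  [/\ A o0 o0 = B o0 o0, A o0 o1 = B o0 o1 & A o0 o2 = B o0 o2] ->
  [/\ A o1 o0 = B o1 o0, A o1 o1 = B o1 o1 & A o1 o2 = B o1 o2] ->
  [/\ A o2 o0 = B o2 o0, A o2 o1 = B o2 o1 & A o2 o2 = B o2 o2] -> A = B.
Proof.
have E (i : 'I_3) : [\/ i = o0, i = o1 | i = o2].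
  case: i => [[|[|[|m]]]] // im; [apply: Or31|apply: Or32|apply: Or33]; exact: val_inj.
move=> [? ? ?] [? ? ?] [? ? ?]; apply/matrixP => i j.
by case: (E i) => ->; case: (E j) => ->.
Qed.

Lemma vec3_eq (f g : 'I_3 -> R) : f o0 = g o0 -> f o1 = g o1 -> f o2 = g o2 -> f = g.
Proof.
move=> ? ? ?; apply/funext => i.
case: i => [[|[|[|m]]]] // im.
- by rewrite (_ : Ordinal im = o0) //; exact: val_inj.
- by rewrite (_ : Ordinal im = o1) //; exact: val_inj.
- by rewrite (_ : Ordinal im = o2) //; exact: val_inj.
Qed.

Lemma SO3_mx3 a b c d e f g h i (M := mx3 a b c d e f g h i) :
  a * a + d * d + g * g = 1 -> b * b + e * e + h * h = 1 -> c * c + f * f + i * i = 1 ->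
  a * b + d * e + g * h = 0 -> a * c + d * f + g * i = 0 -> b * c + e * f + h * i = 0 ->
  a * (e * i - f * h) - b * (d * i - f * g) + c * (d * h - e * g) = 1 -> SO3 M.
Proof.
move=> aa bb cc ab ac bc dt; split; last by rewrite det3 !mxE.
by apply: mx3_eq; split; rewrite !(mxE, sum_ord3) /= ?mulr1n ?mulr0n; lra.
Qed.


Definition rotZ c s := mx3 c s 0 (- s) c 0 0 0 1.

Lemma rotZ_SO3 c s : c * c + s * s = 1 -> SO3 (rotZ c s).
Proof. by move=> cs; apply: SO3_mx3; lra. Qed.

Definition rotY c s := mx3 c 0 (- s) 0 1 0 s 0 c.

Lemma rotY_SO3 c s : c * c + s * s = 1 -> SO3 (rotY c s).
Proof. by move=> cs; apply: SO3_mx3; lra. Qed.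

Definition cyc := mx3 0 1 0 0 0 1 1 0 0.

Lemma cyc_SO3 : SO3 cyc.
Proof. by apply: SO3_mx3; lra. Qed.

(** Polar coordinates without an angle; the last clause covers the zero vector, whose direction is
    arbitrary. *)
Lemma planar_rotation (x y : R) : exists c s r,
  [/\ c * c + s * s = 1, x = c * r, y = s * r & (r = 0 -> x = 0 /\ y = 0)].
Proof.
pose r := Num.sqrt (x ^+ 2 + y ^+ 2).
have [r0|r0] := eqVneq r 0.
  have : x ^+ 2 + y ^+ 2 = 0.
    have p : 0 <= x ^+ 2 + y ^+ 2 by rewrite addr_ge0 ?sqr_ge0.
    by rewrite -(sqr_sqrtr p) -/r r0 expr0n.
  move=> /eqP; rewrite paddr_eq0 ?sqr_ge0 // !sqrf_eq0 => /andP[/eqP-> /eqP->].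
  by exists 1, 0, 0; split; rewrite ?mulr0 //; ring.
exists (x / r), (y / r), r; split; rewrite ?divfK //; last by move=> E; rewrite E eqxx in r0.
have rr : r * r = x ^+ 2 + y ^+ 2 by rewrite -expr2 sqr_sqrtr // addr_ge0 ?sqr_ge0.
have -> : x / r * (x / r) + y / r * (y / r) = (x ^+ 2 + y ^+ 2) / (r * r) by field.
by rewrite -rr divff // mulf_neq0.
Qed.

Lemma nonintegrable_cyc a b c x y z :
  nonintegrable (cJ b c a) (cvec y z x) -> nonintegrable (cJ a b c) (cvec x y z).
Proof.
move=> /(nonintegrable_rot cyc_SO3).
have -> : cyc^T *m cJ b c a *m cyc = cJ a b c.
  by apply: mx3_eq; split; rewrite !(mxE, sum_ord3) /= !(mul0r, mulr0, add0r, addr0, mulr1, mul1r).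
have -> // : rotv cyc (cvec y z x) = cvec x y z.
by apply: vec3_eq; rewrite /rotv sum_ord3 !mxE /cvec /=; ring.
Qed.

Lemma nonintegrable_rotZ a b x y z : exists r, (r = 0 -> x = 0 /\ y = 0) /\
  (nonintegrable (cJ a a b) (cvec r 0 z) -> nonintegrable (cJ a a b) (cvec x y z)).
Proof.
have [c [s [r [cs xr yr r0]]]] := planar_rotation x y.
exists r; split=> // /(nonintegrable_rot (rotZ_SO3 cs)).
have -> : (rotZ c s)^T *m cJ a a b *m rotZ c s = cJ a a b.
  by apply: mx3_eq; split; rewrite !(mxE, sum_ord3) /=;
    first [ring|transitivity (a * (c * c + s * s)); [ring|by rewrite cs mulr1]].
have -> // : rotv (rotZ c s) (cvec r 0 z) = cvec x y z.
by apply: vec3_eq; rewrite /rotv sum_ord3 !mxE /cvec /= ?xr ?yr; ring.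
Qed.


(** An isotropic coupling is invariant under every rotation, so the field can be turned to the [Z]
    axis, which gives the XXX model. *)
Lemma nonintegrable_scalar a x y z : nonintegrable (cJ a a a) (cvec x y z).
Proof.
have [r [_]] := nonintegrable_rotZ a a x y z; apply.
have [c [s [t [cs zt rt _]]]] := planar_rotation z r.
have special : nonintegrable (cJ a a a) (cvec 0 0 t).
  by apply: special_nonintegrable; left; exists a, t.
have := nonintegrable_rot (rotY_SO3 cs) special.
have -> : (rotY c s)^T *m cJ a a a *m rotY c s = cJ a a a.
  by apply: mx3_eq; split; rewrite !(mxE, sum_ord3) /=;
    first [ring|transitivity (a * (c * c + s * s)); [ring|by rewrite cs mulr1]].
have -> // : rotv (rotY c s) (cvec 0 0 t) = cvec r 0 z.
by apply: vec3_eq; rewrite /rotv sum_ord3 !mxE /cvec /= ?rt ?zt; ring.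
Qed.

Hypotheses (k3 : (3 <= k)%N) (kN : (2 * k <= N)%N).

Definition letter_vec (a b c : R) (l : letter) : R :=
  match l with LX => a | LY => b | LZ => c | LI => 0 end.

Lemma nonintegrable_diag a b c x y z :
  (forall D, conserved_coeffs (letter_vec a b c) (letter_vec x y z) N k D ->
     forall i f, f 0%N != LI -> f k.-1 != LI -> D i k f = 0) ->
  nonintegrable (cJ a b c) (cvec x y z).
Proof.
move=> top0 _ O OS A; apply: (no_conserved OS (J := letter_vec a b c) (h := letter_vec x y z)) => //.
  by case; case=> // _ _; rewrite mxE.
by case.
Qed.

Lemma nonintegrable_rank1 c x y z : c != 0 -> nonintegrable (cJ 0 0 c) (cvec x y z).
Proof.
move=> c0; have [r [r0]] := nonintegrable_rotZ 0 c x y z; apply.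
have [rE|rN] := eqVneq r 0.
  by rewrite rE; apply: special_nonintegrable; do 5!right; left; exists c, z.
have [->|zN] := eqVneq z 0.
  by apply: special_nonintegrable; do 4!right; left; exists c, r.
by apply: nonintegrable_diag => D CC i f; apply: (rank1_top0 CC).
Qed.

Lemma nonintegrable_rank2 a b x y z : a != 0 -> b != 0 ->
  nonintegrable (cJ a b 0) (cvec x y z).
Proof.
move=> a0 b0; have [xE|xN] := eqVneq x 0; last first.
  (* The field acting is along [bar a], so a field along [X] calls for the mark [LY]. *)
  by apply: nonintegrable_diag => D CC i f; apply: (rank2_top0 CC _ _ _ _ _ (a := LY)).
have [yE|yN] := eqVneq y 0; last first.
  by apply: nonintegrable_diag => D CC i f; apply: (rank2_top0 CC _ _ _ _ _ (a := LX)).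
rewrite xE yE; apply: special_nonintegrable; do 3!right; left; exists a, b, z.
by [].
Qed.

Lemma nonintegrable_rank3_axis a b c z : a != 0 -> b != 0 -> c != 0 ->
  nonintegrable (cJ a b c) (cvec 0 0 z).
Proof.
move=> a0 b0 c0; have [<-|ab] := eqVneq a b.
  by apply: special_nonintegrable; right; left; exists a, c, z.
have [->|zN] := eqVneq z 0.
  by apply: special_nonintegrable; do 2!right; left; exists a, b, c.
apply: nonintegrable_diag => D CC i f.
by apply: (rank3_top0 CC _ _ _ (x := LX) (y := LY)) => //; case.
Qed.

(** [rank3_top0] needs two unequal couplings and a field component along the third axis. If there
    are none, a field along a single axis leaves XXZ or XYZ, and two or more components force all
    couplings to be equal. *)
Lemma nonintegrable_rank3 a b c x y z : a != 0 -> b != 0 -> c != 0 ->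
  nonintegrable (cJ a b c) (cvec x y z).
Proof.
move=> a0 b0 c0; have JN l : l != LI -> letter_vec a b c l != 0 by case: l.
have [xE|xN] := eqVneq x 0; have [yE|yN] := eqVneq y 0.
- by rewrite xE yE; exact: nonintegrable_rank3_axis.
- have [zE|zN] := eqVneq z 0.
    by rewrite xE zE; apply/nonintegrable_cyc/nonintegrable_cyc/nonintegrable_rank3_axis.
  have [ac|ac] := eqVneq a c; last first.
    by apply: nonintegrable_diag => D CC i f; apply: (rank3_top0 CC _ _ _ (x := LX) (y := LZ)).
  have [ab|ab] := eqVneq a b; last first.
    by apply: nonintegrable_diag => D CC i f; apply: (rank3_top0 CC _ _ _ (x := LX) (y := LY)).
  by rewrite -ab -ac; exact: nonintegrable_scalar.
- have [zE|zN] := eqVneq z 0.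
    by rewrite yE zE; apply/nonintegrable_cyc/nonintegrable_rank3_axis.
  have [bc|bc] := eqVneq b c; last first.
    by apply: nonintegrable_diag => D CC i f; apply: (rank3_top0 CC _ _ _ (x := LY) (y := LZ)).
  have [ab|ab] := eqVneq a b; last first.
    by apply: nonintegrable_diag => D CC i f; apply: (rank3_top0 CC _ _ _ (x := LX) (y := LY)).
  by rewrite -bc -ab; exact: nonintegrable_scalar.
- have [ac|ac] := eqVneq a c; last first.
    by apply: nonintegrable_diag => D CC i f; apply: (rank3_top0 CC _ _ _ (x := LX) (y := LZ)).
  have [bc|bc] := eqVneq b c; last first.
    by apply: nonintegrable_diag => D CC i f; apply: (rank3_top0 CC _ _ _ (x := LY) (y := LZ)).
  by rewrite bc ac; exact: nonintegrable_scalar.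
Qed.

Lemma nonintegrable_cJ a b c x y z : nonintegrable (cJ a b c) (cvec x y z).
Proof.
have [aE|aN] := eqVneq a 0; have [bE|bN] := eqVneq b 0; have [cE|cN] := eqVneq c 0.
- by rewrite aE bE cE; exact: nonintegrable_scalar.
- by rewrite aE bE; exact: nonintegrable_rank1.
- by rewrite aE cE; apply/nonintegrable_cyc/nonintegrable_cyc/nonintegrable_rank1.
- by rewrite aE; apply/nonintegrable_cyc/nonintegrable_rank2.
- by rewrite bE cE; apply/nonintegrable_cyc/nonintegrable_rank1.
- by rewrite bE; apply/nonintegrable_cyc/nonintegrable_cyc/nonintegrable_rank2.
- by rewrite cE; exact: nonintegrable_rank2.
- exact: nonintegrable_rank3.
Qed.

End Frames.

(** * Diagonalisation of the coupling matrix by a rotation *)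

Section Diagonalisation.
Variables (R : realType).
Notation o0 := (ord0 : 'I_3).
Notation o1 := (lift ord0 ord0 : 'I_3).
Notation o2 := (ord_max : 'I_3).

(* The characteristic polynomial has odd degree, hence a real root. *)
Lemma eigenvector_frame (J : 'M[R]_3) : exists Q la, SO3 Q /\
  forall m, Q o2 o0 * J o0 m + Q o2 o1 * J o1 m + Q o2 o2 * J o2 m = la * Q o2 m.
Proof.
have [|la] := @odd_poly_root _ (char_poly J); first by rewrite size_char_poly.
rewrite -eigenvalue_root_char => /eigenvalueP[v vJ v0].
have [c [s [r [cs v0r v1r r0]]]] := planar_rotation (v 0 o0) (v 0 o1).
have [c' [s' [t [cs' v2t rt t0]]]] := planar_rotation (v 0 o2) r.
have tN : t != 0.
  apply: contraNneq v0 => /t0[v20 /r0[v00 v10]]; apply/eqP/matrixP => i j.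
  rewrite !ord1 mxE; case: j => [[|[|[|m]]]] // im.
  - by rewrite (_ : Ordinal im = o0) //; exact: val_inj.
  - by rewrite (_ : Ordinal im = o1) //; exact: val_inj.
  - by rewrite (_ : Ordinal im = o2) //; exact: val_inj.
exists (rotY c' s' *m rotZ c s), la; split.
  by apply: SO3_mul; [exact: rotY_SO3|exact: rotZ_SO3].
set Q := _ *m _.
have QE m : t * Q o2 m = v 0 m.
  case: m => [[|[|[|m]]]] // im.
  - rewrite (_ : Ordinal im = o0); last exact: val_inj.
    by rewrite v0r rt !(mxE, sum_ord3) /=; ring.
  - rewrite (_ : Ordinal im = o1); last exact: val_inj.
    by rewrite v1r rt !(mxE, sum_ord3) /=; ring.
  - rewrite (_ : Ordinal im = o2); last exact: val_inj.
    by rewrite v2t !(mxE, sum_ord3) /=; ring.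
move=> m; apply: (mulfI tN).
have /matrixP/(_ 0 m) E := vJ; rewrite !mxE sum_ord3 -!QE in E.
transitivity (la * (t * Q o2 m)); last by ring.
by rewrite -E; ring.
Qed.

Lemma diagonalise_block (J : 'M[R]_3) : J^T = J -> J o2 o0 = 0 -> J o2 o1 = 0 ->
  exists Q a b c, SO3 Q /\ J = Q^T *m cJ a b c *m Q.
Proof.
move=> Js J20 J21; have sym i j : J i j = J j i by rewrite -{1}Js mxE.
pose p := J o0 o0; pose q := J o0 o1; pose u := J o1 o1.
(* The second equation is the vanishing of the off-diagonal entry of the block in the basis
   [(c, s)], [(- s, c)]. *)
have [c [s [cs E]]] : exists c s, c * c + s * s = 1 /\ q * (c * c - s * s) + c * s * (u - p) = 0.
  have [q0|q0] := eqVneq q 0; first by exists 1, 0; split; rewrite ?q0; ring.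
  (* For the larger eigenvalue of the block, [w] is this eigenvalue minus [p], so that [(q, w)] is
     an eigenvector. *)
  pose w := (u - p + Num.sqrt ((u - p) ^+ 2 + 4%:R * q ^+ 2)) / 2%:R.
  have wE : w * w + w * (p - u) - q * q = 0.
    have S : Num.sqrt ((u - p) ^+ 2 + 4%:R * q ^+ 2) ^+ 2 = (u - p) ^+ 2 + 4%:R * q ^+ 2.
      rewrite sqr_sqrtr //; apply: addr_ge0; first exact: sqr_ge0.
      by apply: mulr_ge0; [exact: ler0n|exact: sqr_ge0].
    rewrite /w; set S' := Num.sqrt _ in S *; clearbody S'.
    transitivity ((S' ^+ 2 - (u - p) ^+ 2 - 4%:R * q ^+ 2) / 4%:R); first by field.
    by rewrite S; ring.
  have [c [s [r [cs qr wr r0]]]] := planar_rotation q w.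
  have rN : r != 0 by apply: contraNneq q0 => /r0[qz _]; apply/eqP.
  exists c, s; split=> //; apply: (mulfI rN); apply: (mulfI rN); rewrite !mulr0.
  have -> : r * (r * (q * (c * c - s * s) + c * s * (u - p)))
    = q * ((c * r) * (c * r) - (s * r) * (s * r)) + (c * r) * (s * r) * (u - p) by ring.
  rewrite -qr -wr; transitivity (- (q * (w * w + w * (p - u) - q * q))); first by ring.
  by rewrite wE mulr0 oppr0.
exists (rotZ c s), (c * c * p + 2%:R * c * s * q + s * s * u),
  (s * s * p - 2%:R * c * s * q + c * c * u), (J o2 o2).
split; first exact: rotZ_SO3.
have c2 : c * c = 1 - s * s by rewrite -cs; ring.
apply: mx3_eq; split; rewrite !(mxE, sum_ord3) /=.
- transitivity (p * (c * c + s * s) ^+ 2 + 2%:R * c * s * (q * (c * c - s * s) + c * s * (u - p))).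
    by rewrite cs E /p; ring.
  by ring.
- transitivity (q * (c * c + s * s) ^+ 2 - (c * c - s * s) * (q * (c * c - s * s) + c * s * (u - p))).
    by rewrite cs E /q; ring.
  by ring.
- by rewrite sym J20; ring.
- rewrite sym; transitivity (q * (c * c + s * s) ^+ 2
    - (c * c - s * s) * (q * (c * c - s * s) + c * s * (u - p))).
    by rewrite cs E /q; ring.
  by ring.
- transitivity (u * (c * c + s * s) ^+ 2 - 2%:R * c * s * (q * (c * c - s * s) + c * s * (u - p))).
    by rewrite cs E /u; ring.
  by ring.
- by rewrite sym J21; ring.
- by rewrite J20; ring.
- by rewrite J21; ring.
- by ring.
Qed.

(** With an eigenvector as third row of the frame, symmetry makes the third row and column diagonal,
    and the remaining block is treated by [diagonalise_block]. *)
Lemma diagonalise (J : 'M[R]_3) : J^T = J ->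
  exists Q a b c, SO3 Q /\ J = Q^T *m cJ a b c *m Q.
Proof.
move=> Js; have [P [la [PS PE]]] := eigenvector_frame J.
have PP : P^T *m P = 1%:M by case: PS.
pose J' := P *m J *m P^T.
have J'2 j : J' o2 j = la * (o2 == j)%:R.
  rewrite /J' !(mxE, sum_ord3) !PE -(SO3_orth PS o2 j); ring.
have J's : J'^T = J' by rewrite /J' !trmx_mul trmxK Js mulmxA.
have [||Q [a [b [c [QS QE]]]]] := diagonalise_block J's; try by rewrite J'2 mulr0.
exists (Q *m P), a, b, c; split; first exact: SO3_mul.
rewrite trmx_mul -!mulmxA [Q^T *m _]mulmxA [(_ *m _) *m (Q *m P)]mulmxA -QE /J' !mulmxA PP mul1mx.
by rewrite -mulmxA PP mulmx1.
Qed.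

Lemma nonintegrable_sym N k (J : 'M[R]_3) h : (3 <= k)%N -> (2 * k <= N)%N ->
  J^T = J -> nonintegrable N k J h.
Proof.
move=> k3 kN /diagonalise[Q [a [b [c [QS ->]]]]].
have -> : h = rotv Q (cvec (rotv Q^T h o0) (rotv Q^T h o1) (rotv Q^T h o2)).
  apply/funext => i; rewrite /rotv sum_ord3 /cvec /= !sum_ord3 !mxE.
  transitivity (\sum_j (Q o0 i * Q o0 j + Q o1 i * Q o1 j + Q o2 i * Q o2 j) * h j).
    rewrite (bigD1 i) //= big1 ?addr0 => [|j ji]; rewrite (SO3_orthT QS) ?eqxx ?mul1r //.
    by rewrite eq_sym (negPf ji) mul0r.
  by rewrite sum_ord3; ring.
by apply: nonintegrable_rot => //; exact: nonintegrable_cJ.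
Qed.

End Diagonalisation.

Theorem theorem1 (R : realType) (N : nat) (J : 'M[R]_3) (h : 'I_3 -> R) :
  (6 <= N)%N ->
  J^T = J ->
  ~ (exists Q : 'M[R]_3, SO3 Q /\ is_special_model (rotH N Q J h)) ->
  forall k : nat, (3 <= k)%N -> (2 * k <= N)%N ->
  ~ (exists Q : op R N, ksupp_conserved (H N J h) k Q).
Proof.
move=> _ Js ns k k3 kN [A]; rewrite -hamil_rsig1.
apply: (nonintegrable_sym k3 kN Js _ (SO3_1 R)) => S SS sp.
by apply: ns; exists S.
Qed.
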